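(* Let $n\ge3$, $0<2s<n$, and $g=\varphi^{\frac4{n-2s}}g_{\mathbb{S}^n}$ with $\varphi\in C^\infty(\mathbb{S}^n)$ positive. Let $P_s=\frac{\Gamma(B+\frac12+s)}{\Gamma(B+\frac12-s)}$, $B=\sqrt{-\Delta_{g_{\mathbb{S}^n}}+(\frac{n-1}2)^2}$, $P^g_s(u)=\varphi^{-\frac{n+2s}{n-2s}}P_s(\varphi u)$, $R^g_s=P^g_s(1)$, $c_{n,s}=\frac{\Gamma(\frac n2-s)}{\pi^{n/2}2^{2s}\Gamma(s)}$ and $\mathcal K(\zeta,\omega)=\varphi(\zeta)\varphi(\omega)|\zeta-\omega|^{n-2s}$ ($|\cdot|$ Euclidean in $\mathbb{R}^{n+1}$). Let $f:\mathbb{R}\to\mathbb{R}$ be continuous and consider $$P^g_su-R^g_su=f(u)\ \text{ on }\mathbb{S}^n,\qquad(D)$$ $$u(\zeta)=c_{n,s}\int_{\mathbb{S}^n}\frac{f(u)(\omega)+R^g_s(\omega)u(\omega)}{\mathcal K(\zeta,\omega)}d\upsilon_g^{(\omega)},\ \zeta\in\mathbb{S}^n.\qquad(I)$$ Then: (i) any continuous nonnegative solution of $(I)$ is also a solution of $(D)$; (ii) if $f(t)+R^g_s(\zeta)t\ge0$ for all $\zeta\in\mathbb{S}^n$ and $t\ge0$, then any nonnegative smooth solution of $(D)$ is also a solution of $(I)$. *)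

(* Defs.v *)
From HB Require Import structures.
From mathcomp Require Import all_boot all_order all_algebra.
From mathcomp Require Import all_classical all_reals all_analysis.
From mathcomp Require mpoly.

Unset Printing Implicit Defensive.

Import Order.TTheory GRing.Theory Num.Theory.
Import numFieldNormedType.Exports.
Local Open Scope classical_set_scope.
Local Open Scope ring_scope.

Section Defs.
Context {R : realType}.

Definition esq {m : nat} (x : 'rV[R]_m) : R := \sum_(i < m) x ord0 i ^+ 2.
Definition edist {m : nat} (x y : 'rV[R]_m) : R := Num.sqrt (esq (x - y)).

Definition sphere (n : nat) : set 'rV[R]_(n.+1) := [set x | esq x = 1].

(** Iterated Lebesgue integral over R^k (integrand given on lists of
    coordinates): for integrable (or nonnegative measurable) F this is the
    Lebesgue integral over R^k, by Fubini--Tonelli. *)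
Fixpoint iint (k : nat) (F : seq R -> \bar R) : \bar R :=
  match k with
  | 0 => F [::]
  | k'.+1 => (\int[@lebesgue_measure R]_x iint k' (fun t => F (x :: t)))%E
  end.

Definition ysq (n : nat) (y : seq R) : R := \sum_(i < n) (nth 0 y i) ^+ 2.
Definition istereo (n : nat) (y : seq R) : 'rV[R]_(n.+1) :=
  \row_(i < n.+1)
    (if (i < n)%N then 2 * nth 0 y i / (1 + ysq n y)
     else (ysq n y - 1) / (1 + ysq n y)).

(** Integral over S^n w.r.t. the standard (round) volume measure, computed
    in stereographic coordinates (the north pole is a null set). *)
Definition sint (n : nat) (h : 'rV[R]_(n.+1) -> R) : \bar R :=
  iint n (fun y => (h (istereo n y) * (2 / (1 + ysq n y)) ^+ n)%:E).

Definition Gamma (x : R) : R :=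
  fine (\int[@lebesgue_measure R]_(t in `]0%R, +oo[)
          ((t `^ (x - 1)) * expR (- t))%:E)%E.

Definition sph_harm (n k : nat) (Y : 'rV[R]_(n.+1) -> R) : Prop :=
  exists p : mpoly.mpoly n.+1 R,
    all (fun m => mpoly.mdeg m == k) (mpoly.msupp p) /\
    \sum_(i < n.+1) mpoly.mderiv i (mpoly.mderiv i p) = 0 /\
    forall x, sphere n x -> Y x = mpoly.meval (fun i => x ord0 i) p.

(** Eigenvalue of P_s = Gamma(B+1/2+s)/Gamma(B+1/2-s) on degree-k spherical
    harmonics, where B = k + (n-1)/2 there. *)
Definition Ps_eig (n : nat) (s : R) (k : nat) : R :=
  Gamma (k%:R + n%:R / 2 + s) / Gamma (k%:R + n%:R / 2 - s).

(** [Ps_eq n s w h] : "P_s w = h on S^n", in the (spectral/distributional)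
    weak sense: tested against every spherical harmonic Y of degree k, on
    which P_s acts as multiplication by Ps_eig n s k. *)
Definition Ps_eq (n : nat) (s : R) (w h : 'rV[R]_(n.+1) -> R) : Prop :=
  forall (k : nat) (Y : 'rV[R]_(n.+1) -> R), sph_harm n k Y ->
    sint n (fun x => h x * Y x) = ((Ps_eig n s k)%:E * sint n (fun x => (w x * Y x)%R))%E.

Definition cexp (n : nat) (s : R) : R := (n%:R + 2 * s) / (n%:R - 2 * s).

(** [Pg_eq n s phi u h] : "P^g_s u = h" for g = phi^{4/(n-2s)} g_{S^n},
    where P^g_s u = phi^{-(n+2s)/(n-2s)} P_s (phi u); i.e.
    P_s(phi u) = phi^{(n+2s)/(n-2s)} h. *)
Definition Pg_eq (n : nat) (s : R) (phi u h : 'rV[R]_(n.+1) -> R) : Prop :=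
  Ps_eq n s (fun x => phi x * u x) (fun x => phi x `^ cexp n s * h x).

Definition cns (n : nat) (s : R) : R :=
  Gamma (n%:R / 2 - s) / (pi `^ (n%:R / 2) * 2 `^ (2 * s) * Gamma s).

Definition Kker (n : nat) (s : R) (phi : 'rV[R]_(n.+1) -> R)
  (z w : 'rV[R]_(n.+1)) : R :=
  phi z * phi w * edist z w `^ (n%:R - 2 * s).

(** Volume form of g = phi^{4/(n-2s)} g_{S^n}: dv_g = phi^{2n/(n-2s)} dsigma. *)
Definition vol_dens (n : nat) (s : R) (phi : 'rV[R]_(n.+1) -> R)
  (w : 'rV[R]_(n.+1)) : R := phi w `^ (2 * n%:R / (n%:R - 2 * s)).

Fixpoint iderive {m : nat} (vs : seq 'rV[R]_m) (F : 'rV[R]_m -> R)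
  : 'rV[R]_m -> R :=
  match vs with
  | [::] => F
  | v :: vs' => fun x => derive (iderive vs' F) x v
  end.

Definition Cinf {m : nat} (F : 'rV[R]_m -> R) : Prop :=
  forall vs : seq 'rV[R]_m, continuous (iderive vs F) /\
    forall x v, derivable (iderive vs F) x v.

Definition smooth_on_sphere (n : nat) (u : 'rV[R]_(n.+1) -> R) : Prop :=
  exists F : 'rV[R]_(n.+1) -> R, Cinf F /\ forall x, sphere n x -> F x = u x.

End Defs.

(* Main.v *)
(* In stereographic coordinates |z - w|^(-2a), with a = n/2 - s, equals
   4^(-a) (1 - v)^(-a) for v = (1 + <z, w>) / 2 in [0, 1], so (I) reads
   phi u = kappa * (F convolved with (1 - v)^(-a)), where F is phi to the power
   (n+2s)/(n-2s) times f(u) + R u, while (D) compares the moments of F and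
   phi u against the spherical harmonics.  The two match by the Funk-Hecke
   formula: the divergence theorem gives a two-term recursion for the moments
   of v^N against a harmonic of degree k, summing over the binomial series of
   (1 - v)^(-a) makes a telescoping contiguity relation between the multipliers
   for k and k + 1, and k = 0 is a Gaussian integral at the north pole.
   Part (i) is then Fubini.  For (ii), the continuous function
   kappa * (F convolved with (1 - v)^(-a)) - phi u is orthogonal to all
   harmonics, hence (through the zonal ones) to every power v^N, and these
   concentrate at z. *)
Require Import Defs.
From HB Require Import structures.
From mathcomp Require Import all_boot all_order all_algebra.
From mathcomp Require Import all_classical all_reals all_analysis.
From mathcomp Require Import measurable_realfun.
From mathcomp Require Import ring lra zify.
From mathcomp Require mpoly.
Import (canonicals) mpoly.

Set Implicit Arguments.
Unset Strict Implicit.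
Unset Printing Implicit Defensive.

Import Order.TTheory GRing.Theory Num.Theory.
Import numFieldNormedType.Exports.
Local Open Scope classical_set_scope.
Local Open Scope ring_scope.


(** The round measure is given only as an iterated integral in stereographic coordinates, so
    rotating the sphere would mean an awkward change of variables. Rotation invariance enters
    through the moments instead: the moment of v^N against a harmonic p is p(z) times a number
    independent of z. This is why the constant of the kernel may be computed at the pole alone,
    where 1 - v = 1 / (1 + |y|^2). The divergence theorem is flat as well: the gradient field of a
    coordinate function times a polynomial becomes a field on R^n decaying along every line, and
    each partial derivative integrates to zero by Fubini. A single partial derivative carries only
    the weight [rho] to the power n - 1, which is integrable when n < 2 (n - 1); this is one place
    where n >= 3 acts. The kernel is unbounded near z, so it is reached through its truncated
    series. The error is bounded by the tail of one numerical series that does not involve z, and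
    this uniformity gives both termwise integration and the continuity of potentials. *)

(** * Fundamental theorem of calculus on an increasing union of segments *)

Section FTC_exhaustion.
Context {R : realType}.
Let mu : {measure set (measurableTypeR R) -> \bar R} := @lebesgue_measure R.
Variables (a b : nat -> R) (F f : R -> R) (l : R).
Let D := \bigcup_k `[a k, b k]%classic.
Hypothesis ab : forall k, a k < b k.
Hypothesis nd : forall k, a k.+1 <= a k /\ b k <= b k.+1.
Hypothesis dF : forall x, D x -> is_derive x (1:R) F (f x).
Hypothesis cf : forall x, D x -> {for x, continuous f}.
Hypothesis Fl : (fun k => F (b k) - F (a k)) @ \oo --> l.

Lemma FTC_segment k : (\int[mu]_(x in `[a k, b k]) (f x)%:E = (F (b k) - F (a k))%:E)%E.
Proof.
have sub x : x \in `[a k, b k] -> D x by move=> ?; exists k.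
have cF x : x \in `[a k, b k] -> {for x, continuous F}.
  move=> /sub/dF h; apply: differentiable_continuous.
  by apply/derivable1_diffP; exact: ex_derive.
rewrite (@continuous_FTC2 _ f F) ?EFinB//.
- apply/subspace_continuousP => x xab; apply: cvg_within_filter.
  by apply: cf; apply: sub.
- split.
  + move=> x xab; apply: ex_derive; apply: dF; apply: sub.
    by apply: subset_itv_oo_cc xab.
  + apply: cvg_at_right_filter; apply: cF.
    by rewrite in_itv/= lexx ltW.
  + apply: cvg_at_left_filter; apply: cF.
    by rewrite in_itv/= lexx ltW.
- move=> x xab; rewrite derive1E; apply: derive_val; apply: dF; apply: sub.
  by apply: subset_itv_oo_cc xab.
Qed.

Lemma segment_nondecreasing : nondecreasing_seq (fun k => `[a k, b k]%classic).
Proof.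
apply/nondecreasing_seqP => k; apply/subsetPset => x /=.
by rewrite !in_itv/= => /andP[? ?]; have [? ?] := nd k; apply/andP; split; lra.
Qed.

Lemma exhaustion_measurable_fun : measurable_fun D f.
Proof.
apply/measurable_fun_bigcup => // k; apply: subspace_continuous_measurable_fun => //.
apply/subspace_continuousP => x xab; apply: cvg_within_filter.
by apply: cf; exists k.
Qed.

(** Monotone convergence along the segments. Finiteness of the integral is a result here, read off
    from the limit of the boundary values. *)
Lemma FTC_exhaustion_ge0 : (forall x, D x -> 0 <= f x) ->
  (\int[mu]_(x in D) (f x)%:E = l%:E)%E.
Proof.
move=> f0.
have := @ge0_nondecreasing_set_cvg_integral _ (measurableTypeR R) R (fun k => `[a k, b k]%classic)
  (EFin \o f) mu segment_nondecreasing.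
move=> /(_ (fun=> measurable_itv _)).
have mfk k : measurable_fun `[a k, b k] (EFin \o f).
  apply/measurable_EFinP; apply: measurable_funS exhaustion_measurable_fun.
    exact: bigcup_measurable.
  by move=> x ?; exists k.
move=> /(_ mfk); have f0' k x : `[a k, b k]%classic x -> (0 <= (EFin \o f) x)%E.
  by move=> ?; rewrite lee_fin f0//; exists k.
move=> /(_ f0') /cvg_lim <- //; apply/cvg_lim => //.
rewrite (_ : (fun i => _) = (fun k => (F (b k) - F (a k))%:E)); last first.
  by apply/funext => k; rewrite -FTC_segment.
by apply: cvg_EFin => //; exact: nearW.
Qed.

(** For a signed derivative, monotone convergence is applied to the positive and negative parts;
    integrability makes the difference of the two limits well defined. *)
Lemma FTC_exhaustion : mu.-integrable D (EFin \o f) ->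
  (\int[mu]_(x in D) (f x)%:E = l%:E)%E.
Proof.
move=> fi.
have mfk k : measurable_fun `[a k, b k] (EFin \o f).
  apply/measurable_EFinP; apply: measurable_funS exhaustion_measurable_fun.
    exact: bigcup_measurable.
  by move=> x ?; exists k.
have cp := @ge0_nondecreasing_set_cvg_integral _ (measurableTypeR R) R (fun k => `[a k, b k]%classic)
  (EFin \o f)^\+%E mu segment_nondecreasing (fun=> measurable_itv _)
  (fun k => measurable_funepos (mfk k)) (fun _ _ _ => funepos_ge0 _ _).
have cn := @ge0_nondecreasing_set_cvg_integral _ (measurableTypeR R) R (fun k => `[a k, b k]%classic)
  (EFin \o f)^\-%E mu segment_nondecreasing (fun=> measurable_itv _)
  (fun k => measurable_funeneg (mfk k)) (fun _ _ _ => funeneg_ge0 _ _).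
have := cvgeB _ cp cn.
rewrite (_ : (fun i => _) = (fun k => (F (b k) - F (a k))%:E)); last first.
  by apply/funext => k; rewrite -FTC_segment [RHS]integralE.
rewrite [(\int[mu]_(x in D) (f x)%:E)%E]integralE => h.
have mD : measurable (D : set (measurableTypeR R)) by exact: bigcup_measurable.
have fp := integrable_pos_fin_num mD fi.
have {}h := h _ (fin_num_adde_defr _ fp).
apply: (@cvg_unique _ (@ereal_hausdorff R) _ _ _ _ (h _)).
by apply: cvg_EFin => //; exact: nearW.
Qed.

End FTC_exhaustion.

Section pointwise_derivatives.
Context {R : realType}.
Implicit Types (f g : R -> R) (x a b : R).

Lemma is_derive_mul f g x a b : is_derive x 1 f a -> is_derive x 1 g b ->
  is_derive x (1:R) (fun t => f t * g t) (a * g x + f x * b).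
Proof.
by move=> fa gb; apply: (is_derive_eq (is_deriveM fa gb)); rewrite /GRing.scale/=; ring.
Qed.

Lemma is_derive_add f g x a b : is_derive x 1 f a -> is_derive x 1 g b ->
  is_derive x (1:R) (fun t => f t + g t) (a + b).
Proof. exact: is_deriveD. Qed.

Lemma is_derive_sub f g x a b : is_derive x 1 f a -> is_derive x 1 g b ->
  is_derive x (1:R) (fun t => f t - g t) (a - b).
Proof. exact: is_deriveB. Qed.

Lemma is_derive_cmul c f x a : is_derive x 1 f a ->
  is_derive x (1:R) (fun t => c * f t) (c * a).
Proof. exact: is_deriveZ. Qed.

Lemma is_derive_continuous f x a : is_derive x 1 f a -> {for x, continuous f}.
Proof.
by move=> h; apply: differentiable_continuous; apply/derivable1_diffP; exact: ex_derive.
Qed.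

End pointwise_derivatives.

(** * The Gamma function: finiteness, functional equation, positivity, scaling *)

Section Gamma_function.
Context {R : realType}.
Let mu : {measure set (measurableTypeR R) -> \bar R} := @lebesgue_measure R.
Implicit Types x t : R.

Definition Gamma_integrand x t : R := t `^ (x - 1) * expR (- t).

(** Starting at 1/2 instead of 1 keeps the first segment nondegenerate, as the exhaustion asks for
    [aa k < bb k]. *)
Let aa (k : nat) : R := k.+2%:R^-1.
Let bb (k : nat) : R := k.+1%:R.

Let aabb k : aa k < bb k.
Proof.
rewrite /aa /bb; apply: (@lt_le_trans _ _ 1); last by rewrite ler1n.
by rewrite invf_lt1 ?ltr1n ?ltr0n.
Qed.

Let aabb_nd k : aa k.+1 <= aa k /\ bb k <= bb k.+1.
Proof. by rewrite /aa /bb lef_pV2 ?posrE ?ltr0n// !ler_nat. Qed.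

Let mpos : measurable (`]0, +oo[%classic : set (measurableTypeR R)).
Proof. exact: measurable_itv. Qed.

Let aa0 : aa @ \oo --> (0:R).
Proof.
rewrite (_ : aa = (fun k => [sequence n.+1%:R^-1]_n (k + 1)%N)).
  by rewrite (@cvg_shiftn 1%N R^o (fun n => n.+1%:R^-1)); exact: cvg_harmonic.
by apply/funext => k; rewrite /aa addn1.
Qed.

Let pos_exhaustion : \bigcup_k `[aa k, bb k]%classic = `]0, +oo[%classic.
Proof.
apply/seteqP; split => t /=.
  move=> [k _ /=]; rewrite !in_itv/= andbT => /andP[h _].
  by apply: lt_le_trans h; rewrite invr_gt0 ltr0n.
rewrite in_itv/= andbT => t0.
exists (Num.truncn t + Num.truncn (t^-1))%N => //=.
have ht := truncnS_gt t; have hi := truncnS_gt t^-1.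
rewrite in_itv/= /aa /bb; apply/andP; split.
  rewrite -[leRHS]invrK lef_pV2 ?posrE ?ltr0n ?invr_gt0//.
  by apply: ltW; apply: (lt_le_trans hi); rewrite ler_nat ltnS leqW// leq_addl.
by apply: ltW; apply: (lt_le_trans ht); rewrite ler_nat ltnS leq_addr.
Qed.

Let bbP t : (\bigcup_k `[aa k, bb k]%classic) t <-> 0 < t.
Proof. by rewrite pos_exhaustion /= in_itv/= andbT. Qed.

Lemma powR_expRN_bound x : 0 < x ->
  exists2 C : R, 0 < C & forall t, 0 < t -> t `^ x * expR (- t) <= C * expR (- (t / 2)).
Proof.
(* The maximum of t^x exp(-t/2), attained at t = 2x. The inequality 1 + w <= exp w at w = ln (t /
   (2x)) gives it without differentiating. *)
move=> x0; exists (expR (x * ln (2 * x) - x)); first exact: expR_gt0.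
move=> t t0; rewrite /powR gt_eqF// -!expRD ler_expR.
have x2 : 0 < 2 * x by lra.
have := expR_ge1Dx (ln (t / (2 * x))).
rewrite lnK ?posrE ?divr_gt0// ln_div ?posrE//.
move: (ln t) (ln (2 * x)) => u w; rewrite -(ler_pM2r x2) divfK ?gt_eqF// => h.
have E : (1 + (u - w)) * (2 * x) = 2 * (x + x * u - x * w) by ring.
lra.
Qed.


Lemma is_derive_expRN (c t : R) :
  is_derive t (1:R) (fun t => expR (- (t * c))) (- c * expR (- (t * c))).
Proof.
have h : is_derive t (1:R) (fun t => - c * t) (- c * 1).
  exact: (is_derive_cmul (- c) (is_derive_id t 1)).
have E : (fun t => expR (- (t * c))) = expR \o (fun t => - c * t).
  by apply/funext => u /=; congr expR; ring.
rewrite E; apply: is_derive_eq (is_derive1_comp (is_derive_expR (- c * t)) h) _.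
by rewrite mulr1 mulrC; congr (_ * expR _); ring.
Qed.

Lemma is_derive_powR_expRN x t : 0 < t ->
  is_derive t (1:R) (fun t => t `^ x * expR (- t))
    (x * Gamma_integrand x t - t `^ x * expR (- t)).
Proof.
move=> t0; have := is_derive_mul (is_derive1_powR x t0) (is_derive_expRN 1 t).
rewrite (_ : (fun u => _ * _) = (fun t => t `^ x * expR (- t))); last first.
  by apply/funext => u; rewrite mulr1.
by rewrite mulr1 /Gamma_integrand mulN1r mulrN mulrA.
Qed.

Lemma continuous_powR_expRN x t : 0 < t ->
  {for t, continuous (fun t => t `^ x * expR (- t))}.
Proof.
by move=> t0; exact: (is_derive_continuous (is_derive_powR_expRN x t0)).
Qed.

Lemma continuous_Gamma_integrand x t : 0 < t -> {for t, continuous (Gamma_integrand x)}.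
Proof. exact: continuous_powR_expRN. Qed.

Lemma cvg_Cexp C : (fun k => C * expR (- (bb k / 2))) @ \oo --> (0:R).
Proof.
rewrite -[X in _ --> X](mulr0 C); apply: cvgM; first exact: cvg_cst.
move/cvg_pinftyP: (@cvgr_expR R) => /(_ (fun k => bb k / 2)); apply.
have bboo : bb @ \oo --> +oo.
  rewrite (_ : bb = fun k => (k + 1)%:R); first by rewrite (cvg_shiftn 1 (GRing.natmul (1:R))); exact: cvgr_idn.
  by apply/funext => k; rewrite addn1.
apply/cvgryPge => A; move/cvgryPge : bboo => /(_ (2 * A)).
by apply: filterS => k; lra.
Qed.

Lemma cvg_powR_expRN_segment x : 0 < x ->
  (fun k => bb k `^ x * expR (- bb k) - aa k `^ x * expR (- aa k)) @ \oo --> (0 : R).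
Proof.
move=> x0; rewrite -[X in _ --> X](subr0 0).
apply: cvgB.
  have [C C0 hC] := powR_expRN_bound x0.
  apply: (@squeeze_cvgr _ _ _ _ (fun=> 0) (fun k => C * expR (- (bb k / 2)))).
  - apply: nearW => k; rewrite mulr_ge0 ?powR_ge0 ?expR_ge0//= hC// /bb ltr0n//.
  - exact: cvg_cst.
  - exact: cvg_Cexp.
rewrite -[X in _ --> X](mul0r (expR (-0))); apply: cvgM.
  move/cvg_at_rightP: (powR_cvg0 x0); apply; split => // k.
  by rewrite /aa invr_gt0 ltr0n.
apply: continuous_cvg; first exact: continuous_expR.
exact: cvgN.
Qed.

Lemma integral_Gamma_integrand_lty x : 0 < x ->
  (\int[mu]_(t in `]0%R, +oo[) (Gamma_integrand x t)%:E < +oo)%E.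
Proof.
move=> x0; have [C C0 hC] := powR_expRN_bound x0.
(* The integrand has no elementary primitive. Adding x^-1 times the nonnegative gap in
   [powR_expRN_bound] gives a majorant [h] that has one, namely [F]. *)
pose F t := x^-1 * (t `^ x * expR (- t)) - 2 * C / x * expR (- (t * 2^-1)).
pose h t := Gamma_integrand x t + x^-1 * (C * expR (- (t * 2^-1)) - t `^ x * expR (- t)).
have gh t : 0 < t -> 0 <= Gamma_integrand x t <= h t.
  move=> t0; rewrite mulr_ge0 ?powR_ge0 ?expR_ge0//= lerDl mulr_ge0 ?invr_ge0 ?(ltW x0)//.
  by rewrite subr_ge0 hC.
have ch t : 0 < t -> {for t, continuous h}.
  move=> t0; apply: cvgD; first exact: continuous_Gamma_integrand.
  apply: cvgM; first exact: cvg_cst.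
  apply: cvgB; last exact: continuous_powR_expRN.
  apply: cvgM; first exact: cvg_cst.
  exact: (is_derive_continuous (is_derive_expRN 2^-1 t)).
have : (\int[mu]_(t in \bigcup_k `[aa k, bb k]%classic) (h t)%:E = (0 + 2 * C / x)%:E)%E.
  apply: (@FTC_exhaustion_ge0 _ aa bb F) => //.
  - move=> t /bbP t0; rewrite (_ : h t = x^-1 * (x * Gamma_integrand x t - t `^ x * expR (- t))
       - 2 * C / x * (- 2^-1 * expR (- (t * 2^-1)))); last first.
      by rewrite /h; field; rewrite gt_eqF.
    apply: is_derive_sub; apply: is_derive_cmul; [exact: is_derive_powR_expRN|exact: is_derive_expRN].
  - by move=> t /bbP /ch.
  - rewrite (_ : 0 + 2 * C / x = x^-1 * 0 - 2 * C / x * (1 * 0 - expR (- (0 / 2)))); last first.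
      by rewrite mul0r oppr0 expR0; ring.
    rewrite (_ : (fun k => _) = (fun k => x^-1 * (bb k `^ x * expR (- bb k) - aa k `^ x * expR (- aa k))
        - 2 * C / x * (1 * expR (- (bb k / 2)) - expR (- (aa k / 2))))); last first.
      by apply/funext => k; rewrite /F; ring.
    apply: cvgB; (apply: cvgM; first exact: cvg_cst); first exact: cvg_powR_expRN_segment.
    apply: cvgB; first by rewrite mulr0; exact: cvg_Cexp.
    apply: (continuous_cvg _ (@continuous_expR R _)); apply: cvgN; apply: cvgM aa0 _.
    exact: cvg_cst.
  - by move=> t /bbP /gh/andP[]; exact: le_trans.
rewrite pos_exhaustion => hh.
apply: (@le_lt_trans _ _ (\int[mu]_(t in `]0%R, +oo[) (h t)%:E)%E); last by rewrite hh ltry.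
apply: ge0_le_integral => //.
- by move=> t; rewrite /= in_itv/= andbT lee_fin => /gh/andP[].
- apply/measurable_EFinP; apply: open_continuous_measurable_fun => // t.
  by rewrite inE/= in_itv/= andbT; exact: continuous_Gamma_integrand.
- apply/measurable_EFinP; apply: open_continuous_measurable_fun => // t.
  by rewrite inE/= in_itv/= andbT; exact: ch.
- by move=> t; rewrite /= in_itv/= andbT lee_fin => /gh/andP[].
Qed.

Lemma measurable_Gamma_integrand x : measurable_fun (`]0, +oo[%classic : set R) (Gamma_integrand x).
Proof.
apply: open_continuous_measurable_fun => // t.
by rewrite inE/= in_itv/= andbT; exact: continuous_Gamma_integrand.
Qed.

Lemma integrable_Gamma_integrand x : 0 < x ->
  mu.-integrable `]0, +oo[ (EFin \o Gamma_integrand x).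
Proof.
move=> x0; apply/integrableP; split.
  by apply/measurable_EFinP; exact: measurable_Gamma_integrand.
under eq_integral => t _ do rewrite gee0_abs ?lee_fin ?mulr_ge0 ?powR_ge0 ?expR_ge0//.
exact: integral_Gamma_integrand_lty.
Qed.

Lemma GammaE x : 0 < x ->
  (\int[mu]_(t in `]0%R, +oo[) (Gamma_integrand x t)%:E = (Gamma x)%:E)%E.
Proof.
move=> x0; rewrite /Gamma fineK// ge0_fin_numE; first exact: integral_Gamma_integrand_lty.
by apply: integral_ge0 => t _; rewrite lee_fin mulr_ge0 ?powR_ge0 ?expR_ge0.
Qed.

(** The fundamental theorem for t^x exp(-t), whose boundary values vanish at 0 and at infinity. *)
Lemma GammaS x : 0 < x -> Gamma (x + 1) = x * Gamma x.
Proof.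
move=> x0; have x10 : 0 < x + 1 by rewrite addr_gt0.
have iS := integrable_Gamma_integrand x10; have i0 := integrable_Gamma_integrand x0.
have iX : mu.-integrable `]0, +oo[ (EFin \o (fun t => x * Gamma_integrand x t)).
  exact: (integrableZl mpos x i0).
have E : Gamma_integrand (x + 1) = (fun t => t `^ x * expR (- t)).
  by apply/funext => t; rewrite /Gamma_integrand addrK.
have : (\int[mu]_(t in `]0%R, +oo[) ((EFin \o (fun t => x * Gamma_integrand x t)%R) t - (EFin \o Gamma_integrand (x + 1)) t) = 0%:E)%E.
  rewrite E -pos_exhaustion.
  apply: (@FTC_exhaustion _ aa bb (fun t => t `^ x * expR (- t))
    (fun t => x * Gamma_integrand x t - t `^ x * expR (- t))) => //.
  - by move=> t /bbP; exact: is_derive_powR_expRN.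
  - move=> t /bbP t0; apply: cvgB; last exact: continuous_powR_expRN.
    by apply: cvgM; [exact: cvg_cst|exact: continuous_Gamma_integrand].
  - exact: cvg_powR_expRN_segment.
  - rewrite pos_exhaustion; have iB := integrableB mpos iX iS.
    have iB' : mu.-integrable `]0, +oo[ (EFin \o (fun t => x * Gamma_integrand x t - t `^ x * expR (- t))).
      by apply: (eq_integrable mpos _ _ _ iB) => t _; rewrite /= E.
    exact: iB'.
rewrite (integralB mpos iX iS) [X in (X - _)%E](_ : _ = (x%:E * (Gamma x)%:E)%E); last first.
  by rewrite -GammaE// -(integralZl mpos).
by rewrite GammaE// -EFinM -EFinB => -[] /eqP; rewrite subr_eq0 => /eqP ->.
Qed.

Lemma Gamma_gt0 x : 0 < x -> 0 < Gamma x.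
Proof.
move=> x0; rewrite -lte_fin -GammaE//.
(* On [1, 2] one has 0 <= ln t <= 1 and t <= 2, so the exponent (x - 1) ln t - t is at least -|x -
   1| - 2. *)
pose c := expR (- `|x - 1| - 2).
have s12 : `[1 : R, 2]%classic `<=` `]0, +oo[.
  by move=> t /=; rewrite !in_itv/= andbT => /andP[+ _]; apply: lt_le_trans.
have : (\int[mu]_(t in `[1%R, 2%R]) (cst c%:E t) <= \int[mu]_(t in `]0%R, +oo[) (Gamma_integrand x t)%:E)%E.
  apply: (@le_trans _ _ (\int[mu]_(t in `[1%R, 2%R]) (Gamma_integrand x t)%:E)%E).
    apply: ge0_le_integral => //.
    - by move=> t _; rewrite lee_fin expR_ge0.
    - by apply/measurable_EFinP; apply: measurable_funS s12 (measurable_Gamma_integrand x).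
    move=> t; rewrite /= in_itv/= => /andP[t1 t2].
    have t0 : 0 < t by lra.
    rewrite lee_fin /Gamma_integrand /powR gt_eqF// -expRD ler_expR.
    have l0 : 0 <= ln t by rewrite ln_ge0.
    have l1 : ln t <= 1.
      have := expR_ge1Dx (ln t); rewrite lnK ?posrE//; lra.
    have : - `|x - 1| <= (x - 1) * ln t.
      rewrite lerNl -mulNr (le_trans (ler_norm _))// normrM normrN (ger0_norm l0).
      by rewrite ler_piMr.
    lra.
  apply: ge0_subset_integral => //.
    by apply/measurable_EFinP; exact: measurable_Gamma_integrand.
  by move=> t _; rewrite lee_fin mulr_ge0 ?powR_ge0 ?expR_ge0.
apply: lt_le_trans; rewrite integral_cst//= /mu lebesgue_measure_itv/= lte_fin ltr1n/=.
by rewrite -EFinB -EFinM lte_fin mulr_gt0// ?expR_gt0//; lra.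
Qed.

(** The substitution theorem asks for continuity up to 0, which t^(x-1) has only for x >= 1; smaller
    exponents in the binomial series are reached later by a shift. *)
Lemma Gamma_scale x (l : R) : 1 <= x -> 0 < l ->
  (\int[mu]_(t in `]0%R, +oo[) (t `^ (x - 1) * expR (- (t * l)))%:E = (Gamma x / l `^ x)%:E)%E.
Proof.
move=> x1 l0; have x0 : 0 < x by exact: lt_le_trans x1.
have := @increasing_ge0_integration_by_substitutiony R (fun t => t * l) (Gamma_integrand x) 0.
have dF t : is_derive t (1:R) (fun t => t * l) l.
  have := is_derive_cmul l (is_derive_id t (1:R)); rewrite mulr1.
  by rewrite (_ : (fun u => l * id u) = (fun u => u * l))//; apply/funext => u; rewrite mulrC.
have dE : (fun t : R => t * l)^`()%classic = cst l.
  by apply/funext => t; rewrite derive1E; apply: derive_val.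
rewrite dE mul0r => sub.
have cG : {within `[0, +oo[, continuous (Gamma_integrand x)}.
  apply/continuous_within_itvcyP; split.
    by move=> t; rewrite in_itv/= andbT; exact: continuous_Gamma_integrand.
  apply: cvgM; last first.
    by apply: cvg_at_right_filter; apply: continuous_cvg; [exact: continuous_expR|exact: cvgN].
  have [->|xn1] := eqVneq x 1.
    by rewrite subrr powRr0; under eq_fun do rewrite powRr0; exact: cvg_cst.
  rewrite powR0 ?subr_eq0//; apply: powR_cvg0; rewrite subr_gt0 lt_neqAle eq_sym xn1//.
pose h t := Gamma_integrand x (t * l) * l.
have ch t : 0 < t -> {for t, continuous h}.
  move=> t0; apply: cvgM; last exact: cvg_cst.
  apply: (@continuous_comp _ _ _ (fun t => t * l) (Gamma_integrand x)).
    exact: (is_derive_continuous (dF t)).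
  by apply: continuous_Gamma_integrand; rewrite mulr_gt0.
have mh : measurable_fun (`]0, +oo[%classic : set R) h.
  apply: open_continuous_measurable_fun => // t.
  by rewrite inE/= in_itv/= andbT; exact: ch.
have mG := @measurable_Gamma_integrand x.
rewrite -integral_itv_obnd_cbnd in sub; last exact/measurable_EFinP.
rewrite -integral_itv_obnd_cbnd in sub; last exact/measurable_EFinP.
transitivity (\int[mu]_(t in `]0%R, +oo[) ((l `^ x)^-1%:E * (h t)%:E))%E.
  apply: eq_integral => t; rewrite inE/= in_itv/= andbT => t0.
  rewrite -EFinM; congr EFin; rewrite /h /Gamma_integrand powRM ?(ltW t0) ?(ltW l0)//.
  have -> : l `^ x = l `^ (x - 1) * l by rewrite mulrC mulr_powRB1// ltW.
  by field; rewrite !gt_eqF ?powR_gt0.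
rewrite ge0_integralZl//; last 2 first.
- by move=> t _; rewrite lee_fin mulr_ge0 ?(ltW l0)// mulr_ge0 ?powR_ge0 ?expR_ge0.
- by rewrite lee_fin invr_ge0 powR_ge0.
rewrite -sub ?GammaE -?EFinM 1?mulrC//.
- by move=> u v _ _ uv; rewrite ltr_pM2r.
- by move=> t _; exact: cvg_cst.
- exact: is_cvg_cst.
- exact: is_cvg_cst.
- split; first by move=> t _; exact: ex_derive.
  by apply: cvg_at_right_filter; exact: (is_derive_continuous (dF 0)).
- by apply: gt0_cvgMly => //; exact: cvg_id.
- by move=> t; rewrite in_itv/= andbT => t0; rewrite mulr_ge0 ?powR_ge0 ?expR_ge0.
exact/measurable_EFinP.
Qed.

End Gamma_function.

(** * The space R^n as an iterated product, and Fubini for iterated integrals *)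

Section product_space.
Context d1 d2 (T1 : measurableType d1) (T2 : measurableType d2) {R : realType}.
Variables (m1 : {sigma_finite_measure set T1 -> \bar R})
  (m2 : {sigma_finite_measure set T2 -> \bar R}).

(* For sigma-finite factors the instance found on [m1 \x m2] stops at
   [measure]: the one for subprobability factors takes precedence. *)
Definition sfprod : set (T1 * T2) -> \bar R := (m1 \x m2)%E.

HB.instance Definition _ := Measure.on sfprod.

Let sfprod_sigma_finite : sigma_finite setT sfprod.
Proof.
have /sigma_finiteP[A [AT ndA Afin]] := sigma_finiteT m1.
have /sigma_finiteP[B [BT ndB Bfin]] := sigma_finiteT m2.
exists (fun k => A k `*` B k) => [|k].
  apply/esym; rewrite -subTset => -[x y] _.
  have [i _ Ax] : (\bigcup_k A k) x by rewrite -AT.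
  have [j _ By] : (\bigcup_k B k) y by rewrite -BT.
  exists (i + j)%N => //; split => /=.
    by move: Ax; apply/subsetPset/ndA/leq_addr.
  by move: By; apply/subsetPset/ndB/leq_addl.
have [[mA fA] [mB fB]] := (Afin k, Bfin k); split; first exact: measurableX.
by rewrite [sfprod _]product_measure1E// lte_mul_pinfty// ge0_fin_numE.
Qed.

HB.instance Definition _ :=
  Measure_isSigmaFinite.Build _ _ _ sfprod sfprod_sigma_finite.

End product_space.

Section coordinate_space.
Context {R : realType}.

(** Type, display and measure of R^k all depend on k, so they are bundled to be built by one
    recursion; [cs_seq] yields the coordinate list on which the iterated integral acts. *)
Record coord_space := CoordSpace {
  cs_disp : measure_display;
  cs_type : measurableType cs_disp;
  cs_mu : {sigma_finite_measure set cs_type -> \bar R};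
  cs_seq : cs_type -> seq R }.

Definition cs0 : coord_space := @CoordSpace _ unit (dirac tt) (fun=> [::]).

Definition csS (E : coord_space) : coord_space :=
  @CoordSpace _ (measurableTypeR R * cs_type E)%type
    (sfprod (@lebesgue_measure R) (cs_mu E))
    (fun p => p.1 :: cs_seq p.2).

Fixpoint Rn (k : nat) : coord_space := if k is k'.+1 then csS (Rn k') else cs0.


Implicit Types (k l : nat) (t : R).

Lemma measurable_coord k i :
  measurable_fun setT (fun p : cs_type (Rn k) => nth 0 (cs_seq p) i).
Proof.
elim: k i => [|k ih] [|i] /=; [exact: measurable_cst..|exact: measurable_fst|].
exact: (measurableT_comp (ih i) measurable_snd).
Qed.

Lemma measurable_fun_integral_param d d' (T : measurableType d) (T' : measurableType d')
    (m : {sigma_finite_measure set T' -> \bar R}) (f : T * T' -> \bar R) :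
  measurable_fun setT f -> measurable_fun setT (fun x => \int[m]_y f (x, y))%E.
Proof.
move=> mf; rewrite (_ : (fun x => _) =
    (fun x => (\int[m]_y f^\+ (x, y)) - (\int[m]_y f^\- (x, y)))%E).
  apply: emeasurable_funB.
    apply: (measurable_fun_fubini_tonelli_F (f^\+)%E); first exact: measurable_funepos.
    by move=> x; exact: funepos_ge0.
  apply: (measurable_fun_fubini_tonelli_F (f^\-)%E); first exact: measurable_funeneg.
  by move=> x; exact: funeneg_ge0.
apply/funext => x; rewrite [LHS]integralE. by congr (_ - _)%E; apply: eq_integral => y _; rewrite ?funeposE ?funenegE.
Qed.

(** Holds whatever the integrability of the slices. In [iintE] the inner iterated integral is
    identified with a product integral only for almost every slice, while the comparison asks for a
    function measurable on the whole line. *)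
Lemma measurable_iint k d (T : measurableType d) (G : T -> seq R -> \bar R) :
  measurable_fun setT (fun p : T * cs_type (Rn k) => G p.1 (cs_seq p.2)) ->
  measurable_fun setT (fun x => iint k (G x)).
Proof.
elim: k d T G => [|k ih] d T G mG /=.
  exact: (measurableT_comp mG (measurable_fun_pair (@measurable_id _ T setT) (measurable_cst tt))).
pose H (q : T * measurableTypeR R) := iint k (fun s => G q.1 (q.2 :: s)).
apply: (@measurable_fun_integral_param _ _ _ _ (@lebesgue_measure R) H).
apply: (ih _ _ (fun (q : T * measurableTypeR R) s => G q.1 (q.2 :: s))) => /=.
apply: (measurableT_comp mG (g := fun p : (T * measurableTypeR R) * cs_type (Rn k) =>
  (p.1.1, (p.1.2, p.2)))).
apply: measurable_fun_pair; first exact: (measurableT_comp measurable_fst measurable_fst).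
by apply: measurable_fun_pair; [exact: (measurableT_comp measurable_snd measurable_fst)|].
Qed.

(** Fubini, one variable at a time: almost every slice is integrable, so the induction hypothesis
    applies to it, and the other slices form a null set. *)
Lemma iintE k (F : seq R -> \bar R) :
  (cs_mu (Rn k)).-integrable setT (fun p => F (cs_seq p)) ->
  iint k F = (\int[cs_mu (Rn k)]_p F (cs_seq p))%E.
Proof.
elim: k F => [|k ih] F Fi /=.
  by rewrite integral_dirac ?diracT ?mul1e//; exact: measurable_int Fi.
pose f (q : measurableTypeR R * cs_type (Rn k)) := F (q.1 :: cs_seq q.2).
have fi : (@lebesgue_measure R \x cs_mu (Rn k))%E.-integrable setT f by exact: Fi.
transitivity (\int[@lebesgue_measure R]_x \int[cs_mu (Rn k)]_p f (x, p))%E; last first.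
  exact: integral12_prod_meas1.
apply: ae_eq_integral => //.
- apply: (@measurable_iint k _ (measurableTypeR R) (fun x s => F (x :: s))).
  exact: measurable_int fi.
- exact: (measurable_fubini_F fi).
have := ae_integrable1 fi; apply: filterS => x xi _.
exact: (ih (fun s => F (x :: s))).
Qed.

Fixpoint cs_upd k l t : cs_type (Rn k) -> cs_type (Rn k) :=
  match k with
  | 0 => id
  | k'.+1 => fun p => if l is l'.+1 then (p.1, cs_upd l' t p.2) else (t, p.2)
  end.

Lemma cs_seq_upd k l t (p : cs_type (Rn k)) : (l < k)%N ->
  cs_seq (cs_upd l t p) = set_nth 0 (cs_seq p) l t.
Proof. by elim: k l p => [//|k ih] [|l] [x p] //= lk; rewrite ih. Qed.

(** Fubini with the [l]-th variable integrated innermost, reached by peeling off the variables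
    before it. Vanishing is asked only along lines where [f] is integrable, which is the situation
    of [FTC_exhaustion]. *)
Lemma integral_lines_eq0 k l (f : cs_type (Rn k) -> R) : (l < k)%N ->
  (cs_mu (Rn k)).-integrable setT (EFin \o f) ->
  (forall p, (@lebesgue_measure R).-integrable setT (EFin \o (fun t => f (cs_upd l t p))) ->
     \int[@lebesgue_measure R]_t (f (cs_upd l t p))%:E = 0)%E ->
  (\int[cs_mu (Rn k)]_p (f p)%:E = 0)%E.
Proof.
elim: k l f => [//|k ih] l f lk fi f0 /=.
pose g (q : measurableTypeR R * cs_type (Rn k)) := (f q)%:E.
have gi : (@lebesgue_measure R \x cs_mu (Rn k))%E.-integrable setT g by exact: fi.
case: l lk f0 => [|l] lk f0.
  transitivity (\int[cs_mu (Rn k)]_p \int[@lebesgue_measure R]_x g (x, p))%E.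
    by rewrite (integral21_prod_meas1 gi).
  rewrite (ae_eq_integral (cst 0%E)) ?integral0 //; first exact: (measurable_fubini_G gi).
  have := ae_integrable2 gi; apply: filterS => p pint _.
  exact: (f0 (0, p) pint).
transitivity (\int[@lebesgue_measure R]_x \int[cs_mu (Rn k)]_p g (x, p))%E.
  by rewrite (integral12_prod_meas1 gi).
rewrite (ae_eq_integral (cst 0%E)) ?integral0 //; first exact: (measurable_fubini_F gi).
have := ae_integrable1 gi; apply: filterS => x xi _.
apply: (ih l (fun p => f (x, p))) => // p; exact: (f0 (x, p)).
Qed.

End coordinate_space.

(** * Induction on polynomials and derivatives along coordinate lines *)

Section mpoly_induction.
Context {R : comNzRingType} {m : nat}.
Notation mp := (mpoly.mpoly m R).
Notation mX i := (mpoly.mpolyX R (mpoly.mnm1 i)).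

(** Polynomials as the algebra generated by constants and variables: this shape suits properties
    stable under sums and products, such as differentiation rules and boundedness. *)
Lemma mpoly_alg_ind (P : mp -> Prop) :
  (forall c, P (mpoly.mpolyC m c)) -> (forall i, P (mX i)) ->
  (forall p q, P p -> P q -> P (p + q)) -> (forall p q, P p -> P q -> P (p * q)) ->
  forall p, P p.
Proof.
move=> PC PX PD PM; elim/mpoly.mpolyind => [|c u p _ _ Pp].
  by rewrite -mpoly.mpolyC0; exact: PC.
apply: PD => //; rewrite -mpoly.mul_mpolyC; apply: (PM _ _ (PC c)).
have P1 : P 1 by have := PC 1; rewrite mpoly.mpolyC1.
rewrite mpoly.mpolyXE_id; apply: (big_ind P) => [|p' q'|i _]; [exact: P1|exact: PM|].
elim: (mpoly.fun_of_multinom u i) => [|k ih]; first exact: P1.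
by rewrite exprS; apply: PM.
Qed.

End mpoly_induction.

Section line_derivative.
Context {R : realType} (l : nat).
Implicit Types (F G : seq R -> R) (y : seq R).

(** The line through [y] is drawn by [set_nth], and [F'] is evaluated at the moving point; the rules
    then compose for lists of any length. *)
Definition lderiv F F' := forall y t,
  is_derive t (1:R) (fun t => F (set_nth 0 y l t)) (F' (set_nth 0 y l t)).

Lemma lderiv_cst c : lderiv (fun=> c) (fun=> 0).
Proof. by move=> y t; exact: is_derive_cst. Qed.

Lemma lderiv_nth i : lderiv (fun y => nth 0 y i) (fun=> (i == l)%:R).
Proof.
move=> y t; under [X in is_derive _ _ X _]eq_fun do rewrite nth_set_nth/=.
by case: eqP => _; [exact: is_derive_id|exact: is_derive_cst].
Qed.

Lemma lderiv_add F F' G G' : lderiv F F' -> lderiv G G' ->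
  lderiv (fun y => F y + G y) (fun y => F' y + G' y).
Proof. by move=> hF hG y t; apply: is_derive_add. Qed.

Lemma lderiv_mul F F' G G' : lderiv F F' -> lderiv G G' ->
  lderiv (fun y => F y * G y) (fun y => F' y * G y + F y * G' y).
Proof. by move=> hF hG y t; apply: is_derive_mul. Qed.

Lemma lderiv_eq F F' G' : lderiv F F' -> F' =1 G' -> lderiv F G'.
Proof. by move=> hF /funext <-. Qed.

Lemma lderiv_cmul c F F' : lderiv F F' -> lderiv (fun y => c * F y) (fun y => c * F' y).
Proof. by move=> hF y t; apply: is_derive_cmul. Qed.

Lemma lderiv_opp F F' : lderiv F F' -> lderiv (fun y => - F y) (fun y => - F' y).
Proof. by move=> hF y t; exact: is_deriveN. Qed.

Lemma lderiv_sum (I : Type) (r : seq I) (F F' : I -> seq R -> R) :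
  (forall i, lderiv (F i) (F' i)) ->
  lderiv (fun y => \sum_(i <- r) F i y) (fun y => \sum_(i <- r) F' i y).
Proof.
move=> h; elim: r => [|i r ih].
  rewrite (_ : (fun y => _) = fun=> 0); last by apply/funext => y; rewrite big_nil.
  by apply: (lderiv_eq (lderiv_cst 0)) => y; rewrite big_nil.
rewrite (_ : (fun y => _) = fun y => F i y + \sum_(i <- r) F i y); last first.
  by apply/funext => y; rewrite big_cons.
by apply: (lderiv_eq (lderiv_add (h i) ih)) => y; rewrite big_cons.
Qed.

Lemma lderiv_exp F F' k : lderiv F F' ->
  lderiv (fun y => F y ^+ k) (fun y => k%:R * F y ^+ k.-1 * F' y).
Proof.
move=> hF; elim: k => [|k ih].
  by apply: (lderiv_eq (lderiv_cst 1)) => y; rewrite !mul0r.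
rewrite (_ : (fun y => _) = fun y => F y * F y ^+ k); last first.
  by apply/funext => y; rewrite exprS.
apply: (lderiv_eq (lderiv_mul hF ih)) => y.
case: k {ih} => [|k]; first by rewrite !expr0; ring.
by rewrite /= exprS [in RHS]mulrS; ring.
Qed.

Lemma lderiv_inv F F' : (forall y, F y != 0) -> lderiv F F' ->
  lderiv (fun y => (F y)^-1) (fun y => - (F y ^- 2 * F' y)).
Proof.
move=> F0 hF y t.
have := is_deriveV (f := fun t => F (set_nth 0 y l t)) (x := t) (F0 _) (hF y t).
by move=> h; apply: (is_derive_eq h); rewrite /GRing.scale/= mulNr.
Qed.

Lemma lderiv_continuous F F' : lderiv F F' ->
  forall y, continuous (fun t => F (set_nth 0 y l t)).
Proof. by move=> hF y t; exact: (is_derive_continuous (hF y t)). Qed.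

Lemma lderiv_meval m (g g' : 'I_m -> seq R -> R) (p : mpoly.mpoly m R) :
  (forall i, lderiv (g i) (g' i)) ->
  lderiv (fun y => mpoly.meval (g^~ y) p)
    (fun y => \sum_(i < m) mpoly.meval (g^~ y) (mpoly.mderiv i p) * g' i y).
Proof.
move=> hg; move: p; apply: mpoly_alg_ind => [c|i|p q hp hq|p q hp hq].
- rewrite (_ : (fun y => _) = fun=> c); last by apply/funext => y; rewrite mpoly.mevalC.
  apply: (lderiv_eq (lderiv_cst c)) => y; rewrite big1// => i _.
  by rewrite mpoly.mderivC mpoly.meval0 mul0r.
- rewrite (_ : (fun y => _) = g i); last by apply/funext => y; rewrite mpoly.mevalXU.
  apply: (lderiv_eq (hg i)) => y; rewrite (bigD1 i)//= big1 ?addr0 => [|j ji].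
    rewrite mpoly.mderivX mpoly.mnm1E eqxx scale1r.
    rewrite (_ : mpoly.mnm_sub _ _ = mpoly.mnm0); last first.
      by apply/mpoly.mnmP => k; rewrite mpoly.mnmBE subnn mpoly.mnm0E.
    by rewrite mpoly.mpolyX0 mpoly.meval1 mul1r.
  by rewrite mpoly.mderivX mpoly.mnm1E eq_sym (negbTE ji) scale0r mpoly.meval0 mul0r.
- rewrite (_ : (fun y => _) = fun y => mpoly.meval (g^~ y) p + mpoly.meval (g^~ y) q).
    apply: (lderiv_eq (lderiv_add hp hq)) => y; rewrite -big_split/=.
    by apply: eq_bigr => i _; rewrite mpoly.mderivD mpoly.mevalD mulrDl.
  by apply/funext => y; rewrite mpoly.mevalD.
- rewrite (_ : (fun y => _) = fun y => mpoly.meval (g^~ y) p * mpoly.meval (g^~ y) q).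
    apply: (lderiv_eq (lderiv_mul hp hq)) => y.
    rewrite mulr_suml mulr_sumr -big_split/=; apply: eq_bigr => i _.
    by rewrite mpoly.mderivM mpoly.mevalD !mpoly.mevalM; ring.
  by apply/funext => y; rewrite mpoly.mevalM.
Qed.

End line_derivative.

(** * Stereographic coordinates and the divergence of coordinate gradient fields *)

Section stereographic.
Context {R : realType} (n : nat).
Implicit Types (y : seq R) (i m : 'I_n.+1) (l : 'I_n).

Definition rho y : R := 2 / (1 + ysq n y).
(** The direction (y, -1) from the north pole to the point (y, 0) of the equatorial hyperplane;
    inverse stereographic projection travels [rho y] times it from the pole. *)
Definition sty i y : R := if (i < n)%N then nth 0 y i else -1.
Definition pole i : R := (i == n :> nat)%:R.
Definition st i y : R := istereo n y ord0 i.

Lemma ysq_ge0 y : 0 <= ysq n y.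
Proof. by apply: sumr_ge0 => i _; rewrite sqr_ge0. Qed.

Lemma ysq1_gt0 y : 0 < 1 + ysq n y.
Proof. by rewrite ltr_pwDl// ysq_ge0. Qed.

Lemma rho_gt0 y : 0 < rho y.
Proof. by rewrite divr_gt0// ysq1_gt0. Qed.

Lemma rho_le2 y : rho y <= 2.
Proof. by rewrite ler_pdivrMr ?ysq1_gt0// ler_pMr// lerDl ysq_ge0. Qed.

Lemma rho_ysq y : rho y * ysq n y = 2 - rho y.
Proof. by rewrite /rho; field; rewrite gt_eqF ?ysq1_gt0. Qed.

Lemma stE i y : st i y = rho y * sty i y + pole i.
Proof.
rewrite /st mxE /sty /pole /rho; have h := ysq1_gt0 y; case: ifPn => ini.
  by rewrite ltn_eqF// addr0; field; rewrite gt_eqF.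
by rewrite (_ : (i == n :> nat)) ?mulr1n; [field; rewrite gt_eqF|rewrite eqn_leq -ltnS ltn_ord leqNgt].
Qed.

Lemma big_sphere (F : 'I_n.+1 -> R) :
  \sum_i F i = \sum_(l < n) F (widen_ord (leqnSn n) l) + F ord_max.
Proof. by rewrite big_ord_recr. Qed.

Lemma sty_widen l y : sty (widen_ord (leqnSn n) l) y = nth 0 y l.
Proof. by rewrite /sty /= ltn_ord. Qed.

Lemma sty_max y : sty ord_max y = -1.
Proof. by rewrite /sty /= ltnn. Qed.

Lemma pole_widen l : pole (widen_ord (leqnSn n) l) = 0.
Proof. by rewrite /pole /= ltn_eqF. Qed.

Lemma pole_max : pole ord_max = 1.
Proof. by rewrite /pole /= eqxx. Qed.

Lemma istereo_sphere y : sphere n (istereo n y).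
Proof.
change (\sum_i st i y ^+ 2 = 1); rewrite big_sphere.
under eq_bigr => l _ do rewrite stE sty_widen pole_widen addr0 exprMn.
rewrite -mulr_sumr -/(ysq n y) stE sty_max pole_max.
have := rho_ysq y; move: (rho y) (ysq n y) => r q h.
by rewrite expr2 -mulrA h; ring.
Qed.

Lemma lderiv_ysq l : lderiv l (ysq n) (fun y => 2 * nth 0 y l).
Proof.
have h (i : 'I_n) := lderiv_exp 2 (@lderiv_nth R l i).
apply: (lderiv_eq (lderiv_sum _ h)) => y.
rewrite (bigD1 l)//= eqxx mulr1 big1 ?addr0 ?expr1// => i il.
by rewrite val_eqE (negbTE il) mulr0.
Qed.

Lemma lderiv_rho l : lderiv l rho (fun y => - (rho y ^+ 2 * nth 0 y l)).
Proof.
have h := lderiv_inv (fun y => lt0r_neq0 (ysq1_gt0 y)) (lderiv_add (lderiv_cst l 1) (lderiv_ysq l)).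
apply: (lderiv_eq (lderiv_cmul 2 h)) => y; rewrite /rho.
by field; rewrite gt_eqF ?ysq1_gt0.
Qed.

Definition kron l i : R := (l == i :> nat)%:R.

Lemma lderiv_sty l i : lderiv l (sty i) (fun=> kron l i).
Proof.
rewrite /sty /kron; case: (boolP (i < n)%N) => ini; first by rewrite eq_sym; exact: lderiv_nth.
have -> : (l == i :> nat) = false by apply/negbTE; apply: contraNneq ini => <-.
exact: lderiv_cst.
Qed.

(* [rho * tang l i] is the derivative of [st i] along the [l]-th coordinate,
   and [tang l i / rho] the [l]-th component of the gradient field of the
   [i]-th coordinate function of the sphere. *)
Definition tang l i y := kron l i - rho y * sty i y * nth 0 y l.

Lemma lderiv_st l i : lderiv l (st i) (fun y => rho y * tang l i y).
Proof.
rewrite (_ : st i = fun y => rho y * sty i y + pole i); last by apply/funext => y; exact: stE.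
apply: (lderiv_eq (lderiv_add (lderiv_mul (lderiv_rho l) (lderiv_sty l i)) (lderiv_cst l _))).
by move=> y; rewrite /tang; ring.
Qed.

Definition dtang l i y :=
  - (- (rho y ^+ 2 * nth 0 y l) * sty i y * nth 0 y l + rho y * kron l i * nth 0 y l
     + rho y * sty i y).

Lemma lderiv_tang l i : lderiv l (tang l i) (dtang l i).
Proof.
apply: (lderiv_eq (lderiv_add (lderiv_cst l (kron l i)) (lderiv_opp
  (lderiv_mul (lderiv_mul (lderiv_rho l) (lderiv_sty l i)) (lderiv_nth l l))))) => y.
by rewrite /dtang eqxx /=; ring.
Qed.

Lemma sphere_ordP i : i = ord_max \/ exists l : 'I_n, i = widen_ord (leqnSn n) l.
Proof.
have [ini|ini] := ltnP i n; first by right; exists (Ordinal ini); apply: val_inj.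
by left; apply: val_inj => /=; apply/eqP; rewrite eqn_leq ini -ltnS ltn_ord.
Qed.

Lemma sum_kron_widen (F : 'I_n -> R) k :
  \sum_(l < n) kron l (widen_ord (leqnSn n) k) * F l = F k.
Proof.
rewrite (bigD1 k)//= /kron eqxx mul1r big1 ?addr0// => j jk.
by rewrite /= val_eqE (negbTE jk) mul0r.
Qed.

Lemma sum_kron_max (F : 'I_n -> R) : \sum_(l < n) kron l ord_max * F l = 0.
Proof. by rewrite big1// => j _; rewrite /kron /= ltn_eqF ?mul0r. Qed.

(** The vectors [tang l _] form an orthonormal basis of the tangent space at x, so the sum over [l]
    is the matrix of the orthogonal projection, the identity minus x x^T. *)
Lemma sum_tang i m y :
  \sum_(l < n) tang l i y * tang l m y = (i == m)%:R - st i y * st m y.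
Proof.
have e l : tang l i y * tang l m y = kron l i * tang l m y
   - rho y * sty i y * (kron l m * nth 0 y l) + rho y ^+ 2 * sty i y * sty m y * nth 0 y l ^+ 2.
  by rewrite /tang; ring.
under eq_bigr do rewrite e.
rewrite big_split sumrB/= -!mulr_sumr -/(ysq n y) !stE -val_eqE/=.
have q : rho y ^+ 2 * ysq n y = rho y * (2 - rho y) by rewrite expr2 -mulrA rho_ysq.
rewrite (_ : rho y ^+ 2 * _ * _ * _ = rho y * (2 - rho y) * sty i y * sty m y); last first.
  by rewrite -q; ring.
have [->|[a ->]] := sphere_ordP i; have [->|[b ->]] := sphere_ordP m;
  rewrite ?sum_kron_max ?sum_kron_widen ?sty_max ?pole_max ?sty_widen ?pole_widen /tang /=
    ?sty_max ?sty_widen /kron /= ?eqxx ?(ltn_eqF (ltn_ord _)) ?(gtn_eqF (ltn_ord _)) /=; ring.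
Qed.

(* The divergence of the field [rho ^ n.-1 * tang _ i] is [- n * rho ^ n * st i]. *)
Lemma sum_dtang i y :
  \sum_(l < n) (- (n%:R - 1) * rho y * nth 0 y l * tang l i y + dtang l i y) =
  - n%:R * rho y * st i y.
Proof.
have e l : - (n%:R - 1) * rho y * nth 0 y l * tang l i y + dtang l i y =
  - n%:R * rho y * (kron l i * nth 0 y l) + n%:R * rho y * (rho y * sty i y * nth 0 y l ^+ 2)
  - rho y * sty i y.
  by rewrite /tang /dtang; ring.
under eq_bigr do rewrite e.
rewrite big_split big_split /= -!mulr_sumr -/(ysq n y) !stE sumr_const card_ord -mulr_natr.
rewrite (_ : rho y * sty i y * _ = (2 - rho y) * sty i y); last by rewrite -rho_ysq; ring.
have [->|[a ->]] := sphere_ordP i;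
  rewrite ?sum_kron_max ?sum_kron_widen ?sty_max ?pole_max ?sty_widen ?pole_widen; ring.
Qed.

Section field.
Variables (i : 'I_n.+1) (P : mpoly.mpoly n.+1 R).
Hypothesis n1 : (1 < n)%N.

Definition pst (p : mpoly.mpoly n.+1 R) y := mpoly.meval (st^~ y) p.

(** The field P grad x_i for the metric rho^2 |dy|^2 has components [tang l i / rho] times P; the
    volume density rho^n turns its divergence on the sphere into a flat one. *)
Definition flux l y := rho y ^+ n.-1 * tang l i y * pst P y.

(** Kept as [rho ^+ n.-1] times a bounded factor, so that each term is integrable by itself; the
    full weight [rho ^+ n] appears only after summing over [l]. *)
Definition dflux l y := rho y ^+ n.-1 *
  ((- (n%:R - 1) * rho y * nth 0 y l * tang l i y + dtang l i y) * pst P y +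
   \sum_m pst (mpoly.mderiv m P) y * (rho y * (tang l i y * tang l m y))).

Lemma lderiv_flux l : lderiv l (flux l) (dflux l).
Proof.
have := lderiv_mul (lderiv_mul (lderiv_exp n.-1 (lderiv_rho l)) (lderiv_tang l i))
   (lderiv_meval P (lderiv_st l)).
move=> h; apply: (lderiv_eq h) => y; rewrite /dflux /pst.
rewrite [in RHS]mulrDr.
have -> : (n.-1)%:R = n%:R - 1 :> R by rewrite -subn1 natrB// ltnW.
have -> : rho y ^+ n.-1 = rho y * rho y ^+ n.-2 by rewrite -exprS; case: (n) n1 => [|[]].
congr (_ + _); first by ring.
by rewrite [LHS]mulr_sumr [RHS]mulr_sumr; apply: eq_bigr => m _; ring.
Qed.

(** The Laplacian of x_i on the sphere is -n x_i, and the inner product of grad x_i with grad P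
    comes from [sum_tang]. *)
Lemma sum_dflux y : \sum_(l < n) dflux l y = rho y ^+ n *
  (- n%:R * st i y * pst P y + pst (mpoly.mderiv i P) y
   - st i y * \sum_m st m y * pst (mpoly.mderiv m P) y).
Proof.
rewrite /dflux -mulr_sumr big_split/= -mulr_suml sum_dtang exchange_big/=.
have -> : rho y ^+ n = rho y ^+ n.-1 * rho y by rewrite -exprSr prednK// ltnW.
rewrite -[RHS]mulrA; congr (_ * _).
under [X in _ + X]eq_bigr => m _ do rewrite -!mulr_sumr sum_tang.
have -> : \sum_m pst (mpoly.mderiv m P) y * (rho y * ((i == m)%:R - st i y * st m y)) =
    rho y * pst (mpoly.mderiv i P) y - rho y * st i y * \sum_m st m y * pst (mpoly.mderiv m P) y.
  transitivity (\sum_m (rho y * (pst (mpoly.mderiv m P) y * (i == m)%:R) -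
    rho y * st i y * (st m y * pst (mpoly.mderiv m P) y))).
    by apply: eq_bigr => m _; ring.
  rewrite sumrB -!mulr_sumr (bigD1 i)//= eqxx big1 ?addr0 ?mulr1// => m mi.
  by rewrite eq_sym (negbTE mi) mulr0.
by ring.
Qed.

End field.

End stereographic.

(** * Gaussian integrals on R^k and the integral of powers of 1 + |y|^2 *)

Section gaussian.
Context {R : realType}.
Let mu : {measure set (measurableTypeR R) -> \bar R} := @lebesgue_measure R.
Implicit Types (k : nat) (t b : R).

Lemma ge0_integral_scale d (T : measurableType d) (m : {measure set T -> \bar R}) (f : T -> R) (c : R) :
  measurable_fun setT f -> (forall x, 0 <= f x) -> 0 <= c ->
  (\int[m]_x (c * f x)%:E = c%:E * \int[m]_x (f x)%:E)%E.
Proof.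
move=> mf f0 c0; under eq_integral do rewrite EFinM.
apply: ge0_integralZl => //; first exact/measurable_EFinP.
by move=> x _; rewrite lee_fin.
Qed.

Lemma integral_gauss_line t : 0 < t ->
  (\int[mu]_x (expR (- (t * x ^+ 2)))%:E = (Num.sqrt (pi / t))%:E)%E.
Proof.
move=> t0; pose c := Num.sqrt t.
have c0 : 0 < c by rewrite sqrtr_gt0.
have c2 : c ^+ 2 = t by rewrite sqr_sqrtr// ltW.
have dF x : is_derive x (1:R) (fun x => x * c) c.
  have := is_derive_cmul c (is_derive_id x (1:R)); rewrite mulr1.
  by rewrite (_ : (fun u => c * id u) = (fun u => u * c))//; apply/funext => u; rewrite mulrC.
have dE : (fun x : R => x * c)^`()%classic = cst c.
  by apply/funext => x; rewrite derive1E; apply: derive_val.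
have := @increasing_ge0_integration_by_substitutionT R (fun x => x * c) gauss_fun.
rewrite dE integralT_gauss => sub.
transitivity (\int[mu]_x (c^-1%:E * (((gauss_fun \o (fun x => x * c)%R) * cst c)%R x)%:E))%E.
  apply: eq_integral => x _; rewrite -EFinM; congr EFin; rewrite /= /gauss_fun /cst.
  rewrite [in RHS]mulrC -mulrA divff ?gt_eqF// mulr1; congr (expR (- _)).
  by rewrite exprMn c2 mulrC.
rewrite ge0_integralZl//.
- rewrite -sub.
  + by rewrite -EFinM sqrtrM ?pi_ge0// sqrtrV ?(ltW t0)// mulrC.
  + by move=> x y xy; rewrite ltr_pM2r.
  + by move=> x; exact: cvg_cst.
  + exact: is_cvg_cst.
  + exact: is_cvg_cst.
  + by move=> x; exact: ex_derive.
  + by apply: gt0_cvgMlNy => //; exact: cvg_id.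
  + by apply: gt0_cvgMly => //; exact: cvg_id.
  + exact: continuous_gauss_fun.
  + exact: gauss_fun_ge0.
- apply/measurable_EFinP; apply: continuous_measurable_fun => x; apply: cvgM; last exact: cvg_cst.
  apply: (@continuous_comp _ _ _ (fun t => t * c) gauss_fun).
    exact: (is_derive_continuous (dF x)).
  exact: continuous_gauss_fun.
- by move=> x _; rewrite lee_fin mulr_ge0 ?(ltW c0)// gauss_fun_ge0.
- by rewrite lee_fin invr_ge0 ltW.
Qed.

Lemma measurable_ysq k :
  measurable_fun setT (fun p : cs_type (@Rn R k) => ysq k (cs_seq p)).
Proof.
apply: measurable_sum => i; apply: measurable_funX; exact: measurable_coord.
Qed.

Lemma ysq_cons k x (s : seq R) : ysq k.+1 (x :: s) = x ^+ 2 + ysq k s.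
Proof. by rewrite /ysq big_ord_recl. Qed.

Lemma integral_gauss_Rn k t : 0 < t ->
  (\int[cs_mu (@Rn R k)]_p (expR (- (t * ysq k (cs_seq p))))%:E = (Num.sqrt (pi / t) ^+ k)%:E)%E.
Proof.
move=> t0; elim: k => [|k ih].
  by rewrite /= integral_dirac// diracT mul1e /ysq big_ord0 mulr0 oppr0 expR0 expr0.
pose f (q : measurableTypeR R * cs_type (@Rn R k)) := (expR (- (t * ysq k.+1 (q.1 :: cs_seq q.2))))%:E.
transitivity (\int[mu]_x \int[cs_mu (@Rn R k)]_p f (x, p))%E.
  apply: (@fubini_tonelli1 _ _ _ _ _ (@lebesgue_measure R) (cs_mu (@Rn R k)) f).
    apply/measurable_EFinP; apply: measurableT_comp => //.
    apply: measurableT_comp => //; apply: measurable_funM => //.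
    exact: (@measurable_ysq k.+1).
  by move=> q; rewrite lee_fin expR_ge0.
have mg : measurable_fun setT (fun p : cs_type (@Rn R k) => expR (- (t * ysq k (cs_seq p)))).
  apply: measurableT_comp => //.
  by apply: measurableT_comp => //; apply: measurable_funM => //; exact: measurable_ysq.
have ml : measurable_fun setT (fun x : measurableTypeR R => expR (- (t * x ^+ 2))).
  apply: measurableT_comp => //.
  by apply: measurableT_comp => //; apply: measurable_funM.
have E x : (\int[cs_mu (@Rn R k)]_p f (x, p) = (Num.sqrt (pi / t) ^+ k * expR (- (t * x ^+ 2)))%:E)%E.
  transitivity (\int[cs_mu (@Rn R k)]_p (expR (- (t * x ^+ 2)) * expR (- (t * ysq k (cs_seq p))))%:E)%E.
    by apply: eq_integral => p _; rewrite /f ysq_cons /= mulrDr opprD expRD.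
  by rewrite (ge0_integral_scale _ mg) ?expR_ge0// ih -EFinM mulrC.
under eq_integral do rewrite E.
rewrite (ge0_integral_scale _ ml) ?exprn_ge0 ?sqrtr_ge0//.
by rewrite integral_gauss_line// -EFinM exprSr.
Qed.

(** Gamma(b) (1 + |y|^2)^(-b) is the integral of t^(b-1) exp(-t (1 + |y|^2)) over t > 0. By Tonelli
    the integral in y comes first: a Gaussian worth (pi / t)^(k/2), which leaves a Gamma integral at
    b - k/2. *)
Lemma integral_ysq_powR k b : 1 <= b -> k%:R / 2 < b ->
  (\int[cs_mu (@Rn R k)]_p ((1 + ysq k (cs_seq p)) `^ (- b))%:E =
   (pi `^ (k%:R / 2) * Gamma (b - k%:R / 2) / Gamma b)%:E)%E.
Proof.
move=> b1 kb; have b0 : 0 < b by exact: lt_le_trans b1.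
have Gb := Gamma_gt0 b0.
pose D := `]0%R, +oo[%classic : set (measurableTypeR R).
have mD : measurable D by exact: measurable_itv.
pose f (q : cs_type (@Rn R k) * measurableTypeR R) : \bar R :=
  (q.2 `^ (b - 1) * expR (- (q.2 * (1 + ysq k (cs_seq q.1)))) * \1_D q.2)%:E.
have mf : measurable_fun setT f.
  apply/measurable_EFinP; apply: measurable_funM.
    apply: measurable_funM.
      exact: (measurableT_comp (@measurable_powR R (b - 1)) measurable_snd).
    apply: (measurableT_comp (@measurable_expR R)); apply: measurable_funN.
    apply: measurable_funM; first exact: measurable_snd.
    apply: measurable_funD; first exact: measurable_cst.
    exact: (measurableT_comp (@measurable_ysq k) measurable_fst).
  exact: (measurableT_comp (measurable_indic mD) measurable_snd).
have f0 q : (0 <= f q)%E.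
  by rewrite lee_fin mulr_ge0// mulr_ge0 ?powR_ge0 ?expR_ge0.
have H := fubini_tonelli (m1 := cs_mu (@Rn R k)) (m2 := @lebesgue_measure R) f mf f0.
have E1 p : (\int[@lebesgue_measure R]_t f (p, t) = (Gamma b * (1 + ysq k (cs_seq p)) `^ (- b))%:E)%E.
  rewrite powRN -Gamma_scale// ?ysq1_gt0//.
  rewrite [RHS]integral_mkcond; apply: eq_integral => t _.
  rewrite /f /= patchE indicE; case: ifPn => _; first by rewrite mulr1.
  by rewrite mulr0.
have E2 t : (\int[cs_mu (@Rn R k)]_p f (p, t) =
   (pi `^ (k%:R / 2))%:E * ((EFin \o Gamma_integrand (b - k%:R / 2)) \_ D) t)%E.
  rewrite patchE; have [tD|tD] := boolP (t \in D); last first.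
    rewrite mule0; apply: integral0_eq => p _.
    by rewrite /f /= indicE (negbTE tD) mulr0.
  have t0 : 0 < t by move: tD; rewrite inE /D /= in_itv/= andbT.
  transitivity (\int[cs_mu (@Rn R k)]_p (t `^ (b - 1) * expR (- t) * expR (- (t * ysq k (cs_seq p))))%:E)%E.
    apply: eq_integral => p _; rewrite /f /= indicE tD mulr1 mulrDr mulr1 opprD expRD.
    by rewrite mulrA.
  have mg : measurable_fun setT (fun p : cs_type (@Rn R k) => expR (- (t * ysq k (cs_seq p)))).
    apply: measurableT_comp => //.
    by apply: measurableT_comp => //; apply: measurable_funM => //; exact: measurable_ysq.
  rewrite (ge0_integral_scale _ mg) ?mulr_ge0 ?powR_ge0 ?expR_ge0//; last first.
  rewrite integral_gauss_Rn// -!EFinM; congr EFin; rewrite /Gamma_integrand.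
  rewrite -powR12_sqrt ?divr_ge0 ?pi_ge0 ?(ltW t0)//.
  rewrite -[_ ^+ k]powR_mulrn ?powR_ge0//.
  rewrite -powRrM powRM ?invr_ge0 ?pi_ge0 ?(ltW t0)//.
  rewrite -(powR_inv1 (ltW t0)) -powRrM.
  rewrite (_ : b - k%:R / 2 - 1 = (b - 1) + (-1 * (2^-1 * k%:R))); last by ring.
  rewrite [t `^ (b - 1 + _)]powRD ?(gt_eqF t0) ?implybT//.
  by rewrite [2^-1 * k%:R]mulrC; ring.
move: H; under eq_integral => p _ do rewrite E1.
under [X in _ = X]eq_integral => t _ do rewrite E2.
have my : measurable_fun setT (fun p : cs_type (@Rn R k) => (1 + ysq k (cs_seq p)) `^ (- b)).
  apply: (measurableT_comp (@measurable_powR R (- b))).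
  by apply: measurable_funD => //; exact: measurable_ysq.
rewrite (ge0_integral_scale _ my) ?(ltW Gb)//; last by move=> p; exact: powR_ge0.
have mG : measurable_fun setT ((EFin \o Gamma_integrand (b - k%:R / 2)) \_ D).
  by apply/(measurable_restrictT _ mD)/measurable_EFinP; exact: measurable_Gamma_integrand.
rewrite (ge0_integralZl _ _ mG) ?lee_fin ?powR_ge0//; last first.
  by move=> t _; apply: erestrict_ge0 => u _; rewrite lee_fin mulr_ge0 ?powR_ge0 ?expR_ge0.
rewrite -integral_mkcond GammaE ?subr_gt0// -EFinM => H.
rewrite EFinM -H muleAC -EFinM divff ?gt_eqF// mul1e//.
Qed.

End gaussian.

(** * Bounded measurable functions of the stereographic coordinates *)

Section bounded_measurable.
Context {R : realType} (n : nat).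
Implicit Types (F G : seq R -> R) (i : 'I_n.+1) (l : 'I_n).

(** A class closed under polynomial operations whose members are integrable against every weight
    [rho ^+ m] with n < 2m; it spares separate integrability proofs. *)
Definition bm F := (exists M, forall y, `|F y| <= M) /\
  measurable_fun setT (fun p : cs_type (@Rn R n) => F (cs_seq p)).

Lemma bm_cst c : bm (fun=> c).
Proof. by split; last exact: measurable_cst; exists (`|c|). Qed.

Lemma bm_add F G : bm F -> bm G -> bm (fun y => F y + G y).
Proof.
move=> [[M hM] mF] [[N hN] mG]; split; last exact: measurable_funD.
by exists (M + N) => y; rewrite (le_trans (ler_normD _ _))// lerD.
Qed.

Lemma bm_opp F : bm F -> bm (fun y => - F y).
Proof.
move=> [[M hM] mF]; split; last exact: measurable_funN.
by exists M => y; rewrite normrN.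
Qed.

Lemma bm_mul F G : bm F -> bm G -> bm (fun y => F y * G y).
Proof.
move=> [[M hM] mF] [[N hN] mG]; split; last exact: measurable_funM.
by exists (M * N) => y; rewrite normrM ler_pM.
Qed.

Lemma bm_sum (I : Type) (r : seq I) (F : I -> seq R -> R) :
  (forall i : I, bm (F i)) -> bm (fun y => \sum_(i <- r) F i y).
Proof.
move=> h; elim: r => [|i r ih].
  rewrite (_ : (fun y => _) = fun=> 0); first exact: bm_cst.
  by apply/funext => y; rewrite big_nil.
rewrite (_ : (fun y => _) = fun y => F i y + \sum_(i <- r) F i y).
  exact: bm_add.
by apply/funext => y; rewrite big_cons.
Qed.

Lemma bm_exp F k : bm F -> bm (fun y => F y ^+ k).
Proof.
move=> hF; elim: k => [|k ih]; first exact: bm_cst.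
rewrite (_ : (fun y => _) = fun y => F y * F y ^+ k); first exact: bm_mul.
by apply/funext => y; rewrite exprS.
Qed.

Lemma bm_meval m (g : 'I_m -> seq R -> R) (p : mpoly.mpoly m R) :
  (forall i : 'I_m, bm (g i)) -> bm (fun y => mpoly.meval (g^~ y) p).
Proof.
move=> hg; move: p; apply: mpoly_alg_ind => [c|i|p q hp hq|p q hp hq].
- rewrite (_ : (fun y => _) = fun=> c); first exact: bm_cst.
  by apply/funext => y; rewrite mpoly.mevalC.
- rewrite (_ : (fun y => _) = g i)//.
  by apply/funext => y; rewrite mpoly.mevalXU.
- rewrite (_ : (fun y => _) = fun y => mpoly.meval (g^~ y) p + mpoly.meval (g^~ y) q).
    exact: bm_add.
  by apply/funext => y; rewrite mpoly.mevalD.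
- rewrite (_ : (fun y => _) = fun y => mpoly.meval (g^~ y) p * mpoly.meval (g^~ y) q).
    exact: bm_mul.
  by apply/funext => y; rewrite mpoly.mevalM.
Qed.

Lemma measurable_rho : measurable_fun setT (fun p : cs_type (@Rn R n) => rho n (cs_seq p)).
Proof.
rewrite (_ : (fun p => _) = (fun p => 2 * (1 + ysq n (cs_seq p)) `^ (-1))).
  apply: measurable_funM => //; apply: (measurableT_comp (@measurable_powR R (- 1))).
  by apply: measurable_funD => //; exact: measurable_ysq.
by apply/funext => p; rewrite powR_inv1// ltW// ysq1_gt0.
Qed.

Lemma bm_rho : bm (rho n).
Proof.
split; last exact: measurable_rho.
by exists 2 => y; rewrite ger0_norm ?rho_le2// ltW// rho_gt0.
Qed.

Lemma sqr_nth_le_ysq (l : 'I_n) (y : seq R) : nth 0 y l ^+ 2 <= ysq n y.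
Proof. by rewrite /ysq (bigD1 l)//= lerDl sumr_ge0// => i _; rewrite sqr_ge0. Qed.

Lemma bm_rho_nth (l : 'I_n) : bm (fun y => rho n y * nth 0 y l).
Proof.
split; last by apply: measurable_funM; [exact: measurable_rho|exact: measurable_coord].
exists 1 => y.
have := sqr_nth_le_ysq l y; have := rho_ysq n y; have := rho_gt0 n y.
move: (rho n y) (ysq n y) (nth 0 y l) => r q a r0 h aq.
have : r ^+ 2 * a ^+ 2 <= r * (r * q) by rewrite expr2 -!mulrA !ler_pM2l.
rewrite h -exprMn => ra; have {}ra : (r * a) ^+ 2 <= 1.
  by apply: (le_trans ra); have := sqr_ge0 (r - 1); rewrite !expr2; lra.
by rewrite -(@expr_le1 _ 2) ?normr_ge0// real_normK ?num_real.
Qed.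

(** The coordinates are unbounded, but one factor [rho] absorbs two of them because rho |y|^2 = 2 -
    rho. *)
Lemma bm_rho_nth2 (l k : 'I_n) : bm (fun y => rho n y * nth 0 y k * nth 0 y l).
Proof.
split; last first.
  apply: measurable_funM; last exact: measurable_coord.
  by apply: measurable_funM; [exact: measurable_rho|exact: measurable_coord].
exists 2 => y.
have := sqr_nth_le_ysq l y; have := sqr_nth_le_ysq k y; have := rho_ysq n y; have := rho_gt0 n y.
rewrite -mulrA normrM; move: (rho n y) (ysq n y) (nth 0 y l) (nth 0 y k) => r q a b r0 h aq bq.
have ab : `|b * a| <= q.
  by rewrite ler_norml; have := sqr_ge0 (a - b); have := sqr_ge0 (a + b); move: aq bq; rewrite !expr2; nra.
rewrite (ger0_norm (ltW r0)) (le_trans (ler_wpM2l (ltW r0) ab))//.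
by rewrite h; lra.
Qed.

Lemma bm_rho_sty i : bm (fun y => rho n y * sty i y).
Proof.
have [->|[a ->]] := sphere_ordP i.
  by under eq_fun do rewrite sty_max; apply: bm_mul; [exact: bm_rho|exact: bm_cst].
by under eq_fun do rewrite sty_widen; exact: bm_rho_nth.
Qed.

Lemma bm_rho_sty_nth i l : bm (fun y => rho n y * sty i y * nth 0 y l).
Proof.
have [->|[a ->]] := sphere_ordP i.
  rewrite (_ : (fun y => _) = (fun y => -1 * (rho n y * nth 0 y l))).
    by apply: bm_mul; [exact: bm_cst|exact: bm_rho_nth].
  by apply/funext => y; rewrite sty_max; ring.
by under eq_fun do rewrite sty_widen; exact: bm_rho_nth2.
Qed.

Lemma bm_tang l i : bm (tang (n := n) l i).
Proof. by apply: bm_add; [exact: bm_cst|apply: bm_opp; exact: bm_rho_sty_nth]. Qed.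

Lemma bm_dtang l i : bm (dtang (n := n) l i).
Proof.
rewrite (_ : dtang l i = (fun y => (rho n y * nth 0 y l) * (rho n y * sty i y * nth 0 y l)
   - (kron l i * (rho n y * nth 0 y l) + rho n y * sty i y))).
  apply: bm_add; first by apply: bm_mul; [exact: bm_rho_nth|exact: bm_rho_sty_nth].
  apply: bm_opp; apply: bm_add; last exact: bm_rho_sty.
  by apply: bm_mul; [exact: bm_cst|exact: bm_rho_nth].
by apply/funext => y; rewrite /dtang; ring.
Qed.

Lemma bm_st i : bm (st i).
Proof.
rewrite (_ : st i = fun y => rho n y * sty i y + pole i); last by apply/funext => y; exact: stE.
by apply: bm_add; [exact: bm_rho_sty|exact: bm_cst].
Qed.

Lemma bm_pst P : bm (pst (n := n) P).
Proof. by apply: bm_meval => i; exact: bm_st. Qed.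

End bounded_measurable.

(** * Vanishing of the integral of each partial derivative of the flux *)

Section sphere_integral.
Context {R : realType} (n : nat).
Hypothesis n2 : (2 < n)%N.
Let mu := cs_mu (@Rn R n).
Let T := cs_type (@Rn R n).

Lemma rho_exprE m (y : seq R) : rho n y ^+ m = 2 ^+ m * (1 + ysq n y) `^ (- m%:R).
Proof.
by rewrite powRN powR_mulrn ?(ltW (ysq1_gt0 n y))// /rho exprMn exprVn.
Qed.

Lemma integral_rho_expr m : (n < m.*2)%N ->
  (\int[mu]_p (rho n (cs_seq p) ^+ m)%:E =
  (2 ^+ m * (pi `^ (n%:R / 2) * Gamma (m%:R - n%:R / 2) / Gamma m%:R))%:E)%E.
Proof.
move=> nm; under eq_integral do rewrite rho_exprE.
rewrite ge0_integral_scale ?exprn_ge0//.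
- rewrite integral_ysq_powR -?EFinM//; first by rewrite ler1n; lia.
  by rewrite ltr_pdivrMr// -natrM ltr_nat muln2.
- apply: (measurableT_comp (@measurable_powR R (- m%:R))).
  by apply: measurable_funD => //; exact: measurable_ysq.
- by move=> p; exact: powR_ge0.
Qed.

Lemma integrable_rho_expr m : (n < m.*2)%N ->
  mu.-integrable setT (fun p : T => (rho n (cs_seq p) ^+ m)%:E).
Proof.
move=> nm; apply/integrableP; split.
  by apply/measurable_EFinP/measurable_funX; exact: measurable_rho.
under eq_integral do rewrite gee0_abs ?lee_fin ?exprn_ge0 ?(ltW (rho_gt0 _ _))//.
by rewrite integral_rho_expr// ltry.
Qed.

Lemma integrable_bm_rho F m : bm n F -> (n < m.*2)%N ->
  mu.-integrable setT (fun p : T => (rho n (cs_seq p) ^+ m * F (cs_seq p))%:E).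
Proof.
move=> [[M hM] mF] nm.
apply: (le_integrable measurableT _ _ (integrableZl measurableT M (integrable_rho_expr nm))).
  apply/measurable_EFinP/measurable_funM => //; apply/measurable_funX; exact: measurable_rho.
move=> p _; rewrite -EFinM /= lee_fin !normrM mulrC ler_pM//.
by rewrite (le_trans (hM _))// ler_norm.
Qed.

Lemma cs_upd_line l t (p : T) : (l < n)%N ->
  cs_seq (cs_upd l t p) = set_nth 0 (cs_seq p) l t.
Proof. exact: cs_seq_upd. Qed.

Lemma rho_line (l : 'I_n) (t : R) y : rho n (set_nth 0 y l t) <= 2 / (1 + t ^+ 2).
Proof.
rewrite /rho ler_pM2l// lef_pV2 ?posrE ?ysq1_gt0 ?ltr_pwDl ?sqr_ge0//.
by rewrite lerD2l; have := sqr_nth_le_ysq l (set_nth 0 y l t); rewrite nth_set_nth/= eqxx.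
Qed.

(** One factor [rho] is split off for the decay along the line, where it is at most 2 / (1 + t^2);
    the remaining factor is bounded. *)
Lemma flux_bound (i : 'I_n.+1) (P : mpoly.mpoly n.+1 R) : exists2 C : R, 0 <= C &
  forall l y t, `|flux i P l (set_nth 0 y l t)| <= C / (1 + t ^+ 2).
Proof.
have h l : bm n (fun y => rho n y ^+ n.-2 * (tang l i y * pst P y)).
  by apply: bm_mul; [apply/bm_exp/bm_rho|apply: bm_mul; [exact: bm_tang|exact: bm_pst]].
have /choice[M hM] l : exists M, forall y, `|rho n y ^+ n.-2 * (tang l i y * pst P y)| <= M.
  by have [[M hM] _] := h l; exists M.
pose C := \sum_l `|M l|.
have C0 : 0 <= C by exact: sumr_ge0.
have MC l : M l <= C by rewrite /C (bigD1 l)//= (le_trans (ler_norm _))// lerDl sumr_ge0.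
exists (C * 2) => [|l y t]; first by rewrite mulr_ge0.
rewrite (_ : flux i P l _ = rho n (set_nth 0 y l t) ^+ n.-2 *
   (tang l i (set_nth 0 y l t) * pst P (set_nth 0 y l t)) * rho n (set_nth 0 y l t)).
  rewrite normrM -mulrA ler_pM// ?(le_trans (hM _ _))//.
  by rewrite ger0_norm ?rho_line// ltW// rho_gt0.
rewrite /flux; have -> : n.-1 = n.-2.+1 by case: n n2 => [|[]].
by rewrite exprSr; ring.
Qed.

Lemma flux_cvg (i : 'I_n.+1) (P : mpoly.mpoly n.+1 R) (l : 'I_n) y :
  (fun k => flux i P l (set_nth 0 y l k.+1%:R) -
   flux i P l (set_nth 0 y l (- k.+1%:R))) @ \oo --> (0 : R).
Proof.
have [C C0 hC] := flux_bound i P.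
have E (x : R) : C * x + C * x = 2 * C * x by ring.
have b k : `|flux i P l (set_nth 0 y l k.+1%:R) - flux i P l (set_nth 0 y l (- k.+1%:R))| <= 2 * C * harmonic k.
  rewrite (le_trans (ler_normB _ _))//.
  rewrite (le_trans (lerD (hC _ _ _) (hC _ _ _)))// sqrrN E ler_wpM2l//.
    by rewrite mulr_ge0.
  rewrite /harmonic/= lef_pV2 ?posrE ?ltr_pwDl ?sqr_ge0//.
  by rewrite -natrX nat1r ler_nat; apply: leqW; rewrite expnS expn1 leq_pmulr.
have hz c : (fun k => c * harmonic k) @ \oo --> (0 : R).
  by rewrite -[X in _ --> X](mulr0 c); apply: cvgM; [exact: cvg_cst|exact: cvg_harmonic].
have hl := hz (- (2 * C)); have hr := hz (2 * C).
by apply: (squeeze_cvgr _ hl hr); apply: nearW => k; rewrite mulNr -ler_norml.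
Qed.

Definition lcont (l : nat) (F : seq R -> R) := forall y, continuous (fun t => F (set_nth 0 y l t)).

Lemma lcont_add l F G : lcont l F -> lcont l G -> lcont l (fun y => F y + G y).
Proof. by move=> hF hG y t; apply: cvgD; [exact: hF|exact: hG]. Qed.

Lemma lcont_mul l F G : lcont l F -> lcont l G -> lcont l (fun y => F y * G y).
Proof. by move=> hF hG y t; apply: cvgM; [exact: hF|exact: hG]. Qed.

Lemma lcont_lderiv (l : nat) (F F' : seq R -> R) : lderiv l F F' -> lcont l F.
Proof. exact: lderiv_continuous. Qed.

Lemma lcont_sum (I : Type) (r : seq I) l (F : I -> seq R -> R) :
  (forall i : I, lcont l (F i)) -> lcont l (fun y => \sum_(i <- r) F i y).
Proof.
move=> h; elim: r => [|i r ih].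
  rewrite (_ : (fun y => _) = fun=> 0); first by move=> y; exact: cst_continuous.
  by apply/funext => y; rewrite big_nil.
rewrite (_ : (fun y => _) = fun y => F i y + \sum_(i <- r) F i y).
  exact: lcont_add.
by apply/funext => y; rewrite big_cons.
Qed.

Lemma lcont_dflux (i : 'I_n.+1) (P : mpoly.mpoly n.+1 R) (l : 'I_n) : lcont l (dflux i P l).
Proof.
have cr := lcont_lderiv (lderiv_rho l).
have cy := lcont_lderiv (@lderiv_nth R l l).
have cs j := lcont_lderiv (lderiv_sty l j).
have ct k : lcont l (tang l k) by exact: (lcont_lderiv (lderiv_tang l k)).
have cp (Q : mpoly.mpoly n.+1 R) : lcont l (pst Q).
  have hQ := lcont_lderiv (lderiv_meval Q (lderiv_st l)); exact: hQ.
have cc c : lcont l (fun=> c) by move=> y; exact: cst_continuous.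
have cd : lcont l (dtang l i).
  rewrite (_ : dtang l i = fun y => -1 * (-1 * (rho n y * rho n y * nth 0 y l) * sty i y * nth 0 y l
     + rho n y * kron l i * nth 0 y l + rho n y * sty i y)); last by apply/funext => y; rewrite /dtang; ring.
  apply: (lcont_mul (cc (-1))); apply: lcont_add; last exact: (lcont_mul cr (cs i)).
  apply: lcont_add; last exact: (lcont_mul (lcont_mul cr (cc _)) cy).
  apply: (lcont_mul (lcont_mul _ (cs i)) cy).
  exact: (lcont_mul (cc (-1)) (lcont_mul (lcont_mul cr cr) cy)).
apply: lcont_mul; first exact: (lcont_lderiv (lderiv_exp n.-1 (lderiv_rho l))).
apply: lcont_add; last first.
  by apply: lcont_sum => m; exact: (lcont_mul (cp _) (lcont_mul cr (lcont_mul (ct i) (ct m)))).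
apply: lcont_mul; last exact: cp.
apply: lcont_add; last exact: cd.
exact: (lcont_mul (lcont_mul (lcont_mul (cc _) cr) cy) (ct i)).
Qed.

Lemma integrable_dflux (i : 'I_n.+1) (P : mpoly.mpoly n.+1 R) (l : 'I_n) :
  mu.-integrable setT (EFin \o (fun p : T => dflux i P l (cs_seq p))).
Proof.
have hF : bm n (fun y => (- (n%:R - 1) * rho n y * nth 0 y l * tang l i y + dtang l i y) * pst P y +
   \sum_m pst (mpoly.mderiv m P) y * (rho n y * (tang l i y * tang l m y))).
  apply: bm_add; last first.
    apply: bm_sum => m; apply: bm_mul; first exact: bm_pst.
    by apply: bm_mul; [exact: bm_rho|apply: bm_mul; exact: bm_tang].
  apply: bm_mul; last exact: bm_pst.
  apply: bm_add; last exact: bm_dtang.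
  apply: bm_mul; last exact: bm_tang.
  rewrite (_ : (fun y => _) = (fun y => - (n%:R - 1) * (rho n y * nth 0 y l))).
    by apply: bm_mul; [exact: bm_cst|exact: bm_rho_nth].
  by apply/funext => y; ring.
(* The weight is only [rho ^+ n.-1]; this inequality amounts to n >= 3. *)
have nn : (n < n.-1.*2)%N by lia.
exact: (integrable_bm_rho hF nn).
Qed.

Lemma integral_dflux (i : 'I_n.+1) (P : mpoly.mpoly n.+1 R) (l : 'I_n) : (\int[mu]_p (dflux i P l (cs_seq p))%:E = 0)%E.
Proof.
have fi := integrable_dflux i P l.
apply: (integral_lines_eq0 (ltn_ord l) fi) => p.
under eq_fun do rewrite cs_upd_line//.
under eq_integral do rewrite cs_upd_line//.
move: (cs_seq p) => y yi.
have setTE : \bigcup_k `[- k.+1%:R : R, k.+1%:R]%classic = setT.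
  apply/seteqP; split => // t _; exists (Num.truncn `|t|) => //=.
  have h := truncnS_gt `|t|; rewrite in_itv/= -ler_norml; exact: ltW.
rewrite -setTE; apply: (@FTC_exhaustion _ _ _ (fun t => flux i P l (set_nth 0 y l t))
  (fun t => dflux i P l (set_nth 0 y l t))).
- by move=> k; rewrite gtrN// ltr0n.
- by move=> k; rewrite lerN2 !ler_nat.
- by move=> t _; apply: lderiv_flux; lia.
- by move=> t _; exact: lcont_dflux.
- exact: flux_cvg.
- by rewrite setTE.
Qed.

End sphere_integral.

(** * Homogeneous polynomials, Euler's identity, the Laplacian *)

Section homogeneous.
Context {R : realType} {m : nat}.
Notation mp := (mpoly.mpoly m R).
Notation U := mpoly.mnm1.
Notation X i := (mpoly.mpolyX R (mpoly.mnm1 i)).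
Implicit Types (p : mp) (k : nat).

Definition homog k p := all (fun u => mpoly.mdeg u == k) (mpoly.msupp p).
Definition laplacian p := \sum_(i < m) mpoly.mderiv i (mpoly.mderiv i p).

Lemma meval_sum (I : Type) (r : seq I) (F : I -> mp) (v : 'I_m -> R) :
  mpoly.meval v (\sum_(i <- r) F i) = \sum_(i <- r) mpoly.meval v (F i).
Proof. exact: (big_morph _ (mpoly.mevalD v) (mpoly.meval0 v)). Qed.

Lemma mderiv_sum (I : Type) (r : seq I) (F : I -> mp) i :
  mpoly.mderiv i (\sum_(j <- r) F j) = \sum_(j <- r) mpoly.mderiv i (F j).
Proof. exact: (big_morph _ (mpoly.mderivD i) (mpoly.mderiv0 _ i)). Qed.

Lemma homog_mderiv k p i : homog k p -> homog k.-1 (mpoly.mderiv i p).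
Proof.
move=> /allP hp; apply/allP => u.
rewrite mpoly.mcoeff_msupp mpoly.mcoeff_mderiv => h.
have /hp : mpoly.mnm_add u (U i) \in mpoly.msupp p.
  by rewrite mpoly.mcoeff_msupp; apply: contraNneq h => ->; rewrite mul0rn.
by rewrite mpoly.mdegD mpoly.mdeg1 addn1 => /eqP <-.
Qed.

Lemma laplacian_mderiv p i : laplacian p = 0 -> laplacian (mpoly.mderiv i p) = 0.
Proof.
move=> h; transitivity (mpoly.mderiv i (laplacian p)); last by rewrite h mpoly.mderiv0.
rewrite /laplacian mderiv_sum; apply: eq_bigr => j _.
by rewrite (mpoly.mderiv_comm i j) (mpoly.mderiv_comm i j).
Qed.

Lemma euler_homog k p (v : 'I_m -> R) : homog k p ->
  \sum_(i < m) v i * mpoly.meval v (mpoly.mderiv i p) = k%:R * mpoly.meval v p.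
Proof.
move=> /allP hp; rewrite {1 2}(mpoly.mpolyE p).
transitivity (\sum_(i < m) \sum_(u <- mpoly.msupp p) mpoly.mcoeff u p * (v i * mpoly.meval v (mpoly.mderiv i (mpoly.mpolyX R u)))).
  apply: eq_bigr => i _; rewrite mderiv_sum meval_sum mulr_sumr; apply: eq_bigr => u _.
  by rewrite mpoly.mderivZ mpoly.mevalZ; ring.
rewrite exchange_big/= meval_sum mulr_sumr !big_seq; apply: eq_bigr => u /hp /eqP uk.
rewrite -mulr_sumr mpoly.mevalZ mulrCA; congr (_ * _).
rewrite -uk mpoly.mdegE natr_sum mulr_suml; apply: eq_bigr => i _.
rewrite mpoly.mderivX mpoly.mevalZ mulrCA; have [->|ui] := eqVneq (mpoly.fun_of_multinom u i) 0%N.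
  by rewrite !mul0r.
congr (_ * _); rewrite -[in LHS](mpoly.mevalXU v i) -mpoly.mevalM -mpoly.mpolyXD.
congr (mpoly.meval v (mpoly.mpolyX R _)); apply/mpoly.mnmP => j.
rewrite mpoly.mnmDE mpoly.mnmBE subnKC// mpoly.mnm1E; case: eqP => [<-|]//.
by rewrite lt0n.
Qed.

Lemma homog0_const p (v w : 'I_m -> R) : homog 0 p -> mpoly.meval v p = mpoly.meval w p.
Proof.
move=> /allP hp; rewrite !mpoly.mevalE !big_seq; apply: eq_bigr => u /hp.
rewrite mpoly.mdeg_eq0 => /eqP ->; congr (_ * _).
by apply: eq_bigr => i _; rewrite mpoly.mnm0E !expr0.
Qed.

Lemma mderiv_exp p N i : mpoly.mderiv i (p ^+ N) = N%:R *: (p ^+ N.-1 * mpoly.mderiv i p).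
Proof.
elim: N => [|N ih]; first by rewrite expr0 scale0r -mpoly.mpolyC1 mpoly.mderivC.
rewrite exprS mpoly.mderivM ih; case: N {ih} => [|N].
  by rewrite /= scale0r mulr0 addr0 !expr0 scale1r mulr1 mul1r.
rewrite /= -scalerAr mulrA -exprS -[N.+2%:R]natr1 scalerDl scale1r addrC; congr (_ + _).
by rewrite mulrC.
Qed.

Lemma mderiv_XU i j : mpoly.mderiv i (X j) = mpoly.mpolyC m (i == j)%:R.
Proof.
rewrite mpoly.mderivX mpoly.mnm1E eq_sym; case: eqP => [->|_].
  rewrite scale1r (_ : mpoly.mnm_sub _ _ = mpoly.mnm0).
    by rewrite mpoly.mpolyX0 mpoly.mpolyC1.
  by apply/mpoly.mnmP => k; rewrite mpoly.mnmBE subnn mpoly.mnm0E.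
by rewrite scale0r mpoly.mpolyC0.
Qed.

End homogeneous.

(** * The sphere integral as a linear functional, and the moment recursion *)

Section sphere_functional.
Context {R : realType} (n : nat).
Hypothesis n2 : (2 < n)%N.
Let mu := cs_mu (@Rn R n).
Let T := cs_type (@Rn R n).
Implicit Types (F G : seq R -> R).

Definition Lam F : R := \int[mu]_p (rho n (cs_seq p) ^+ n * F (cs_seq p)).

Let nn : (n < n.*2)%N. Proof. lia. Qed.

Lemma integrable_bm F : bm n F ->
  mu.-integrable setT (fun p : T => (rho n (cs_seq p) ^+ n * F (cs_seq p))%:E).
Proof. by move=> hF; exact: integrable_bm_rho. Qed.

Lemma Lam_add F G : bm n F -> bm n G -> Lam (fun y => F y + G y) = Lam F + Lam G.
Proof.
move=> hF hG; rewrite /Lam -RintegralD//; [|exact: integrable_bm..].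
by apply: eq_Rintegral => p _; rewrite mulrDr.
Qed.

Lemma Lam_cmul c F : bm n F -> Lam (fun y => c * F y) = c * Lam F.
Proof.
move=> hF; rewrite /Lam -RintegralZl//; last exact: integrable_bm.
by apply: eq_Rintegral => p _; rewrite mulrCA.
Qed.

Lemma Lam0 : Lam (fun=> 0) = 0.
Proof.
transitivity (Lam (fun=> 0 * 0)); first by congr Lam; apply/funext => y; rewrite mul0r.
by rewrite (Lam_cmul 0 (bm_cst n 0)) mul0r.
Qed.

Lemma Lam_sum (I : Type) (r : seq I) (F : I -> seq R -> R) : (forall i : I, bm n (F i)) ->
  Lam (fun y => \sum_(i <- r) F i y) = \sum_(i <- r) Lam (F i).
Proof.
move=> h; elim: r => [|i r ih].
  rewrite big_nil -[RHS]Lam0; congr Lam; by apply/funext => y; rewrite big_nil.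
rewrite big_cons -ih -Lam_add//; last exact: bm_sum.
by congr Lam; apply/funext => y; rewrite big_cons.
Qed.

Lemma Lam_le F G : bm n F -> bm n G -> (forall y, F y <= G y) -> Lam F <= Lam G.
Proof.
move=> hF hG FG; apply: le_Rintegral => //; [exact: integrable_bm..|move=> p _].
by rewrite ler_wpM2l// exprn_ge0// ltW// rho_gt0.
Qed.

Lemma Lam1_gt0 : 0 < Lam (fun=> 1).
Proof.
rewrite /Lam /Rintegral; under eq_integral do rewrite mulr1.
rewrite integral_rho_expr//= mulr_gt0 ?exprn_gt0//.
have n0 : (0 : R) < n%:R by rewrite ltr0n; lia.
rewrite divr_gt0 ?Gamma_gt0// mulr_gt0 ?powR_gt0 ?pi_gt0 ?Gamma_gt0//.
by rewrite subr_gt0 ltr_pdivrMr// ltr_pMr// ltr1n.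
Qed.

(* The divergence theorem on the sphere, for the gradient field of the [i]-th
   coordinate function times [P]. *)
Lemma sphere_ibp (i : 'I_n.+1) (P : mpoly.mpoly n.+1 R) :
  Lam (fun y => - n%:R * st i y * pst P y + pst (mpoly.mderiv i P) y
   - st i y * \sum_j st j y * pst (mpoly.mderiv j P) y) = 0.
Proof.
have n1 : (1 < n)%N by exact: ltnW.
rewrite /Lam; under eq_Rintegral => p _ do rewrite -(sum_dflux _ _ n1).
rewrite /Rintegral; under eq_integral do rewrite -sumEFin.
rewrite integral_sum//; last by move=> l; exact: integrable_dflux.
by rewrite big1// => l _; exact: integral_dflux.
Qed.

Definition zdot (z : 'I_n.+1 -> R) y := \sum_i z i * st i y.
Definition vz z y := 2^-1 * (1 + zdot z y).
(** The polynomial that restricts to [vz z] on the sphere: powers of v have to be polynomials to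
    enter [sphere_ibp]. *)
Definition Vz (z : 'I_n.+1 -> R) : mpoly.mpoly n.+1 R :=
  2^-1 *: (1 + \sum_i z i *: mpoly.mpolyX R (mpoly.mnm1 i)).

Lemma pst_Vz z y : pst (Vz z) y = vz z y.
Proof.
rewrite /pst /Vz mpoly.mevalZ mpoly.mevalD mpoly.meval1 meval_sum /vz /zdot.
by congr (_ * (_ + _)); apply: eq_bigr => i _; rewrite mpoly.mevalZ mpoly.mevalXU.
Qed.

Lemma mderiv_Vz z i : mpoly.mderiv i (Vz z) = mpoly.mpolyC n.+1 (2^-1 * z i).
Proof.
rewrite /Vz mpoly.mderivZ mpoly.mderivD -mpoly.mpolyC1 mpoly.mderivC add0r mderiv_sum.
rewrite (bigD1 i)//= mpoly.mderivZ mderiv_XU eqxx big1 ?addr0 => [|j ji].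
  by rewrite mpoly.mpolyC1 scalerA -mpoly.mul_mpolyC mulr1.
by rewrite mpoly.mderivZ mderiv_XU eq_sym (negbTE ji) mpoly.mpolyC0 scaler0.
Qed.

Lemma bm_zdot z : bm n (zdot z).
Proof. by apply: bm_sum => i; apply: bm_mul; [exact: bm_cst|exact: bm_st]. Qed.

Lemma bm_vz z : bm n (vz z).
Proof. by apply: bm_mul; [exact: bm_cst|apply: bm_add; [exact: bm_cst|exact: bm_zdot]]. Qed.

Definition unitv (z : 'I_n.+1 -> R) := \sum_i z i ^+ 2 = 1.

Lemma pstM p q y : pst (n := n) (p * q) y = pst p y * pst q y :> R.
Proof. exact: mpoly.mevalM. Qed.

Lemma pst_exp p N y : pst (n := n) (p ^+ N) y = pst p y ^+ N :> R.
Proof.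
elim: N => [|N ih]; first by rewrite !expr0 /pst mpoly.meval1.
by rewrite !exprS pstM ih.
Qed.

Definition zderiv (z : 'I_n.+1 -> R) p : mpoly.mpoly n.+1 R := \sum_i z i *: mpoly.mderiv i p.

Lemma pst_zderiv z p y : pst (zderiv z p) y = \sum_i z i * pst (mpoly.mderiv i p) y.
Proof. by rewrite /pst meval_sum; apply: eq_bigr => i _; rewrite mpoly.mevalZ. Qed.

(** The divergence identity for p [Vz]^N, summed over i with weights z_i. Euler's identity handles
    the radial derivatives, |z| = 1 the derivative of [Vz] along z, and <z, x> = 2v - 1 raises the
    power of v. *)
Lemma moment_rec z p k N : unitv z -> homog k p ->
  (2 * n%:R + 2 * k%:R + 2 * N%:R) * Lam (fun y => pst p y * vz z y ^+ N.+1) =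
  (n%:R + k%:R + 2 * N%:R) * Lam (fun y => pst p y * vz z y ^+ N) +
  Lam (fun y => pst (zderiv z p) y * vz z y ^+ N).
Proof.
move=> z1 hp; pose P := p * Vz z ^+ N.
have bp (q : mpoly.mpoly n.+1 R) M : bm n (fun y => pst q y * vz z y ^+ M).
  by apply: bm_mul; [exact: bm_pst|apply: bm_exp; exact: bm_vz].
have dP i y : pst (mpoly.mderiv i P) y = pst (mpoly.mderiv i p) y * vz z y ^+ N +
    N%:R * 2^-1 * pst p y * vz z y ^+ N.-1 * z i.
  rewrite /P mpoly.mderivM mderiv_exp mderiv_Vz /pst mpoly.mevalD !mpoly.mevalM.
  rewrite mpoly.mevalZ mpoly.mevalM mpoly.mevalC -!/(pst _ _) !pst_exp pst_Vz; ring.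
have E y : \sum_i z i * (- n%:R * st i y * pst P y + pst (mpoly.mderiv i P) y
   - st i y * \sum_j st j y * pst (mpoly.mderiv j P) y) =
  - (2 * n%:R + 2 * k%:R + 2 * N%:R) * (pst p y * vz z y ^+ N.+1) +
  ((n%:R + k%:R + 2 * N%:R) * (pst p y * vz z y ^+ N) + pst (zderiv z p) y * vz z y ^+ N).
  have e1 : \sum_j st j y * pst (mpoly.mderiv j P) y =
      k%:R * pst p y * vz z y ^+ N + N%:R * 2^-1 * pst p y * vz z y ^+ N.-1 * zdot z y.
    rewrite -(euler_homog (fun j : 'I_n.+1 => st j y) hp) mulr_suml /zdot mulr_sumr -big_split /=.
    by apply: eq_bigr => j _; rewrite dP /pst; ring.
  have e2 : \sum_i z i * pst (mpoly.mderiv i P) y =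
      pst (zderiv z p) y * vz z y ^+ N + N%:R * 2^-1 * pst p y * vz z y ^+ N.-1.
    have c1 (c : R) : c = \sum_i c * z i ^+ 2 by rewrite -mulr_sumr z1 mulr1.
    rewrite pst_zderiv mulr_suml [X in _ = _ + X]c1 -big_split /=.
    by apply: eq_bigr => i _; rewrite dP; ring.
  transitivity (- n%:R * zdot z y * pst P y + \sum_i z i * pst (mpoly.mderiv i P) y
     - zdot z y * \sum_j st j y * pst (mpoly.mderiv j P) y).
    move: (\sum_j st j y * pst (mpoly.mderiv j P) y) => S.
    move: (pst P y) => Py; rewrite /zdot mulr_sumr !mulr_suml -big_split -sumrB /=.
    by apply: eq_bigr => i _; ring.
  rewrite e1 e2 pstM pst_exp pst_Vz.
  have -> : zdot z y = 2 * vz z y - 1 by rewrite /vz; field.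
  case: N {P dP e1 e2 bp} => [|N]; first by rewrite expr1 !expr0; ring.
  by rewrite /= !exprS -!natr1; field.
have : Lam (fun y => \sum_i z i * (- n%:R * st i y * pst P y + pst (mpoly.mderiv i P) y
   - st i y * \sum_j st j y * pst (mpoly.mderiv j P) y)) = 0.
  have bi i : bm n (fun y => - n%:R * st i y * pst P y + pst (mpoly.mderiv i P) y
   - st i y * \sum_j st j y * pst (mpoly.mderiv j P) y).
    apply: bm_add.
      apply: bm_add; last exact: bm_pst.
      apply: bm_mul; last exact: bm_pst.
      by apply: bm_mul; [exact: bm_cst|exact: bm_st].
    apply: bm_opp; apply: bm_mul; first exact: bm_st.
    by apply: bm_sum => j; apply: bm_mul; [exact: bm_st|exact: bm_pst].
  rewrite Lam_sum => [|i]; last by apply: bm_mul; [exact: bm_cst|exact: bi].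
  by rewrite big1// => i _; rewrite Lam_cmul// sphere_ibp mulr0.
move/funext : E => ->.
have bc (c : R) (q : mpoly.mpoly n.+1 R) M : bm n (fun y => c * (pst q y * vz z y ^+ M)).
  by apply: bm_mul; [exact: bm_cst|exact: bp].
rewrite (Lam_add (bc _ _ _) (bm_add (bc _ _ _) (bp _ _))) (Lam_add (bc _ _ _) (bp _ _)) !Lam_cmul// mulNr => /eqP; rewrite addrC subr_eq0 => /eqP.
by [].
Qed.

End sphere_functional.

(** * Closed form of the moments of v^N against harmonics *)

Section pochhammer.
Context {R : realType}.
Implicit Types (x : R) (k N : nat).

Definition poch x N : R := \prod_(i < N) (x + i%:R).

Lemma poch0 x : poch x 0 = 1.
Proof. by rewrite /poch big_ord0. Qed.

Lemma pochS x N : poch x N.+1 = poch x N * (x + N%:R).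
Proof. by rewrite /poch big_ord_recr. Qed.

Lemma poch_gt0 x N : 0 < x -> 0 < poch x N.
Proof. by move=> x0; apply: prodr_gt0 => i _; rewrite ltr_pwDl. Qed.

(** The difference is taken in [R]; for N < k both falling factorials vanish, so the identity holds
    for all N and k. *)
Lemma ffactSr_R N k : (N ^_ k.+1)%:R = (N ^_ k)%:R * (N%:R - k%:R) :> R.
Proof.
have [kN|Nk] := leqP k N; first by rewrite ffactnSr natrM natrB.
by rewrite !ffact_small ?mul0r// ltnW.
Qed.

Lemma ffactSS_R N k : (N.+1 ^_ k)%:R * (N%:R + 1 - k%:R) = (N%:R + 1) * (N ^_ k)%:R :> R.
Proof. by rewrite natr1 -ffactSr_R ffactSS natrM. Qed.

End pochhammer.

Section moments.
Context {R : realType} (n : nat).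
Hypothesis n2 : (2 < n)%N.

Let n0 : (0 : R) < n%:R. Proof. by rewrite ltr0n; lia. Qed.

Let nN N : (0 : R) < n%:R + N%:R. Proof. by rewrite ltr_pwDl. Qed.
Let nNk N k : (0 : R) < n%:R + N%:R + k%:R. Proof. by rewrite ltr_pwDl// nN. Qed.

(** Solution of the moment recursion, scaled by the total mass; for k = 0 these are the moments of
    the Beta(n/2, n/2) law of v. The falling factorial encodes that v^N, of degree N, is orthogonal
    to harmonics of degree k > N. *)
Definition emom k N : R :=
  Lam n (fun=> 1) * (N ^_ k)%:R * poch (n%:R / 2) N / poch n%:R (N + k).

Lemma emom_ge0 k N : 0 <= emom k N.
Proof.
by rewrite divr_ge0 ?mulr_ge0 ?(ltW (Lam1_gt0 n2)) ?ler0n ?ltW ?poch_gt0 ?divr_gt0.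
Qed.

Lemma emom0_gt0 N : 0 < emom 0 N.
Proof. by rewrite divr_gt0 ?mulr_gt0 ?(Lam1_gt0 n2) ?ffactn0 ?poch_gt0 ?divr_gt0. Qed.

Lemma emom0S N : emom 0 N.+1 * (n%:R + N%:R) = emom 0 N * (n%:R / 2 + N%:R).
Proof.
rewrite /emom !ffactn0 !addn0 !pochS; field.
by rewrite ?gt_eqF ?poch_gt0 -?addrA ?addrA ?nNk ?nN//.
Qed.

Lemma emomkS k N : emom k.+1 N * (n%:R + N%:R + k%:R) = emom k N * (N%:R - k%:R).
Proof.
rewrite /emom ffactSr_R addnS pochS natrD; field.
by rewrite ?gt_eqF ?poch_gt0 -?addrA ?addrA ?nNk ?nN//.
Qed.

Lemma emomNS k N : emom k N.+1 * (N%:R + 1 - k%:R) * (n%:R + N%:R + k%:R) =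
  emom k N * (N%:R + 1) * (n%:R / 2 + N%:R).
Proof.
rewrite /emom addSn !pochS natrD.
have h := @ffactSS_R R N k; move: h; move: ((N.+1 ^_ k)%:R : R) => A h.
transitivity (Lam n (fun=> 1) * (A * (N%:R + 1 - k%:R)) * poch (n%:R / 2) N * (n%:R / 2 + N%:R) / poch n%:R (N + k)).
  field; rewrite ?gt_eqF ?poch_gt0 -?addrA ?addrA ?nNk ?nN//.
by rewrite h; field; rewrite gt_eqF ?poch_gt0.
Qed.

Lemma emom_rec k N : (2 * n%:R + 2 * k%:R + 2 * N%:R) * emom k N.+1 =
  (n%:R + k%:R + 2 * N%:R) * emom k N + k%:R * emom k.-1 N.
Proof.
case: k => [|k]; first by have := emom0S N; lra.
rewrite /emom /= ffactSS ffactSr_R natrM addSn addnS !pochS -!natr1 natrD; field.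
by rewrite ?gt_eqF ?poch_gt0 -?addrA ?addrA ?nNk ?nN//.
Qed.

(** The divergence identity for the i-th derivative of p, summed over i: by Euler's identity (n +
    k)(k + 1) times the integral of p is the integral of its Laplacian. *)
Lemma Lam_harmonic (k : nat) (p : mpoly.mpoly n.+1 R) : homog k.+1 p -> laplacian p = 0 ->
  Lam n (fun y => pst p y) = 0.
Proof.
move=> hp lp.
have bq (q : mpoly.mpoly n.+1 R) : bm n (fun y => pst q y) by exact: bm_pst.
have bsq (i : 'I_n.+1) (q : mpoly.mpoly n.+1 R) : bm n (fun y => st i y * pst q y).
  by apply: bm_mul; [exact: bm_st|exact: bm_pst].
have h (i : 'I_n.+1) : (n%:R + k%:R) * Lam n (fun y => st i y * pst (mpoly.mderiv i p) y) =
    Lam n (fun y => pst (mpoly.mderiv i (mpoly.mderiv i p)) y).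
  have := sphere_ibp n2 i (mpoly.mderiv i p).
  rewrite (_ : (fun y => _) = (fun y => - (n%:R + k%:R) * (st i y * pst (mpoly.mderiv i p) y) +
     pst (mpoly.mderiv i (mpoly.mderiv i p)) y)); last first.
    apply/funext => y; rewrite (euler_homog (fun j : 'I_n.+1 => st j y) (homog_mderiv i hp)) /= -/(pst _ y).
    ring.
  rewrite (Lam_add n2 (bm_mul (bm_cst n _) (bsq _ _)) (bq _)) (Lam_cmul n2 _ (bsq _ _)).
  lra.
have E : (n%:R + k%:R) * (k.+1%:R * Lam n (fun y => pst p y)) = 0.
  rewrite -(Lam_cmul n2 _ (bq p)).
  rewrite (_ : (fun y => _) = (fun y => \sum_i st i y * pst (mpoly.mderiv i p) y)); last first.
    by apply/funext => y; rewrite -(euler_homog (fun j : 'I_n.+1 => st j y) hp).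
  rewrite (Lam_sum n2); last by move=> i; exact: bsq.
  rewrite mulr_sumr (eq_bigr _ (fun i _ => h i)).
  rewrite -(Lam_sum n2); last by move=> i; exact: bq.
  rewrite -[RHS](Lam0 n2); congr Lam; apply/funext => y.
  by rewrite /pst -meval_sum -/(laplacian p) lp mpoly.meval0.
move/eqP : E; rewrite !mulf_eq0 gt_eqF ?ltr_pwDl//= pnatr_eq0/=.
by move/eqP.
Qed.

(** Induction on N for all harmonics at once, because the recursion brings in the derivative of p
    along z, again harmonic and of degree k - 1, whose value at z is k p(z) by Euler's identity. *)
Theorem moment (z : 'I_n.+1 -> R) (k N : nat) (p : mpoly.mpoly n.+1 R) :
  unitv z -> homog k p -> laplacian p = 0 ->
  Lam n (fun y => pst p y * vz z y ^+ N) = mpoly.meval z p * emom k N.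
Proof.
move=> z1; elim: N k p => [|N ih] k p hp lp.
  rewrite (_ : (fun y => _) = (fun y => pst p y)); last first.
    by apply/funext => y; rewrite expr0 mulr1.
  case: k hp => [|k] hp; last first.
    by rewrite (Lam_harmonic hp lp) /emom ffact0n /= mulr0 !mul0r mulr0.
  rewrite /emom ffactn0 !poch0 mulr1 mulr1 divr1 -(Lam_cmul n2 _ (bm_cst n 1)).
  by congr Lam; apply/funext => y; rewrite mulr1; exact: homog0_const.
have c0 : 0 < 2 * n%:R + 2 * k%:R + 2 * N%:R :> R by rewrite !ltr_pwDl ?mulr_ge0 ?mulr_gt0.
apply: (mulfI (lt0r_neq0 c0)); rewrite (moment_rec n2 _ z1 hp) (ih k p hp lp).
(* For k = 0 the truncated predecessor is harmless, since the factor [k%:R] vanishes. *)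
have -> : Lam n (fun y => pst (zderiv z p) y * vz z y ^+ N) = k%:R * mpoly.meval z p * emom k.-1 N.
  rewrite (_ : (fun y => _) = (fun y => \sum_i z i * (pst (mpoly.mderiv i p) y * vz z y ^+ N))); last first.
    apply/funext => y; rewrite pst_zderiv mulr_suml; apply: eq_bigr => i _; ring.
  have b1 (i : 'I_n.+1) : bm n (fun y => pst (mpoly.mderiv i p) y * vz z y ^+ N).
    by apply: bm_mul; [exact: bm_pst|apply: bm_exp; exact: bm_vz].
  rewrite (Lam_sum n2); last by move=> i; apply: bm_mul; [exact: bm_cst|exact: b1].
  rewrite -(euler_homog z hp) mulr_suml; apply: eq_bigr => i _.
  by rewrite (Lam_cmul n2 _ (b1 i)) (ih k.-1 _ (homog_mderiv i hp) (laplacian_mderiv i lp)) mulrA.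
by rewrite [RHS]mulrCA emom_rec; ring.
Qed.

End moments.

(** * The binomial series of (1 - v)^(-a) *)

Section series_ereal.
Context {R : realType}.
Implicit Types (u : nat -> R) (l : R).

Lemma cvg_series_EFin u l : series u @ \oo --> l -> (\sum_(N <oo) (u N)%:E = l%:E)%E.
Proof.
move=> h; apply/cvg_lim => //.
rewrite (_ : (fun J => _) = EFin \o series u).
  by apply: cvg_EFin => //; exact: nearW.
by apply/funext => J; rewrite /= /series/= sumEFin.
Qed.

Lemma EFin_cvg_series u l : (forall N, 0 <= u N) ->
  (\sum_(N <oo) (u N)%:E = l%:E)%E -> series u @ \oo --> l.
Proof.
move=> u0 h.
have c : (fun J => \sum_(0 <= N < J) (u N)%:E)%E @ \oo --> (\sum_(N <oo) (u N)%:E)%E.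
  by apply: is_cvg_nneseries => N _ _; rewrite lee_fin.
rewrite h (_ : (fun J => _) = EFin \o series u) in c; first exact: fine_cvg c.
by apply/funext => J; rewrite /= /series/= sumEFin.
Qed.

End series_ereal.

Section binomial_series.
Context {R : realType}.
Let mu : {measure set (measurableTypeR R) -> \bar R} := @lebesgue_measure R.
Implicit Types (a v : R) (N : nat).

Definition bc a N : R := poch a N / N`!%:R.

Lemma fact_gt0_R N : (0 : R) < N`!%:R.
Proof. by rewrite ltr0n fact_gt0. Qed.

Lemma bc_ge0 a N : 0 < a -> 0 <= bc a N.
Proof. by move=> a0; rewrite divr_ge0 ?ler0n// ltW// poch_gt0. Qed.

Lemma bcS a N : bc a N.+1 * (N%:R + 1) = bc a N * (a + N%:R).
Proof.
rewrite /bc pochS factS natrM -natr1; field.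
by rewrite gt_eqF ?fact_gt0_R// natr1 pnatr_eq0.
Qed.

Lemma poch_shift a N : poch a N.+1 = a * poch (a + 1) N.
Proof.
rewrite /poch big_ord_recl addr0; congr (_ * _); apply: eq_bigr => i _.
by rewrite -addrA nat1r.
Qed.

Lemma bc_pascal a N : bc a N.+1 = bc (a + 1) N.+1 - bc (a + 1) N.
Proof.
rewrite /bc poch_shift pochS factS natrM -natr1; field.
by rewrite gt_eqF ?fact_gt0_R// natr1 pnatr_eq0.
Qed.

Lemma Gamma_poch a N : 0 < a -> Gamma (a + N%:R) = poch a N * Gamma a.
Proof.
move=> a0; elim: N => [|N ih]; first by rewrite addr0 poch0 mul1r.
have aN : 0 < a + N%:R by rewrite ltr_pwDl.
by rewrite -natr1 addrA (GammaS aN) ih pochS; ring.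
Qed.

(** Gamma(a) (1 - v)^(-a) is the integral of t^(a-1) exp(-t) exp(t v). Expanding exp(t v) and
    integrating termwise gives Gamma(a + N) v^N / N!. The bound 1 <= a is inherited from
    [Gamma_scale]. *)
Lemma binomial_series_ge1 a v : 1 <= a -> 0 <= v -> v < 1 ->
  series (fun N => bc a N * v ^+ N) @ \oo --> (1 - v) `^ (- a).
Proof.
move=> a1 v0 v1; have a0 : 0 < a by exact: lt_le_trans a1.
have Ga := Gamma_gt0 a0.
apply: EFin_cvg_series => [N|]; first by rewrite mulr_ge0 ?bc_ge0 ?exprn_ge0.
have mpos : measurable (`]0, +oo[%classic : set (measurableTypeR R)) by exact: measurable_itv.
have sv : 0 < 1 - v by rewrite subr_gt0.
have := Gamma_scale a1 sv.
have -> : (\int[mu]_(t in `]0%R, +oo[) (t `^ (a - 1) * expR (- (t * (1 - v))))%:E)%E =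
   (\int[mu]_(t in `]0%R, +oo[) \sum_(N <oo) (v ^+ N / N`!%:R * Gamma_integrand (a + N%:R) t)%:E)%E.
  apply: eq_integral => t; rewrite inE/= in_itv/= andbT => t0; apply/esym/cvg_series_EFin.
  have -> : t `^ (a - 1) * expR (- (t * (1 - v))) = Gamma_integrand a t * expR (t * v).
    by rewrite /Gamma_integrand -mulrA -expRD; congr (_ * expR _); ring.
  rewrite (_ : series _ = (fun J => Gamma_integrand a t * series (exp_coeff (t * v)) J)).
    by apply: cvgM; [exact: cvg_cst|exact: is_cvg_series_exp_coeff].
  apply/funext => J; rewrite /series /= mulr_sumr; apply: eq_bigr => N _.
  rewrite /exp_coeff /Gamma_integrand (_ : a + N%:R - 1 = (a - 1) + N%:R); last by ring.
  rewrite /= powRD ?(gt_eqF t0) ?implybT// powR_mulrn ?(ltW t0)// exprMn; ring.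
have GN N : 0 < a + N%:R by rewrite ltr_pwDl.
rewrite integral_nneseries//; last 2 first.
- move=> N; apply/measurable_EFinP/measurable_funM => //; exact: measurable_Gamma_integrand.
- move=> N t _; rewrite lee_fin mulr_ge0 ?divr_ge0 ?exprn_ge0 ?ler0n//.
  by rewrite mulr_ge0 ?powR_ge0 ?expR_ge0.
have E N : (\int[mu]_(t in `]0%R, +oo[) (v ^+ N / N`!%:R * Gamma_integrand (a + N%:R) t)%:E)%E =
   ((Gamma a)%:E * (bc a N * v ^+ N)%:E)%E.
  under eq_integral do rewrite EFinM.
  rewrite integralZl//; last exact: integrable_Gamma_integrand.
  by rewrite GammaE// Gamma_poch// -!EFinM /bc; congr EFin; ring.
under eq_eseriesr do rewrite E.
rewrite nneseriesZl; last by move=> N _; rewrite lee_fin mulr_ge0 ?bc_ge0 ?exprn_ge0.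
move=> h; have := congr1 (fun x => ((Gamma a)^-1%:E * x)%E) h.
rewrite muleA -!EFinM mulVf ?gt_eqF// mul1e => ->.
by rewrite powRN; congr EFin; field; rewrite !gt_eqF ?powR_gt0.
Qed.

(** The series at a is 1 - v times the series at a + 1, where the preceding lemma applies; on
    partial sums this is [bc_pascal]. *)
Lemma binomial_series a v : 0 < a -> 0 <= v -> v < 1 ->
  series (fun N => bc a N * v ^+ N) @ \oo --> (1 - v) `^ (- a).
Proof.
move=> a0 v0 v1; have h := @binomial_series_ge1 (a + 1) v _ v0 v1.
have {}h := h _; have {}h := h ltac:(by rewrite lerDr ltW).
have sv : 0 < 1 - v by rewrite subr_gt0.
have -> : (1 - v) `^ (- a) = (1 - v) `^ (- (a + 1)) - v * (1 - v) `^ (- (a + 1)).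
  rewrite (_ : - a = 1 + - (a + 1)); last by ring.
  by rewrite powRD ?(gt_eqF sv) ?implybT// powRr1 ?(ltW sv)//; ring.
rewrite -(cvg_shiftS (series _)).
rewrite (_ : (fun J => _) = (fun J => series (fun N => bc (a + 1) N * v ^+ N) J.+1 - v * series (fun N => bc (a + 1) N * v ^+ N) J)).
  apply: cvgB; first by rewrite (cvg_shiftS (series _)).
  by apply: cvgM; [exact: cvg_cst|].
apply/funext; elim=> [|J ih].
  by rewrite /series /= !big_nat1 big_geq// mulr0 subr0 /bc !poch0.
rewrite seriesSr ih !seriesSr bc_pascal exprS; ring.
Qed.

End binomial_series.

(** * The kernel (1 - v)^(-a) and its total mass *)

Section kernel.
Context {R : realType} (n : nat) (a : R).
Hypotheses (n2 : (2 < n)%N) (a0 : 0 < a) (an : 2 * a < n%:R).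
Let mu := cs_mu (@Rn R n).
Let T := cs_type (@Rn R n).
Implicit Types (z : 'I_n.+1 -> R) (y : seq R) (k N J : nat).

Let n0 : (0 : R) < n%:R. Proof. by rewrite ltr0n; lia. Qed.

Lemma unitv_st y : unitv (fun i : 'I_n.+1 => st i y).
Proof. exact: istereo_sphere. Qed.

Lemma oneB_vz z y : unitv z -> 1 - vz z y = 4^-1 * \sum_i (z i - st i y) ^+ 2.
Proof.
move=> z1; have s1 := unitv_st y.
rewrite (eq_bigr (fun i => z i ^+ 2 + st i y ^+ 2 - 2 * (z i * st i y))) => [|i _]; last by ring.
by rewrite sumrB big_split/= -mulr_sumr z1 s1 /vz /zdot; field.
Qed.

Lemma vz_sqr z y : unitv z -> vz z y = 4^-1 * \sum_i (z i + st i y) ^+ 2.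
Proof.
move=> z1; have s1 := unitv_st y.
rewrite (eq_bigr (fun i => z i ^+ 2 + st i y ^+ 2 + 2 * (z i * st i y))) => [|i _]; last by ring.
by rewrite !big_split/= -mulr_sumr z1 s1 /vz /zdot; field.
Qed.

Lemma vz_ge0 z y : unitv z -> 0 <= vz z y.
Proof. by move=> z1; rewrite vz_sqr// mulr_ge0// sumr_ge0// => i _; rewrite sqr_ge0. Qed.

Lemma vz_le1 z y : unitv z -> vz z y <= 1.
Proof.
by move=> z1; rewrite -subr_ge0 oneB_vz// mulr_ge0// sumr_ge0// => i _; rewrite sqr_ge0.
Qed.

Lemma vz_eq1 z y : unitv z -> vz z y = 1 -> forall i, z i = st i y.
Proof.
move=> z1 v1 i; have := oneB_vz y z1; rewrite v1 subrr => /esym/eqP.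
rewrite mulf_eq0 invr_eq0 pnatr_eq0/= psumr_eq0 => [|j _]; last by rewrite sqr_ge0.
by move=> /allP/(_ i (mem_index_enum i)); rewrite sqrf_eq0 subr_eq0 => /eqP.
Qed.

Lemma coord0_null k (c : R) :
  cs_mu (@Rn R k.+1) [set p | nth 0 (cs_seq p) 0 = c] = 0%E.
Proof.
rewrite (_ : [set p | _] = ([set c] `*` setT)); last first.
  by apply/seteqP; split => [[x p] /= ->|[x p] /= []].
by rewrite [LHS](product_measure1E (@lebesgue_measure R) (cs_mu (@Rn R k)))//= lebesgue_measure_set1 mul0e.
Qed.

Lemma vz_lt1_ae z : unitv z -> {ae mu, forall p, vz z (cs_seq p) < 1}.
Proof.
have npos : (0 < n)%N := ltnW (ltnW n2).
(* First coordinate of the stereographic image of z: the point where v = 1 lies on this hyperplane,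
   which is null. If z is the pole, division by zero gives c = 0, and no y at all has v = 1. *)
move=> z1; pose c := z ord0 / (1 - z ord_max).
have : mu [set p | nth 0 (cs_seq p) 0 = c] = 0%E.
  by rewrite /mu; case: (n) n2 => // m _; exact: coord0_null.
move=> m0; exists [set p | nth 0 (cs_seq p) 0 = c]; split => //.
  rewrite -[X in measurable X]setTI.
  exact: (@measurable_coord R n 0 measurableT _ (measurable_set1 c)).
move=> p /= /negP; rewrite -leNgt => v1.
have {}v1 : vz z (cs_seq p) = 1 by apply/eqP; rewrite eq_le v1 vz_le1.
have e := vz_eq1 z1 v1.
rewrite /c !e !stE sty_max pole_max; have r0 := rho_gt0 n (cs_seq p).
rewrite /pole /sty /= npos ltn_eqF//.
rewrite mulr0n addr0 (_ : 1 - _ = rho n (cs_seq p)); last by ring.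
by field; rewrite gt_eqF.
Qed.

Definition kern z y : R := (1 - vz z y) `^ (- a).
Definition kernJ z J y : R := \sum_(N < J) bc a N * vz z y ^+ N.
(** Contribution of the N-th power of v to the multiplier of the kernel on harmonics of degree k. *)
Definition TT k N : R := bc a N * emom n k N.

Lemma TT_ge0 k N : 0 <= TT k N.
Proof. by rewrite mulr_ge0 ?bc_ge0 ?emom_ge0. Qed.

Lemma kern_ge0 z y : 0 <= kern z y. Proof. exact: powR_ge0. Qed.

Lemma bm_kernJ z J : bm n (kernJ z J).
Proof.
by apply: bm_sum => N; apply: bm_mul; [exact: bm_cst|apply: bm_exp; exact: bm_vz].
Qed.

Lemma measurable_kern z : measurable_fun setT (fun p : T => kern z (cs_seq p)).
Proof.
apply: (measurableT_comp (@measurable_powR R (- a))).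
by apply: measurable_funB => //; have [] := bm_vz z.
Qed.

Lemma series_kern z y : unitv z -> vz z y < 1 ->
  (fun J => kernJ z J y) @ \oo --> kern z y.
Proof.
move=> z1 v1; have := binomial_series a0 (vz_ge0 y z1) v1.
by apply: cvg_trans; apply: near_eq_cvg; apply: nearW => J; rewrite /kernJ /series/= big_mkord.
Qed.

Lemma kernJ_le_kern z J y : unitv z -> vz z y < 1 -> kernJ z J y <= kern z y.
Proof.
move=> z1 v1; have h := series_kern z1 v1.
have nd : nondecreasing_seq (fun J => kernJ z J y).
  apply/nondecreasing_seqP => k; rewrite /kernJ big_ord_recr/= lerDl.
  by rewrite mulr_ge0 ?bc_ge0 ?exprn_ge0 ?vz_ge0.
have := nondecreasing_cvgn_le nd (cvgP _ h) J.
by rewrite (cvg_lim _ h).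
Qed.

Notation w p := (rho n (cs_seq p) ^+ n).

Lemma w_gt0 (p : T) : 0 < w p. Proof. by rewrite exprn_gt0// rho_gt0. Qed.

Lemma measurable_w : measurable_fun setT (fun p : T => w p).
Proof. by apply/measurable_funX; exact: measurable_rho. Qed.

Lemma Lam_vz z N : unitv z -> Lam n (fun y => vz z y ^+ N) = emom n 0 N.
Proof.
move=> z1.
have h1 : homog 0 (1 : mpoly.mpoly n.+1 R).
  by rewrite /homog mpoly.msupp1 /= mpoly.mdeg0 eqxx.
have l1 : laplacian (1 : mpoly.mpoly n.+1 R) = 0.
  by rewrite /laplacian big1// => i _; rewrite -mpoly.mpolyC1 mpoly.mderivC mpoly.mderiv0.
have := moment n2 N z1 h1 l1; rewrite mpoly.meval1 mul1r => <-.
by congr Lam; apply/funext => y; rewrite /pst mpoly.meval1 mul1r.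
Qed.

Lemma Lam_EFin F : bm n F -> (\int[mu]_p (w p * F (cs_seq p))%:E = (Lam n F)%:E)%E.
Proof.
move=> hF; rewrite /Lam /Rintegral fineK//.
by apply: integrable_fin_num => //; exact: integrable_bm.
Qed.

(** Termwise integration of a nonnegative series that converges to the kernel off a null set. The
    right-hand side is free of z, so it can be evaluated at the pole. *)
Lemma integral_kern z : unitv z ->
  (\int[mu]_p (w p * kern z (cs_seq p))%:E = \sum_(N <oo) (TT 0 N)%:E)%E.
Proof.
move=> z1.
have bN N : bm n (fun y => bc a N * vz z y ^+ N).
  by apply: bm_mul; [exact: bm_cst|apply: bm_exp; exact: bm_vz].
have f0 N (p : T) : 0 <= w p * (bc a N * vz z (cs_seq p) ^+ N).
  by rewrite mulr_ge0 ?(ltW (w_gt0 p))// mulr_ge0 ?bc_ge0 ?exprn_ge0 ?vz_ge0.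
have mf N : measurable_fun setT (fun p : T => (w p * (bc a N * vz z (cs_seq p) ^+ N))%:E).
  by apply/measurable_EFinP/measurable_funM; [exact: measurable_w|have [] := bN N].
transitivity (\int[mu]_p \sum_(N <oo) (w p * (bc a N * vz z (cs_seq p) ^+ N))%:E)%E.
  apply: ae_eq_integral => //.
  - by apply/measurable_EFinP/measurable_funM; [exact: measurable_w|exact: measurable_kern].
  - by apply: ge0_emeasurable_sum => // N p _ _; rewrite lee_fin.
  - apply: filterS (vz_lt1_ae z1) => p v1 _; apply/esym/cvg_series_EFin.
    rewrite (_ : series _ = fun J => w p * kernJ z J (cs_seq p)).
      by apply: cvgM; [exact: cvg_cst|exact: series_kern].
    by apply/funext => J; rewrite /series/= /kernJ mulr_sumr big_mkord.
rewrite integral_nneseries//; last by move=> N p _; rewrite lee_fin.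
apply: eq_eseriesr => N _; rewrite (Lam_EFin (bN N)) (Lam_cmul n2) ?Lam_vz//.
by apply: bm_exp; exact: bm_vz.
Qed.

Definition S0 : R := 2 ^+ n * (pi `^ (n%:R / 2) * Gamma (n%:R / 2 - a) / Gamma (n%:R - a)).

Lemma integral_kern_pole :
  (\int[mu]_p (w p * kern (fun i => pole i) (cs_seq p))%:E = S0%:E)%E.
Proof.
have v (y : seq R) : 1 - vz (fun i : 'I_n.+1 => pole i) y = (1 + ysq n y)^-1.
  rewrite /vz /zdot big_sphere big1 ?add0r => [|l _]; last by rewrite pole_widen mul0r.
  rewrite pole_max mul1r stE sty_max pole_max /rho. field.
  by rewrite gt_eqF ?ysq1_gt0.
rewrite /S0 EFinM.
have b1 : 1 <= n%:R - a.
  have h2 : (2 : R) < n%:R by rewrite ltr_nat.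
  by have h3 := an; move: (n%:R : R) h2 h3 => x h2 h3; lra.
have b2 : n%:R / 2 < n%:R - a.
  by have h3 := an; move: (n%:R : R) h3 => x h3; lra.
have := integral_ysq_powR b1 b2; rewrite (_ : n%:R - a - n%:R / 2 = n%:R / 2 - a); last by field.
have c0 : (0 : R) <= 2 ^+ n by rewrite exprn_ge0.
have mq : measurable_fun setT (fun p : T => (1 + ysq n (cs_seq p)) `^ - (n%:R - a)).
  apply: (measurableT_comp (@measurable_powR R _)).
  by apply: measurable_funD => //; exact: measurable_ysq.
move=> <-; rewrite -(ge0_integral_scale mu mq _ c0) => [|p]; last exact: powR_ge0.
apply: eq_integral => p _; congr EFin; rewrite /kern v rho_exprE.
have y0 := ysq1_gt0 n (cs_seq p).
rewrite -[_^-1](powR_inv1 (ltW y0)) -powRrM -mulrA -powRD ?(gt_eqF y0) ?implybT//.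
by congr (_ * _ `^ _); ring.
Qed.

Lemma unitv_pole : unitv (fun i : 'I_n.+1 => pole i : R).
Proof.
rewrite /unitv big_sphere big1 => [|l _]; last by rewrite pole_widen expr0n.
by rewrite pole_max expr1n add0r.
Qed.

Lemma cvg_TT0 : series (TT 0) @ \oo --> S0.
Proof.
by apply: EFin_cvg_series => [N|]; [exact: TT_ge0|rewrite -(integral_kern unitv_pole) integral_kern_pole].
Qed.

Lemma integrable_kern z : unitv z ->
  mu.-integrable setT (fun p : T => (w p * kern z (cs_seq p))%:E).
Proof.
move=> z1; apply/integrableP; split.
  by apply/measurable_EFinP/measurable_funM; [exact: measurable_w|exact: measurable_kern].
under eq_integral => p _ do rewrite gee0_abs ?lee_fin ?mulr_ge0 ?kern_ge0 ?(ltW (w_gt0 p))//.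
by rewrite integral_kern// (cvg_series_EFin cvg_TT0) ltry.
Qed.

Lemma Lam_kern z : unitv z -> Lam n (kern z) = S0.
Proof. by move=> z1; rewrite /Lam /Rintegral integral_kern// (cvg_series_EFin cvg_TT0). Qed.

End kernel.

(** * The Funk-Hecke formula and the multipliers of the kernel *)

Section real_series.
Context {R : realType}.
Implicit Types (u : nat -> R).

Lemma series_shift u m J :
  series (fun j => u (j + m)%N) J = series u (J + m)%N - series u m.
Proof.
elim: J => [|J ih]; first by rewrite /series /= big_geq// subrr.
by rewrite seriesSr ih addSn seriesSr addrAC.
Qed.

(** The terms with N >= k force L >= 0. Were L positive, u would dominate a multiple of 1/N from
    some rank on, against the divergence of the harmonic series. *)
Lemma summable_mul_id_cvg0 u (G : nat -> R) (k : nat) (L : R) :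
  (forall N, 0 <= u N) -> cvgn (series u) -> (forall N, G N = (N%:R - k%:R) * u N) ->
  G @ \oo --> L -> L = 0.
Proof.
move=> u0 cu GE GL.
have L0 : 0 <= L.
  rewrite -(cvg_lim _ GL)//; apply: limr_ge; first exact: cvgP GL.
  by exists k => // N /= kN; rewrite GE mulr_ge0// subr_ge0 ler_nat.
apply/eqP; rewrite eq_le L0 andbT leNgt; apply/negP => Lp.
have L2 : L / 2 < L by lra.
have /cvgr_gt/(_ _ L2) [N0 _ hN] := GL.
(* Beyond the rank N0 and positive; j + m <= m (j + 1) then turns L / 2 <= (j + m) u(j + m) into a
   bound below by [harmonic j]. *)
pose m := (N0 + k).+1.
pose c := L / 2 / m%:R.
have c0 : 0 < c by rewrite !divr_gt0 ?ltr0n.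
have le j : c * harmonic j <= u (j + m)%N.
  have /= h := hN (j + m)%N ltac:(rewrite /= /m; lia).
  rewrite GE in h.
  have {}h : L / 2 <= (j + m)%:R * u (j + m)%N.
    by apply: (le_trans (ltW h)); rewrite ler_wpM2r// lerBlDr lerDl.
  rewrite /c /harmonic /= mulrAC -mulrA -invfM ler_pdivrMr ?mulr_gt0 ?ltr0n//.
  apply: (le_trans h); rewrite mulrC ler_wpM2l// -natrM ler_nat /m; nia.
have cs : cvgn (series (fun j => u (j + m)%N)).
  rewrite (_ : series _ = (fun J => series u (J + m)%N - series u m)); last first.
    by apply/funext => J; exact: series_shift.
  apply: is_cvgB; last exact: is_cvg_cst.
  apply/cvg_ex; exists (limn (series u)).
  by rewrite (cvg_shiftn m (series u)).
have ch : cvgn (series (fun j => c * harmonic j)).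
  apply: (series_le_cvg _ _ le cs) => j //.
  by rewrite mulr_ge0 ?(ltW c0)// /harmonic/= invr_ge0.
apply: (@dvg_harmonic R).
rewrite (_ : series harmonic = (fun J => c^-1 * series (fun j => c * harmonic j) J)); last first.
  apply/funext => J; rewrite /series/= mulr_sumr; apply: eq_bigr => i _.
  by rewrite mulrA mulVf ?gt_eqF// mul1r.
by apply: is_cvgM => //; exact: is_cvg_cst.
Qed.

End real_series.

Section funk_hecke.
Context {R : realType} (n : nat) (a : R).
Hypotheses (n2 : (2 < n)%N) (a0 : 0 < a) (an : 2 * a < n%:R).
Let mu := cs_mu (@Rn R n).
Let T := cs_type (@Rn R n).
Implicit Types (z : 'I_n.+1 -> R) (y : seq R) (k N J : nat).
Notation TTa := (TT n a).

Let n0 : (0 : R) < n%:R. Proof. by rewrite ltr0n; lia. Qed.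
Let nNk N k : (0 : R) < n%:R + N%:R + k%:R.
Proof. by rewrite ltr_pwDl// ltr_pwDl. Qed.

Lemma TTkS k N : TTa k.+1 N * (n%:R + N%:R + k%:R) = TTa k N * (N%:R - k%:R).
Proof. by rewrite /TT -[LHS]mulrA (emomkS n2) mulrA. Qed.

Lemma TTNS k N : TTa k N.+1 * (N%:R + 1 - k%:R) * (n%:R + N%:R + k%:R) =
  TTa k N * (a + N%:R) * (n%:R / 2 + N%:R).
Proof.
have N1 : N%:R + 1 != 0 :> R by rewrite natr1 pnatr_eq0.
apply: (mulfI N1); have e1 := bcS a N; have e2 := emomNS n2 k N.
transitivity ((bc a N.+1 * (N%:R + 1)) * (emom n k N.+1 * (N%:R + 1 - k%:R) * (n%:R + N%:R + k%:R))).
  by rewrite /TT; ring.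
by rewrite e1 e2 /TT; ring.
Qed.

(** Telescoping certificate, in the manner of Gosper, for the combination in [TT_contiguous]; its
    shape (N - k) u_N is the one whose limit [summable_mul_id_cvg0] controls. *)
Definition TG k N := (N%:R - k%:R) * TTa k N.

Lemma TT_contiguous k N :
  (k%:R + a) * TTa k N - (k%:R + n%:R - a) * TTa k.+1 N = 2 * (TG k N.+1 - TG k N).
Proof.
apply: (mulIf (lt0r_neq0 (nNk N k))).
have e1 := TTkS k N; have e2 := TTNS k N.
transitivity ((k%:R + a) * TTa k N * (n%:R + N%:R + k%:R) -
   (k%:R + n%:R - a) * (TTa k.+1 N * (n%:R + N%:R + k%:R))); first by ring.
rewrite e1 [RHS](_ : _ = 2 * (TTa k N.+1 * (N%:R + 1 - k%:R) * (n%:R + N%:R + k%:R)) -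
  2 * (N%:R - k%:R) * TTa k N * (n%:R + N%:R + k%:R)); last by rewrite /TG -natr1; ring.
by rewrite e2; field.
Qed.

(** Carries convergence from k = 0, where the sum is known, to every degree by comparison. *)
Lemma TT_leS k N : TTa k.+1 N <= TTa k N.
Proof.
rewrite -(ler_pM2r (nNk N k)) TTkS ler_wpM2l ?TT_ge0//.
have := ltW n0; have : (0 : R) <= k%:R by []. 
by move: (n%:R : R) (k%:R : R) (N%:R : R) => x y t ? ?; lra.
Qed.

Lemma is_cvg_TT k : cvgn (series (TTa k)).
Proof.
elim: k => [|k ih]; first by apply: cvgP; exact: cvg_TT0.
by apply: (series_le_cvg _ _ (TT_leS k) ih) => N; apply: TT_ge0.
Qed.

Definition Sk k : R := limn (series (TTa k)).

Lemma cvg_Sk k : series (TTa k) @ \oo --> Sk k.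
Proof. exact: is_cvg_TT. Qed.

Lemma Sk0 : Sk 0 = S0 n a.
Proof. by apply/cvg_lim => //; exact: cvg_TT0. Qed.

Lemma TG0 k : TG k 0 = 0.
Proof.
case: k => [|k]; first by rewrite /TG subrr mul0r.
by rewrite /TG /TT /emom ffact0n /= !(mulr0, mul0r).
Qed.

(** Telescoping leaves the boundary term [TG k J] alone. It has a limit because both series
    converge, and that limit can only be 0. *)
Lemma SkS k : (k%:R + a) * Sk k = (k%:R + n%:R - a) * Sk k.+1.
Proof.
have E J : TG k J = 2^-1 * ((k%:R + a) * series (TTa k) J - (k%:R + n%:R - a) * series (TTa k.+1) J).
  elim: J => [|J ih]; first by rewrite TG0 /series /= !big_geq// !mulr0 subr0 mulr0.
  have := TT_contiguous k J; rewrite !seriesSr; move: ih.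
  move: (series (TTa k) J) (series (TTa k.+1) J) (TTa k J) (TTa k.+1 J) => A B C D.
  by move=> ->; lra.
pose L := 2^-1 * ((k%:R + a) * Sk k - (k%:R + n%:R - a) * Sk k.+1).
have GL : TG k @ \oo --> L.
  rewrite (_ : TG k = (fun J => 2^-1 * ((k%:R + a) * series (TTa k) J - (k%:R + n%:R - a) * series (TTa k.+1) J))); last exact/funext.
  apply: cvgM; first exact: cvg_cst.
  by apply: cvgB; (apply: cvgM; [exact: cvg_cst|exact: cvg_Sk]).
have := summable_mul_id_cvg0 (TT_ge0 n2 a0 k) (@is_cvg_TT k) (fun N => erefl) GL.
by rewrite /L; lra.
Qed.

(** By [SkS] and [GammaS] the product is unchanged from k to k + 1. For a = n/2 - s the Gamma
    quotient on the left is the eigenvalue [Ps_eig n s k]. *)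
Lemma Sk_mul_Gamma k :
  Sk k * (Gamma (k%:R + n%:R - a) / Gamma (k%:R + a)) = S0 n a * (Gamma (n%:R - a) / Gamma a).
Proof.
have na : 0 < n%:R - a by move: an n0; move: (n%:R : R) => x ? ?; lra.
elim: k => [|k ih]; first by rewrite Sk0 !add0r.
have ka : 0 < k%:R + a by rewrite ltr_wpDl.
have kna : 0 < k%:R + n%:R - a by rewrite -addrA ltr_wpDl.
rewrite -ih -natr1 (_ : k%:R + 1 + n%:R - a = k%:R + n%:R - a + 1); last by ring.
rewrite (_ : k%:R + 1 + a = k%:R + a + 1); last by ring.
rewrite (GammaS ka) (GammaS kna).
have := Gamma_gt0 ka; have := SkS k; move: ka.
move: (k%:R + a) (_ - a) (Sk k) (Sk k.+1) (Gamma (k%:R + a)) (Gamma (_ - a)).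
move=> b c x x' g g' b0 h g0; apply: (mulfI (lt0r_neq0 b0)); rewrite [RHS]mulrA h; field.
by rewrite !gt_eqF.
Qed.

Notation w p := (rho n (cs_seq p) ^+ n).
Definition lint F := mu.-integrable setT (fun p : T => (w p * F (cs_seq p))%:E).

Lemma lint_bm F : bm n F -> lint F.
Proof. exact: integrable_bm. Qed.

Lemma lint_kern z F : unitv z -> bm n F -> lint (fun y => F y * kern a z y).
Proof.
move=> z1 [[M hM] mF].
apply: (le_integrable measurableT _ _ (integrableZl measurableT M (integrable_kern n2 a0 an z1))).
  apply/measurable_EFinP/measurable_funM; first exact: measurable_w.
  by apply: measurable_funM => //; exact: measurable_kern.
move=> p _; rewrite -EFinM /= lee_fin !normrM mulrCA ler_pM ?normr_ge0 ?mulr_ge0//.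
by rewrite (le_trans (hM _))// ler_norm.
Qed.

(** Almost everywhere the truncated kernel lies below the kernel, so the error is at most M times
    the mass of their difference, a tail of the series for k = 0. The bound is the same for all
    z. *)
Lemma kern_approx z F M J : unitv z -> bm n F -> (forall y, `|F y| <= M) ->
  `|Lam n (fun y => F y * kern a z y) - Lam n (fun y => F y * kernJ a z J y)| <=
  M * (S0 n a - series (TTa 0) J).
Proof.
move=> z1 bF hM; have ik := lint_kern z1 bF.
have bJ := bm_kernJ a z J.
have iJ : lint (fun y => F y * kernJ a z J y) by apply: lint_bm; exact: bm_mul.
have ikJ : lint (kernJ a z J) by exact: lint_bm.
have ik1 := integrable_kern n2 a0 an z1.
have M0 : 0 <= M by apply: le_trans (hM [::]).
have idK : mu.-integrable setT (fun p : T => (w p * (kern a z (cs_seq p) - kernJ a z J (cs_seq p)))%:E).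
  apply: (eq_integrable measurableT _ _ _ (integrableB measurableT ik1 ikJ)) => p _.
  by rewrite -EFinB mulrBr.
have LJ : Lam n (kernJ a z J) = series (TTa 0) J.
  rewrite /kernJ (Lam_sum n2) => [|N]; last by apply: bm_mul; [exact: bm_cst|apply: bm_exp; exact: bm_vz].
  rewrite /series/= big_mkord; apply: eq_bigr => N _.
  by rewrite (Lam_cmul n2) ?Lam_vz//; apply: bm_exp; exact: bm_vz.
have -> : Lam n (fun y => F y * kern a z y) - Lam n (fun y => F y * kernJ a z J y) =
   \int[mu]_p (w p * (F (cs_seq p) * (kern a z (cs_seq p) - kernJ a z J (cs_seq p)))).
  rewrite /Lam -RintegralB//; apply: eq_Rintegral => p _; ring.
have iF : mu.-integrable setT (EFin \o (fun p : T => w p * (F (cs_seq p) * (kern a z (cs_seq p) - kernJ a z J (cs_seq p))))).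
  apply: (eq_integrable measurableT _ _ _ (integrableB measurableT ik iJ)) => p _.
  by rewrite -EFinB -mulrBr -mulrBr.
apply: (le_trans (le_normr_Rintegral measurableT iF)).
have -> : S0 n a - series (TTa 0) J = \int[mu]_p (w p * (kern a z (cs_seq p) - kernJ a z J (cs_seq p))).
  rewrite -(Lam_kern n2 a0 an z1) -LJ /Lam -RintegralB//; apply: eq_Rintegral => p _; ring.
rewrite -RintegralZl//.
have E : \int[mu]_p (M * (w p * (kern a z (cs_seq p) - kernJ a z J (cs_seq p)))) =
   \int[mu]_p (M * (w p * `|kern a z (cs_seq p) - kernJ a z J (cs_seq p)|)).
  rewrite /Rintegral; congr fine.
  have mk := measurable_kern a z; have [_ mJ] := bJ.
  apply: ae_eq_integral => //.
  - apply/measurable_EFinP/measurable_funM => //.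
    by apply: measurable_funM; [exact: measurable_w|exact: measurable_funB].
  - apply/measurable_EFinP/measurable_funM => //.
    apply: measurable_funM; first exact: measurable_w.
    by apply: measurableT_comp => //; exact: measurable_funB.
  - have := vz_lt1_ae n2 z1; apply: filterS => p v1 _.
    by rewrite ger0_norm// subr_ge0; exact: kernJ_le_kern.
rewrite {}E; apply: le_Rintegral => //.
- exact: (integrable_abse iF).
- have h := integrableZl measurableT M (integrable_abse idK).
  apply: (eq_integrable measurableT _ _ _ h) => p _.
  by rewrite /= normrM ger0_norm// ltW// w_gt0.
move=> p _; rewrite !normrM [leRHS]mulrCA ger0_norm ?(ltW (w_gt0 p))// ler_wpM2l ?(ltW (w_gt0 p))//.
by rewrite ler_wpM2r.
Qed.

Lemma cvg_kernJ z F : unitv z -> bm n F ->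
  (fun J => Lam n (fun y => F y * kernJ a z J y)) @ \oo --> Lam n (fun y => F y * kern a z y).
Proof.
move=> z1 bF; have [[M hM] _] := bF.
have h0 : (fun J => M * (S0 n a - series (TTa 0) J)) @ \oo --> (0 : R).
  rewrite -[X in _ --> X](mulr0 M) -[X in _ * X](subrr (S0 n a)).
  apply: cvgM; first exact: cvg_cst.
  by apply: cvgB; [exact: cvg_cst|exact: cvg_TT0].
apply/subr_cvg0/norm_cvg0P; apply: (squeeze_cvgr _ (cvg_cst 0) h0).
apply: nearW => J; rewrite normr_ge0 distrC/=; exact: kern_approx.
Qed.

Theorem funk_hecke z k (p : mpoly.mpoly n.+1 R) : unitv z -> homog k p -> laplacian p = 0 ->
  Lam n (fun y => pst p y * kern a z y) = mpoly.meval z p * Sk k.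
Proof.
move=> z1 hp lp; have h1 := cvg_kernJ z1 (bm_pst p).
have h2 : (fun J => mpoly.meval z p * series (TTa k) J) @ \oo --> mpoly.meval z p * Sk k.
  by apply: cvgM; [exact: cvg_cst|exact: cvg_Sk].
rewrite (_ : (fun J => mpoly.meval z p * _) = (fun J => Lam n (fun y => pst p y * kernJ a z J y))) in h2.
  exact: (cvg_unique _ h1 h2).
apply/funext => J; rewrite /series/= big_mkord mulr_sumr.
rewrite (_ : (fun y => pst p y * kernJ a z J y) = (fun y => \sum_(N < J) bc a N * (pst p y * vz z y ^+ N))); last first.
  by apply/funext => y; rewrite /kernJ mulr_sumr; apply: eq_bigr => N _; ring.
have b (N : nat) : bm n (fun y => pst p y * vz z y ^+ N).
  by apply: bm_mul; [exact: bm_pst|apply: bm_exp; exact: bm_vz].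
rewrite (Lam_sum n2) => [|N]; last by apply: bm_mul; [exact: bm_cst|exact: b].
apply: eq_bigr => N _; rewrite (Lam_cmul n2 _ (b N)) (moment n2 N z1 hp lp).
by rewrite /TT; ring.
Qed.

End funk_hecke.

(** * Zonal harmonics from powers of |x|^2 and <z, x> *)

Section zonal.
Context {R : realType} {m : nat}.
Notation mp := (mpoly.mpoly m R).
Notation XU i := (mpoly.mpolyX R (mpoly.mnm1 i)).
Implicit Types (p q : mp) (k d i l : nat) (z : 'I_m -> R).

Lemma homogM d p k q : homog d p -> homog k q -> homog (d + k) (p * q).
Proof. exact: mpoly.dhomogM. Qed.

Lemma homogX d p k : homog d p -> homog (d * k) (p ^+ k).
Proof. exact: mpoly.dhomogMn. Qed.

Lemma homogZ d c p : homog d p -> homog d (c *: p).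
Proof. exact: mpoly.dhomogZ. Qed.

Lemma homogD d p q : homog d p -> homog d q -> homog d (p + q).
Proof. exact: mpoly.dhomogD. Qed.

Lemma homog_sum (I : Type) (r : seq I) (F : I -> mp) d :
  (forall i : I, homog d (F i)) -> homog d (\sum_(i <- r) F i).
Proof.
move=> h; elim: r => [|i r ih]; first by rewrite big_nil; exact: mpoly.dhomog0.
by rewrite big_cons; exact: homogD.
Qed.

Lemma homog_XU (j : 'I_m) : homog 1 (XU j).
Proof. by rewrite /homog mpoly.msuppX /= mpoly.mdeg1. Qed.

Lemma laplacianD p q : laplacian (p + q) = laplacian p + laplacian q.
Proof. by rewrite -big_split; apply: eq_bigr => i _; rewrite !mpoly.mderivD. Qed.

Lemma laplacianZ c p : laplacian (c *: p) = c *: laplacian p.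
Proof. by rewrite scaler_sumr; apply: eq_bigr => i _; rewrite !mpoly.mderivZ. Qed.

Lemma laplacian_sum (I : Type) (r : seq I) (F : I -> mp) :
  laplacian (\sum_(i <- r) F i) = \sum_(i <- r) laplacian (F i).
Proof.
apply: (big_morph _ laplacianD).
by rewrite /laplacian big1// => i _; rewrite !mpoly.mderiv0.
Qed.

Lemma laplacianM p q : laplacian (p * q) =
  laplacian p * q + 2%:R *: (\sum_(j < m) mpoly.mderiv j p * mpoly.mderiv j q) + p * laplacian q.
Proof.
rewrite /laplacian mulr_suml mulr_sumr scaler_sumr -!big_split/=; apply: eq_bigr => j _.
rewrite !mpoly.mderivM !mpoly.mderivD !mpoly.mderivM scaler_nat mulr2n; ring.
Qed.

Definition qform : mp := \sum_(j < m) XU j ^+ 2.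
Definition lform (z : 'I_m -> R) : mp := \sum_(j < m) z j *: XU j.

Lemma mderiv_qform (j : 'I_m) : mpoly.mderiv j qform = 2%:R *: XU j.
Proof.
rewrite /qform mderiv_sum (bigD1 j)//= mderiv_exp mderiv_XU eqxx expr1.
rewrite mpoly.mpolyC1 mulr1 big1 ?addr0// => i ij.
by rewrite mderiv_exp mderiv_XU eq_sym (negbTE ij) mpoly.mpolyC0 mulr0 scaler0.
Qed.

Lemma mderiv_lform z (j : 'I_m) : mpoly.mderiv j (lform z) = mpoly.mpolyC m (z j).
Proof.
rewrite /lform mderiv_sum (bigD1 j)//= mpoly.mderivZ mderiv_XU eqxx.
rewrite mpoly.mpolyC1 big1 ?addr0 => [|i ij]; first by rewrite -mpoly.mul_mpolyC mulr1.
by rewrite mpoly.mderivZ mderiv_XU eq_sym (negbTE ij) mpoly.mpolyC0 scaler0.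
Qed.

Lemma sum_X_lform z : \sum_(j < m) XU j * mpoly.mpolyC m (z j) = lform z.
Proof. by apply: eq_bigr => j _; rewrite mulrC mpoly.mul_mpolyC. Qed.

Lemma laplacian_qform i :
  laplacian (qform ^+ i) = (2 * i%:R * (2 * i%:R - 2 + m%:R)) *: qform ^+ i.-1.
Proof.
have E j : mpoly.mderiv j (mpoly.mderiv j (qform ^+ i)) =
   (4 * i%:R * i.-1%:R) *: (qform ^+ i.-2 * XU j ^+ 2) + (2 * i%:R) *: qform ^+ i.-1.
  rewrite mderiv_exp mderiv_qform mpoly.mderivZ mpoly.mderivM mderiv_exp mderiv_qform.
  rewrite mpoly.mderivZ mderiv_XU eqxx mpoly.mpolyC1.
  rewrite -!mpoly.mul_mpolyC !mpoly.mpolyCM; ring.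
rewrite /laplacian (eq_bigr _ (fun j _ => E j)) big_split/= -scaler_sumr -mulr_sumr -/qform.
rewrite sumr_const card_ord -[X in _ + X]scaler_nat [X in _ + X]scalerA.
case: i {E} => [|[|i]].
- by rewrite !(mulr0, mul0r, scale0r) addr0.
- by rewrite /= !(mulr0, scale0r) add0r; congr (_ *: _); ring.
by rewrite /= -exprSr -scalerDl; congr (_ *: _); rewrite -!natr1; ring.
Qed.

Lemma laplacian_lform z l : \sum_j z j ^+ 2 = 1 ->
  laplacian (lform z ^+ l) = (l%:R * (l%:R - 1)) *: lform z ^+ l.-2.
Proof.
move=> z1.
have E j : mpoly.mderiv j (mpoly.mderiv j (lform z ^+ l)) =
    (l%:R * l.-1%:R * z j ^+ 2) *: lform z ^+ l.-2.
  rewrite mderiv_exp mderiv_lform mpoly.mderivZ mpoly.mderivM mderiv_exp mderiv_lform mpoly.mderivC.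
  by rewrite -!mpoly.mul_mpolyC !mpoly.mpolyCM; ring.
rewrite /laplacian (eq_bigr _ (fun j _ => E j)) -scaler_suml -mulr_sumr z1 mulr1.
by congr (_ *: _); case: l {E} => [|l]; [rewrite !mul0r|rewrite /= -natr1; ring].
Qed.

Lemma laplacian_qform_lform z i l : \sum_j z j ^+ 2 = 1 ->
  laplacian (qform ^+ i * lform z ^+ l) =
  (2 * i%:R * (2 * i%:R - 2 + m%:R + 2 * l%:R)) *: (qform ^+ i.-1 * lform z ^+ l) +
  (l%:R * (l%:R - 1)) *: (qform ^+ i * lform z ^+ l.-2).
Proof.
move=> z1; rewrite laplacianM laplacian_qform laplacian_lform//.
have -> : \sum_j mpoly.mderiv j (qform ^+ i) * mpoly.mderiv j (lform z ^+ l) =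
    (2 * i%:R * l%:R) *: (qform ^+ i.-1 * lform z ^+ l).
  transitivity ((2 * i%:R * l%:R) *: (qform ^+ i.-1 * lform z ^+ l.-1 *
     \sum_j XU j * mpoly.mpolyC m (z j))).
    rewrite mulr_sumr scaler_sumr; apply: eq_bigr => j _.
    rewrite !mderiv_exp mderiv_qform mderiv_lform.
    by rewrite -!mpoly.mul_mpolyC !mpoly.mpolyCM; ring.
  rewrite sum_X_lform; case: l => [|l]; first by rewrite !mulr0 !scale0r.
  by rewrite -[_ * _ * lform z]mulrA -exprSr.
by rewrite -!mpoly.mul_mpolyC !(mpoly.mpolyCM, mpoly.mpolyCD); ring.
Qed.

Lemma homog_qform : homog 2 qform.
Proof. by apply: homog_sum => j; exact: (homogX 2 (homog_XU j)). Qed.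

Lemma homog_lform z : homog 1 (lform z).
Proof. by apply: homog_sum => j; apply: homogZ; exact: homog_XU. Qed.

(* The zonal harmonic of degree [d] with axis [z], normalised to have
   coefficient 1 on [lform z ^+ d]. *)
Lemma zonal_harmonic z d : (2 < m)%N -> \sum_j z j ^+ 2 = 1 ->
  exists2 c : nat -> R, c 0%N = 1 &
  laplacian (\sum_(i < d./2.+1) c i *: (qform ^+ i * lform z ^+ (d - i.*2))) = 0.
Proof.
move=> m2 z1.
pose A i : R := 2 * i%:R * (2 * i%:R - 2 + m%:R + 2 * (d - i.*2)%:R).
pose B i : R := (d - i.*2)%:R * ((d - i.*2)%:R - 1).
(* The Laplacian sends the i-th term to multiples of the terms with [qform] exponents i - 1 and i;
   this recursion cancels the latter against the former at index i + 1. At the two ends [A 0] and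
   [B d./2] vanish. *)
pose c := fix c i := if i is i'.+1 then - (c i' * B i' / A i) else 1 : R.
exists c => //; rewrite laplacian_sum.
rewrite (eq_bigr (fun i : 'I_d./2.+1 =>
    (c i * A i) *: (qform ^+ i.-1 * lform z ^+ (d - i.*2)) +
    (c i * B i) *: (qform ^+ i * lform z ^+ (d - i.*2).-2))) => [|i _]; last first.
  by rewrite laplacianZ laplacian_qform_lform// scalerDr !scalerA.
rewrite big_split/= big_ord_recl [X in _ + X]big_ord_recr /=.
have -> : A 0%N = 0 by rewrite /A mulr0 mul0r.
have -> : B d./2 = 0.
  rewrite /B; have := odd_double_half d; case: (odd d) => h.
    by rewrite (_ : (d - d./2.*2)%N = 1%N); [rewrite subrr mulr0|lia].
  by rewrite (_ : (d - d./2.*2)%N = 0%N); [rewrite mul0r|lia].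
rewrite !mulr0 !scale0r add0r addr0 -big_split big1// => i _.
have id : (i.*2.+2 <= d)%N by have := ltn_ord i; have := odd_double_half d; lia.
have A0 : A (bump 0 i) != 0.
  rewrite /bump /= add1n /A gt_eqF// mulr_gt0 ?mulr_gt0 ?ltr0n//.
  rewrite (_ : 2 * i.+1%:R - 2 = 2 * i%:R); last by rewrite -natr1; ring.
  rewrite ltr_wpDr ?mulr_ge0// ltr_wpDl ?mulr_ge0// ltr0n; lia.
rewrite /bump /= add1n in A0 *; rewrite mulNr divfK//.
rewrite (_ : (d - i.+1.*2)%N = (d - i.*2).-2); last by lia.
by rewrite -scalerDl addNr scale0r.
Qed.

End zonal.

(** * Functions orthogonal to all harmonics and the concentration of v^N *)

Section completeness.
Context {R : realType} (n : nat).
Hypothesis n2 : (2 < n)%N.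
Implicit Types (z : 'I_n.+1 -> R) (y : seq R) (F : seq R -> R) (k N d : nat).

Definition harmonic_orth F := forall k (p : mpoly.mpoly n.+1 R),
  homog k p -> laplacian p = 0 -> Lam n (fun y => F y * pst p y) = 0.

Lemma pst_qform y : pst (qform : mpoly.mpoly n.+1 R) y = 1.
Proof.
rewrite -(unitv_st n y) /pst meval_sum; apply: eq_bigr => i _.
by rewrite expr2 mpoly.mevalM mpoly.mevalXU.
Qed.

Lemma pst_lform z y : pst (lform z) y = zdot z y.
Proof.
by rewrite /pst meval_sum; apply: eq_bigr => i _; rewrite mpoly.mevalZ mpoly.mevalXU.
Qed.

(** On the sphere |x|^2 = 1, so the zonal harmonic of degree d is <z, x>^d plus lower powers, and
    strong induction on d disposes of these. *)
Lemma harmonic_orth_zdot F z : bm n F -> unitv z -> harmonic_orth F ->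
  forall d, Lam n (fun y => F y * zdot z y ^+ d) = 0.
Proof.
move=> bF z1 hF d; have [k] := ubnP d; elim: k d => // k ih d /ltnSE dk.
have [|c c0 lapH] := zonal_harmonic d _ z1; first exact: ltnW.
set H := (\sum_(i < _) _) in lapH.
have hH : homog d H.
  apply: homog_sum => i; apply: homogZ.
  have id : (d = 2 * i + 1 * (d - i.*2))%N.
    by have := ltn_ord i; have := odd_double_half d; lia.
  rewrite [X in homog X]id; apply: homogM; first exact: (homogX i (@homog_qform R n.+1)).
  exact: (homogX _ (homog_lform z)).
have b d' : bm n (fun y => F y * zdot z y ^+ d').
  by apply: bm_mul => //; apply: bm_exp; exact: bm_zdot.
have := hF d H hH lapH.
rewrite (_ : (fun y => _) = (fun y => \sum_(i < d./2.+1) c i * (F y * zdot z y ^+ (d - i.*2)))); last first.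
  apply/funext => y; rewrite /pst meval_sum mulr_sumr; apply: eq_bigr => i _.
  by rewrite mpoly.mevalZ -!/(pst _ _) pstM !pst_exp pst_qform pst_lform expr1n; ring.
rewrite (Lam_sum n2) => [|i]; last by apply: bm_mul; [exact: bm_cst|exact: b].
rewrite big_ord_recl /= double0 subn0 (Lam_cmul n2 _ (b _)) c0 mul1r big1 ?addr0// => i _.
rewrite (Lam_cmul n2 _ (b _)) /bump /= add1n ih ?mulr0//.
by have := ltn_ord i; have := odd_double_half d; lia.
Qed.

Lemma harmonic_orth_vz F z : bm n F -> unitv z -> harmonic_orth F ->
  forall N, Lam n (fun y => F y * vz z y ^+ N) = 0.
Proof.
move=> bF z1 hF N; have h := harmonic_orth_zdot bF z1 hF.
have b d : bm n (fun y => F y * zdot z y ^+ d).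
  by apply: bm_mul => //; apply: bm_exp; exact: bm_zdot.
rewrite (_ : (fun y => _) = (fun y => \sum_(i < N.+1) (2^-1 ^+ N * 'C(N, i)%:R) * (F y * zdot z y ^+ i))).
  rewrite (Lam_sum n2) => [|i]; last by apply: bm_mul; [exact: bm_cst|exact: b].
  by rewrite big1// => i _; rewrite (Lam_cmul n2 _ (b _)) h mulr0.
apply/funext => y; rewrite /vz exprMn exprDn !mulr_sumr; apply: eq_bigr => i _.
by rewrite expr1n mul1r -mulr_natl; ring.
Qed.

(** Consecutive moments have ratio (n/2 + N) / (n + N), which tends to 1: they decay more slowly
    than any geometric sequence. *)
Lemma emom0_geometric (q : R) : 0 < q -> q < 1 ->
  exists2 N0, (0 : R) < emom n 0 N0 & forall j, q ^+ j * emom n 0 N0 <= emom n 0 (N0 + j).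
Proof.
move=> q0 q1; have n0 : (0 : R) < n%:R by rewrite ltr0n; lia.
(* Once N (1 - q) >= q n, one has q (n + N) <= N, so the ratio is at least q. *)
pose N0 := Num.truncn (q * n%:R / (1 - q)).
have q1' : 0 < 1 - q by rewrite subr_gt0.
have hN0 : q * n%:R <= N0.+1%:R * (1 - q).
  by rewrite -ler_pdivrMr//; apply: ltW; exact: truncnS_gt.
exists N0.+1; first exact: (emom0_gt0 n2).
elim=> [|j ih]; first by rewrite expr0 mul1r addn0.
rewrite exprS -mulrA addnS; apply: (le_trans (ler_wpM2l (ltW q0) ih)).
set N := (N0.+1 + j)%N.
have nN : 0 < n%:R + N%:R :> R by rewrite ltr_pwDl.
rewrite -(ler_pM2r nN) (emom0S n2) mulrAC mulrC ler_wpM2l ?(ltW (emom0_gt0 n2 N))//.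
have NN : (N0.+1%:R : R) <= N%:R by rewrite ler_nat /N leq_addr.
have : N0.+1%:R * (1 - q) <= N%:R * (1 - q) by rewrite ler_wpM2r// ltW.
move: hN0 n0; move: (n%:R : R) (N%:R : R) (N0.+1%:R : R) => x u t.
by move=> *; nra.
Qed.

(* Against the kernels [vz z ^+ N], whose mass concentrates at [z]. *)
Lemma peak F z (e q M : R) : bm n F -> unitv z -> 0 < e -> 0 < q -> q < 1 ->
  (forall y, `|F y| <= M) -> (forall y, q < vz z y -> e <= F y) ->
  ~ forall N, Lam n (fun y => F y * vz z y ^+ N) = 0.
Proof.
move=> bF z1 e0 q0 q1 hM hF h0.
have M0 : 0 <= M by exact: le_trans (hM [::]).
have bv N : bm n (fun y => vz z y ^+ N) by apply: bm_exp; exact: bm_vz.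
have b1 : bm n (fun=> 1 : R) by exact: bm_cst.
(* Pointwise e v^N - (e + M) q^N <= F v^N: where v > q because F >= e, elsewhere because |F| <= M
   and v^N <= q^N. *)
have up N : e * emom n 0 N <= (e + M) * Lam n (fun=> 1) * q ^+ N.
  rewrite -subr_le0 -(h0 N).
  have -> : e * emom n 0 N - (e + M) * Lam n (fun=> 1) * q ^+ N =
     Lam n (fun y => e * vz z y ^+ N + - ((e + M) * q ^+ N) * 1).
    rewrite (Lam_add n2) ?(Lam_cmul n2)//; last 2 first.
    - by apply: bm_mul; [exact: bm_cst|].
    - by apply: bm_mul; [exact: bm_cst|].
    by rewrite Lam_vz//; ring.
  apply: (Lam_le n2).
  - by apply: bm_add; apply: bm_mul => //; exact: bm_cst.
  - exact: bm_mul.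
  move=> y; have v0 := vz_ge0 y z1; have [vq|vq] := ltP q (vz z y).
    have : e * vz z y ^+ N <= F y * vz z y ^+ N.
      by rewrite ler_wpM2r ?exprn_ge0// hF.
    have : 0 <= (e + M) * q ^+ N by rewrite mulr_ge0 ?exprn_ge0 ?addr_ge0// ltW.
    lra.
  have vN : vz z y ^+ N <= q ^+ N by rewrite lerXn2r ?nnegrE// ltW.
  have : - F y * vz z y ^+ N <= M * q ^+ N.
    apply: (@le_trans _ _ (M * vz z y ^+ N)); last by rewrite ler_wpM2l.
    by rewrite ler_wpM2r ?exprn_ge0// (le_trans _ (hM y))// -normrN ler_norm.
  have : e * vz z y ^+ N <= e * q ^+ N by rewrite ler_wpM2l// ltW.
  lra.
(* A rate strictly between q and 1: the moments are bounded below by a multiple of q'^N, whereas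
   [up] makes them at most a multiple of q^N. *)
pose q' := (1 + q) / 2.
have q'0 : 0 < q' by rewrite /q'; lra.
have q'1 : q' < 1 by rewrite /q'; lra.
have qq' : q / q' < 1 by rewrite ltr_pdivrMr// mul1r /q'; lra.
have [N0 eN0 geo] := emom0_geometric q'0 q'1.
pose C := (e + M) * Lam n (fun=> 1) * q ^+ N0.
have bnd j : e * emom n 0 N0 <= C * (q / q') ^+ j.
  rewrite exprMn exprVn [C * _]mulrA ler_pdivlMr ?exprn_gt0//.
  have := up (N0 + j)%N; rewrite exprD mulrA -/C; apply: le_trans.
  by rewrite -mulrA [_ * q' ^+ j]mulrC ler_wpM2l ?(ltW e0).
have : (fun j => C * (q / q') ^+ j) @ \oo --> (0 : R).
  rewrite -[X in _ --> X](mulr0 C); apply: cvgM; first exact: cvg_cst.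
  by apply: cvg_expr; rewrite ger0_norm// divr_ge0// ltW.
have eN : 0 < e * emom n 0 N0 by rewrite mulr_gt0.
by move=> /cvgr_lt/(_ _ eN)[j _ /(_ j (leqnn j))]; rewrite ltNge bnd.
Qed.

End completeness.

(** * Continuous functions on the sphere: boundedness and measurability *)

Section sphere_continuity.
Context {R : realType} (n : nat).
Implicit Types (u v : 'rV[R]_(n.+1) -> R) (x : 'rV[R]_(n.+1)).

Definition scont u x := forall e, 0 < e -> exists2 d, 0 < d &
  forall x', sphere n x' -> (forall i, `|x ord0 i - x' ord0 i| < d) -> `|u x - u x'| < e.

Lemma within_scont u x : {within sphere n, continuous u} -> sphere n x -> scont u x.
Proof.
move=> /subspace_continuousP cu Sx e e0.
have /cvgrPdist_lt/(_ e e0) := cu x Sx.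
rewrite near_withinE => /nbhs_ballP[d d0 hd]; exists d => // x' Sx' h.
apply: (hd x') => //; split=> // i j.
by rewrite (ord1 i); exact: h.
Qed.

Lemma closed_sphere : closed (sphere n : set 'rV[R]_(n.+1)).
Proof.
have c : continuous (@esq R n.+1).
  rewrite /esq; elim: (index_enum _) => [|i r ih].
    rewrite (_ : (fun x => _) = fun=> 0); first exact: cst_continuous.
    by apply/funext => x; rewrite big_nil.
  rewrite (_ : (fun x => _) = (fun x : 'rV[R]_n.+1 => x ord0 i * x ord0 i + \sum_(i <- r) x ord0 i ^+ 2)).
    have ci : continuous (fun x : 'rV[R]_n.+1 => x ord0 i) by exact: coord_continuous.
    by move=> x; exact: (cvgD (cvgM (ci x) (ci x)) (ih x)).
  by apply/funext => x; rewrite big_cons expr2.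
rewrite (_ : sphere n = (@esq R n.+1) @^-1` [set 1])//.
by apply: preimage_closed => [x _|]; [exact: c|exact: closed_eq].
Qed.

Lemma compact_sphere : compact (sphere n : set 'rV[R]_(n.+1)).
Proof.
apply: (subclosed_compact closed_sphere (@rV_compact R n.+1 (fun=> `[-1, 1]%classic) _)).
  by move=> _; exact: segment_compact.
move=> x Sx i /=; rewrite in_itv/= -ler_norml.
rewrite -(@expr_le1 _ 2) ?normr_ge0// real_normK ?num_real//.
rewrite -[leRHS]Sx /esq (bigD1 i)//= lerDl sumr_ge0// => j _; exact: sqr_ge0.
Qed.

Lemma sphere_bounded u : {within sphere n, continuous u} ->
  exists M, forall x, sphere n x -> `|u x| <= M.
Proof.
move=> cu; have := compact_bounded (continuous_compact cu compact_sphere).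
move=> [M [Mr hM]]; exists (M + 1) => x Sx; apply: (hM (M + 1)); first by rewrite ltrDl.
by exists x.
Qed.

(** The sigma-algebra of [cs_type] is a product one, used without a topology. The set where u > c is
    therefore written as a countable union over the rational boxes whose part on the sphere lies
    inside {u > c}. *)
Lemma sphere_measurable u : (forall x, sphere n x -> scont u x) ->
  measurable_fun setT (fun p : cs_type (@Rn R n) => u (istereo n (cs_seq p))).
Proof.
move=> cu; apply: (measurability _ (RGenOInfty.measurableE R)) => _ [_ [c ->] <-].
rewrite setTI.
pose B (q : {ffun 'I_n.+1 -> rat} * nat) := [set p : cs_type (@Rn R n) |
  forall i, `|st i (cs_seq p) - ratr (q.1 i)| < q.2.+1%:R^-1].
pose good (q : {ffun 'I_n.+1 -> rat} * nat) := forall x, sphere n x ->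
  (forall i, `|x ord0 i - ratr (q.1 i)| < q.2.+1%:R^-1) -> c < u x.
rewrite (_ : _ @^-1` _ = \bigcup_q (B q `&` [set _ | good q])); last first.
  apply/seteqP; split => [p /=|p [q _ [Bq gq]]]; last first.
    rewrite /= in_itv/= andbT; apply: gq => //; exact: istereo_sphere.
  rewrite in_itv/= andbT => cp.
  have Sx := istereo_sphere n (cs_seq p); set x := istereo n (cs_seq p) in Sx cp.
  have e0 : 0 < u x - c by rewrite subr_gt0.
  have [d d0 hd] := cu x Sx _ e0.
  (* The box has half-width below d / 2, so any two of its points have coordinates within d of each
     other. *)
  pose m := Num.truncn (2 / d).
  have md : m.+1%:R^-1 < d / 2.
    by rewrite -[ltRHS]invrK ltf_pV2 ?posrE ?ltr0n ?invr_gt0 ?divr_gt0// invf_div truncnS_gt.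
  have m0 : (0 : R) < m.+1%:R^-1 by rewrite invr_gt0 ltr0n.
  have /choice[q hq] i : exists q : rat, `|x ord0 i - ratr q| < m.+1%:R^-1.
    have h : x ord0 i - m.+1%:R^-1 < x ord0 i + m.+1%:R^-1 by rewrite ltrD2l gtrN.
    have [q] := rat_in_itvoo h; rewrite in_itv/= => /andP[q1 q2]; exists q.
    rewrite ltr_norml; move: q1 q2; move: (m.+1%:R^-1 : R) (ratr q : R) (x ord0 i) => r1 r2 r3 *.
    by apply/andP; split; lra.
  exists ([ffun i => q i], m) => //; split => [i|x' Sx' hx'] /=; first by rewrite ffunE; exact: hq.
  have /(hd x' Sx') : forall i, `|x ord0 i - x' ord0 i| < d.
    move=> i; have := hq i; have := hx' i; rewrite /= ffunE !ltr_norml.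
    move: md; move: (m.+1%:R^-1 : R) (ratr (q i) : R) (x ord0 i) (x' ord0 i) => r1 r2 r3 r4 md.
    by move=> /andP[? ?] /andP[? ?]; apply/andP; split; lra.
  by rewrite ltr_norml => /andP[_]; lra.
apply: countable_bigcupT_measurable => // q.
apply: measurableI; last first.
  by have [g|g] := pselect (good q);
    [rewrite (_ : [set _ | _] = setT)//; apply/seteqP; split
    |rewrite (_ : [set _ | _] = set0)//; apply/seteqP; split].
rewrite (_ : B q = \bigcap_(i in [set: 'I_n.+1]) [set p | `|st i (cs_seq p) - ratr (q.1 i)| < q.2.+1%:R^-1]).
  apply: fin_bigcap_measurable => // i _.
  have [_ ms] := @bm_st R n i.
  have mn : measurable_fun setT (fun p : cs_type (@Rn R n) => `|st i (cs_seq p) - ratr (q.1 i)|).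
    by apply: measurableT_comp => //; apply: measurable_funB.
  have := mn measurableT _ (measurable_itv `]-oo, (q.2.+1%:R^-1 : R)[); rewrite setTI.
  by congr measurable; apply/seteqP; split => p /=; rewrite in_itv.
by apply/seteqP; split => [p h i _|p h i] /=; [exact: h|exact: h].
Qed.

Lemma bm_sphere u : {within sphere n, continuous u} -> bm n (fun y => u (istereo n y)).
Proof.
move=> cu; split; last by apply: sphere_measurable => x; exact: within_scont.
have [M hM] := sphere_bounded cu.
by exists M => y; apply: hM; exact: istereo_sphere.
Qed.

Lemma smooth_within u : smooth_on_sphere n u -> {within sphere n, continuous u}.
Proof.
move=> [F [/(_ [::])[/= cF _] Fu]]; apply/subspace_continuousP => x Sx.
have : F y @[y --> within (sphere n) (nbhs x)] --> F x.
  by apply: cvg_within_filter; exact: cF.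
rewrite (Fu x Sx); apply: cvg_trans; apply: near_eq_cvg.
by rewrite near_withinE; apply: nearW => y Sy; exact: Fu.
Qed.

End sphere_continuity.

(** * Potentials of bounded functions: bounds, symmetry, continuity *)

Section potential.
Context {R : realType} (n : nat) (a : R).
Hypotheses (n2 : (2 < n)%N) (a0 : 0 < a) (an : 2 * a < n%:R).
Let mu := cs_mu (@Rn R n).
Let T := cs_type (@Rn R n).
Implicit Types (z : 'I_n.+1 -> R) (y : seq R) (F G : seq R -> R) (N J : nat).
Notation w p := (rho n (cs_seq p) ^+ n).
Notation stv y := (fun i : 'I_n.+1 => st i y).

Definition potential F z : R := Lam n (fun y => F y * kern a z y).

Lemma Lam_norm_le F M : bm n F -> (forall y, `|F y| <= M) -> `|Lam n F| <= M * Lam n (fun=> 1).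
Proof.
move=> bF hM; have b1 c : bm n (fun=> c : R) by exact: bm_cst.
have -> : M * Lam n (fun=> 1) = Lam n (fun=> M).
  by rewrite -(Lam_cmul n2 _ (b1 1)); congr Lam; apply/funext => y; rewrite mulr1.
have Lopp : Lam n (fun=> - M) = - Lam n (fun=> M).
  by rewrite -[RHS]mulN1r -(Lam_cmul n2 _ (b1 M)); congr Lam; apply/funext => y; rewrite mulN1r.
rewrite ler_norml -Lopp; apply/andP; split; apply: (Lam_le n2) => // y.
  by have := hM y; rewrite ler_norml => /andP[].
by have := hM y; rewrite ler_norml => /andP[].
Qed.

Lemma potential_bound F z M : unitv z -> bm n F -> (forall y, `|F y| <= M) ->
  `|potential F z| <= M * S0 n a.
Proof.
(* At level J = 0 the truncated kernel is 0 and the tail is the whole mass. *)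
move=> z1 bF hM; have := kern_approx n2 a0 an 0 z1 bF hM.
rewrite (_ : (fun y => F y * kernJ a z 0 y) = fun=> 0); last first.
  by apply/funext => y; rewrite /kernJ big_ord0 mulr0.
by rewrite (Lam0 n2) subr0 /series/= big_geq// subr0.
Qed.

Lemma measurable_kern2 :
  measurable_fun setT (fun q : T * T => kern a (stv (cs_seq q.1)) (cs_seq q.2)).
Proof.
apply: (measurableT_comp (@measurable_powR R (- a))).
apply: measurable_funB => //; apply: measurable_funM => //; apply: measurable_funD => //.
apply: measurable_sum => i; have [_ ms] := @bm_st R n i.
apply: measurable_funM; first exact: (measurableT_comp ms measurable_fst).
exact: (measurableT_comp ms measurable_snd).
Qed.

Lemma kernC y y' : kern a (stv y) y' = kern a (stv y') y.
Proof.
rewrite /kern /vz /zdot; congr ((1 - _ * (1 + _)) `^ _).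
by apply: eq_bigr => i _; rewrite mulrC.
Qed.

Lemma Lam_potential_EFin F z : bm n F -> unitv z ->
  (\int[mu]_p (w p * (F (cs_seq p) * kern a z (cs_seq p)))%:E = (potential F z)%:E)%E.
Proof.
move=> bF z1; rewrite /potential /Lam /Rintegral fineK//.
by apply: integrable_fin_num => //; exact: (lint_kern n2 a0 an z1 bF).
Qed.

Lemma measurable_w2 F G : bm n F -> bm n G -> measurable_fun setT
  (fun q : T * T => (w q.1 * G (cs_seq q.1) * (w q.2 * (F (cs_seq q.2) * kern a (stv (cs_seq q.1)) (cs_seq q.2))))).
Proof.
move=> [_ mF] [_ mG]; have mw := @measurable_w R n.
apply: measurable_funM; apply: measurable_funM.
- exact: (measurableT_comp mw measurable_fst).
- exact: (measurableT_comp mG measurable_fst).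
- exact: (measurableT_comp mw measurable_snd).
- by apply: measurable_funM; [exact: (measurableT_comp mF measurable_snd)|exact: measurable_kern2].
Qed.

Lemma bm_potential F : bm n F -> bm n (fun y => potential F (stv y)).
Proof.
move=> bF; split.
  have [[M hM] _] := bF; exists (M * S0 n a) => y.
  by apply: potential_bound => //; exact: unitv_st.
have [_ mF] := bF; have mw := @measurable_w R n.
have mk : measurable_fun setT (fun q : T * T => (w q.2 * (F (cs_seq q.2) * kern a (stv (cs_seq q.1)) (cs_seq q.2)))%:E).
  apply/measurable_EFinP; apply: measurable_funM; first exact: (measurableT_comp mw measurable_snd).
  by apply: measurable_funM; [exact: (measurableT_comp mF measurable_snd)|exact: measurable_kern2].
have := @measurable_fun_integral_param R _ _ T T mu _ mk.
exact: (measurableT_comp (fine_measurable measurableT)).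
Qed.

(** The kernel is symmetric, so taking potentials is self-adjoint. Joint integrability comes from
    Tonelli, as the potential of |F| is bounded. *)
Lemma Lam_potential_swap F G : bm n F -> bm n G ->
  Lam n (fun y => potential F (stv y) * G y) = Lam n (fun y => F y * potential G (stv y)).
Proof.
move=> bF bG.
pose f (q : T * T) : \bar R := (w q.1 * G (cs_seq q.1) *
  (w q.2 * (F (cs_seq q.2) * kern a (stv (cs_seq q.1)) (cs_seq q.2))))%:E.
have mf : measurable_fun setT f by apply/measurable_EFinP; exact: measurable_w2.
have iF (p : T) : mu.-integrable setT (fun q : T => (w q * (F (cs_seq q) * kern a (stv (cs_seq p)) (cs_seq q)))%:E).
  exact: (lint_kern n2 a0 an (unitv_st _ _) bF).
have iG (q : T) : mu.-integrable setT (fun p : T => (w p * (G (cs_seq p) * kern a (stv (cs_seq q)) (cs_seq p)))%:E).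
  exact: (lint_kern n2 a0 an (unitv_st _ _) bG).
have E1 (p : T) : (\int[mu]_q f (p, q) = (w p * (potential F (stv (cs_seq p)) * G (cs_seq p)))%:E)%E.
  transitivity (\int[mu]_q ((w p * G (cs_seq p))%:E * (w q * (F (cs_seq q) * kern a (stv (cs_seq p)) (cs_seq q)))%:E))%E.
    by apply: eq_integral => q _; rewrite -EFinM.
  rewrite (integralZl measurableT (iF p)).
  rewrite Lam_potential_EFin//; last exact: unitv_st.
  by rewrite -EFinM; congr EFin; ring.
have E2 (q : T) : (\int[mu]_p f (p, q) = (w q * (F (cs_seq q) * potential G (stv (cs_seq q))))%:E)%E.
  transitivity (\int[mu]_p ((w q * F (cs_seq q))%:E * (w p * (G (cs_seq p) * kern a (stv (cs_seq q)) (cs_seq p)))%:E))%E.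
    by apply: eq_integral => p _; rewrite -EFinM; rewrite /f/= (kernC (cs_seq p)); congr EFin; ring.
  rewrite (integralZl measurableT (iG q)).
  rewrite Lam_potential_EFin//; last exact: unitv_st.
  by rewrite -EFinM; congr EFin; ring.
have fi : (mu \x mu)%E.-integrable setT f.
  apply/(integrable12ltyP mu mu) => //.
  have bF' : bm n (fun y => `|F y|).
    by have [[M hM] mF] := bF; split; [exists M => y; rewrite normr_id|apply: measurableT_comp].
  have bG' : bm n (fun y => `|G y|).
    by have [[M hM] mG] := bG; split; [exists M => y; rewrite normr_id|apply: measurableT_comp].
  have E (p : T) : (\int[mu]_q `|f (p, q)| = (w p * (potential (fun y => `|F y|) (stv (cs_seq p)) * `|G (cs_seq p)|))%:E)%E.
    transitivity (\int[mu]_q ((w p * `|G (cs_seq p)|)%:E * (w q * (`|F (cs_seq q)| * kern a (stv (cs_seq p)) (cs_seq q)))%:E))%E.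
      apply: eq_integral => q _; rewrite -EFinM /f abse_EFin; congr EFin.
      by rewrite !normrM !(ger0_norm (ltW (w_gt0 _))) (ger0_norm (kern_ge0 _ _ _)).
    rewrite (integralZl measurableT (lint_kern n2 a0 an (unitv_st n (cs_seq p)) bF')).
    rewrite (Lam_potential_EFin bF' (unitv_st n (cs_seq p))).
    by rewrite -EFinM; congr EFin; ring.
  under eq_integral do rewrite E.
  by rewrite (Lam_EFin n2 (bm_mul (bm_potential bF') bG')) ltry.
have L1 : (\int[mu]_p \int[mu]_q f (p, q) = \int[mu]_p (w p * (potential F (stv (cs_seq p)) * G (cs_seq p)))%:E)%E.
  by apply: eq_integral => p _; exact: E1.
have L2 : (\int[mu]_q \int[mu]_p f (p, q) = \int[mu]_q (w q * (F (cs_seq q) * potential G (stv (cs_seq q))))%:E)%E.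
  by apply: eq_integral => q _; exact: E2.
by have := congr1 fine (etrans (esym L1) (etrans (Fubini fi) L2)).
Qed.

(* Splitting [kern] at a finite level of its power series in [vz], uniformly in [z]. *)
Lemma potential_continuous F z0 e : bm n F -> unitv z0 -> 0 < e ->
  exists2 d, 0 < d & forall z, unitv z -> (forall i, `|z0 i - z i| < d) ->
    `|potential F z0 - potential F z| < e.
Proof.
move=> bF z01 e0; have [[M hM] mF] := bF.
have M0 : 0 <= M by exact: le_trans (hM [::]).
have e3 : 0 < e / 3 by rewrite divr_gt0.
have [J hJ] : exists J, M * (S0 n a - series (TT n a 0) J) < e / 3.
  have : (fun J => M * (S0 n a - series (TT n a 0) J)) @ \oo --> (0 : R).
    rewrite -[X in _ --> X](mulr0 M) -[X in _ * X](subrr (S0 n a)).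
    apply: cvgM; first exact: cvg_cst.
    by apply: cvgB; [exact: cvg_cst|exact: cvg_TT0].
  by move=> /cvgr_lt/(_ _ e3)[J _ /(_ J (leqnn J))]; exists J.
(* A Lipschitz constant in v on [0, 1] for the truncated series. [K] multiplies it by M, the number
   of coordinates and the total mass; the added 1 makes it positive and the final estimate
   strict. *)
pose C := \sum_(N < J) bc a N * N%:R.
have C0 : 0 <= C by apply: sumr_ge0 => N _; rewrite mulr_ge0 ?bc_ge0.
have vX (x x' : R) N : 0 <= x <= 1 -> 0 <= x' <= 1 -> `|x ^+ N - x' ^+ N| <= N%:R * `|x - x'|.
  move=> /andP[x0 x1] /andP[x'0 x'1]; elim: N => [|N ih].
    by rewrite !expr0 subrr normr0 mul0r.
  rewrite !exprS (_ : _ - _ = x * (x ^+ N - x' ^+ N) + x' ^+ N * (x - x')); last by ring.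
  rewrite (le_trans (ler_normD _ _))// !normrM -natr1 mulrDl mul1r.
  rewrite (ger0_norm x0) (ger0_norm (exprn_ge0 _ x'0)) lerD//.
    by apply: (le_trans _ ih); rewrite ler_piMl.
  by rewrite ler_piMl// exprn_ile1.
have stb (i : 'I_n.+1) y : `|st i y| <= 1.
  rewrite -(@expr_le1 _ 2) ?normr_ge0// real_normK ?num_real//.
  rewrite -[leRHS](unitv_st n y) (bigD1 i)//= lerDl sumr_ge0// => j _; exact: sqr_ge0.
have vzd z z' y d : (forall i, `|z i - z' i| < d) -> `|vz z y - vz z' y| <= n.+1%:R * d.
  move=> h; have d0 : 0 <= d by apply: le_trans (ltW (h ord0)).
  rewrite /vz -mulrBr opprD addrACA subrr add0r normrM ger0_norm// /zdot -sumrB.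
  apply: (@le_trans _ _ (1 * (n.+1%:R * d))); last by rewrite mul1r.
  apply: ler_pM => //; first by rewrite invf_le1// ler1n.
  apply: (le_trans (ler_norm_sum _ _ _)).
  rewrite -[n.+1 in leRHS]card_ord -sum1_card natr_sum mulr_suml; apply: ler_sum => i _.
  by rewrite mul1r -mulrBl normrM -[leRHS]mulr1 ler_pM// ltW.
have L0 := Lam1_gt0 (R := R) n2.
pose K := M * (C * n.+1%:R) * Lam n (fun=> 1) + 1.
have K0 : 0 < K by rewrite ltr_wpDl// !mulr_ge0// ltW.
exists (e / 3 / K) => [|z z1 hz]; first by rewrite divr_gt0.
set d := e / 3 / K in hz.
have d0 : 0 < d by rewrite divr_gt0.
have ap z' : unitv z' -> `|potential F z' - Lam n (fun y => F y * kernJ a z' J y)| < e / 3.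
  by move=> z'1; apply: le_lt_trans hJ; exact: kern_approx.
have bK z' : bm n (fun y => F y * kernJ a z' J y) by apply: bm_mul => //; exact: bm_kernJ.
have mid : `|Lam n (fun y => F y * kernJ a z0 J y) - Lam n (fun y => F y * kernJ a z J y)| < e / 3.
  rewrite -[X in _ - X]mul1r -mulNr -(Lam_cmul n2 (-1) (bK z)).
  rewrite -(Lam_add n2 (bK z0) (bm_mul (bm_cst n _) (bK z))).
  apply: (@le_lt_trans _ _ (M * (C * (n.+1%:R * d)) * Lam n (fun=> 1))).
    apply: Lam_norm_le => [|y]; first exact: (bm_add (bK z0) (bm_mul (bm_cst n _) (bK z))).
    rewrite mulN1r -mulrBr normrM ler_pM//.
    rewrite /kernJ -sumrB (le_trans (ler_norm_sum _ _ _))// /C mulr_suml; apply: ler_sum => N _.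
    rewrite -mulrBr normrM ger0_norm ?bc_ge0// -mulrA ler_wpM2l ?bc_ge0//.
    apply: (le_trans (vX _ _ _ _ _)); rewrite ?vz_ge0 ?vz_le1//.
    by rewrite ler_wpM2l//; exact: vzd.
  rewrite (_ : _ * Lam _ _ = (K - 1) * d); last by rewrite /K; ring.
  rewrite -[ltRHS](divfK (lt0r_neq0 K0)) -/d mulrC ltr_pM2l// gtrBl//.
have A := ap z0 z01; have B := ap z z1; rewrite distrC in B.
have := ler_normD (potential F z0 - Lam n (fun y => F y * kernJ a z0 J y) +
  (Lam n (fun y => F y * kernJ a z0 J y) - Lam n (fun y => F y * kernJ a z J y)))
  (Lam n (fun y => F y * kernJ a z J y) - potential F z).
have := ler_normD (potential F z0 - Lam n (fun y => F y * kernJ a z0 J y))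
  (Lam n (fun y => F y * kernJ a z0 J y) - Lam n (fun y => F y * kernJ a z J y)).
rewrite !addrA !subrK => h1 h2; lra.
Qed.

End potential.

(** * From the conformal equations to potentials, and the two implications *)

Section integral_equation.
Context {R : realType} (n : nat) (s : R).
Hypotheses (n2 : (2 < n)%N) (s0 : 0 < 2 * s) (sn : 2 * s < n%:R).
Let a : R := n%:R / 2 - s.
Let T := cs_type (@Rn R n).
Implicit Types (x z : 'rV[R]_(n.+1)) (h : 'rV[R]_(n.+1) -> R).

Let a0 : 0 < a.
Proof. by rewrite /a; move: sn; move: (n%:R : R) => t ?; lra. Qed.
Let an : 2 * a < n%:R.
Proof. by rewrite /a; move: s0; move: (n%:R : R) => t ?; lra. Qed.
Let sp : 0 < s.
Proof. by move: s0; lra. Qed.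

Notation crd z := (fun i : 'I_n.+1 => z ord0 i).

Lemma sintE h : lint n (fun y => h (istereo n y)) ->
  sint n h = (Lam n (fun y => h (istereo n y)))%:E.
Proof.
move=> hi.
have hi' : (cs_mu (@Rn R n)).-integrable setT (fun p => (h (istereo n (cs_seq p)) * (2 / (1 + ysq n (cs_seq p))) ^+ n)%:E).
  by apply: (eq_integrable measurableT _ _ _ hi) => p _; rewrite mulrC.
rewrite /sint (iintE (F := fun y => (h (istereo n y) * (2 / (1 + ysq n y)) ^+ n)%:E))//.
rewrite /Lam /Rintegral fineK; last by apply: integrable_fin_num.
by apply: eq_integral => p _; rewrite mulrC.
Qed.

Lemma edist_kern z y : sphere n z ->
  (Defs.edist z (istereo n y) `^ (n%:R - 2 * s))^-1 = 4 `^ (- a) * kern a (crd z) y.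
Proof.
move=> Sz; have v1 := vz_le1 y (Sz : unitv (crd z)).
rewrite -powRN /Defs.edist; have -> : esq (z - istereo n y) = 4 * (1 - vz (crd z) y).
  rewrite (oneB_vz y (Sz : unitv (crd z))) mulrA divff// mul1r /esq.
  by apply: eq_bigr => i _; rewrite mxE [in LHS]mxE.
have v0 : 0 <= 1 - vz (crd z) y by rewrite subr_ge0.
rewrite -powR12_sqrt ?mulr_ge0// -powRrM powRM//.
by rewrite /kern /a (_ : 2^-1 * _ = - (n%:R / 2 - s))//; field.
Qed.

Definition kappa : R := cns n s * 4 `^ (- a).

(** The choice of c_{n,s} is exactly what makes the integral operator invert P_s in every degree:
    4^(-a) = 2^(2s) / 2^n cancels the powers of 2, and [S0] supplies pi^(n/2) Gamma(s) / Gamma(n -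
    a). *)
Lemma kappa_Sk k : kappa * Sk n a k * Ps_eig n s k = 1.
Proof.
have n0 : (0 : R) < n%:R by rewrite ltr0n; apply: ltn_trans n2.
have na : 0 < n%:R - a by have := an; have := a0; move: (n%:R : R) a => t b ? ?; lra.
rewrite /Ps_eig (_ : k%:R + n%:R / 2 + s = k%:R + n%:R - a); last by rewrite /a; field.
rewrite (_ : k%:R + n%:R / 2 - s = k%:R + a); last by rewrite /a; ring.
rewrite -mulrA (Sk_mul_Gamma n2 a0 an) /kappa /cns /S0 -/a.
rewrite (_ : n%:R / 2 - a = s); last by rewrite /a; ring.
have -> : 4 `^ (- a) = 2 `^ (2 * s) / 2 ^+ n :> R.
  rewrite -[2 ^+ n]powR_mulrn// -powRB ?pnatr_eq0 ?implybT//.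
  rewrite (_ : (4 : R) = 2 `^ 2); last by rewrite powR_mulrn// -natrX.
  by rewrite -powRrM; congr (_ `^ _); rewrite /a; field.
have G1 := Gamma_gt0 na; have G2 := Gamma_gt0 a0; have G3 := Gamma_gt0 sp.
have G4 : 0 < pi `^ (n%:R / 2) :> R by rewrite powR_gt0 ?pi_gt0.
have G5 : 0 < 2 `^ (2 * s) :> R by rewrite powR_gt0.
have G6 : 0 < 2 ^+ n :> R by rewrite exprn_gt0.
move: (Gamma _) (Gamma a) (Gamma s) (_ `^ _) (_ `^ _) (_ ^+ n) G1 G2 G3 G4 G5 G6.
by move=> x1 x2 x3 x4 x5 x6 *; field; rewrite !gt_eqF.
Qed.

Section conformal.
Variables (phi Rg : 'rV[R]_(n.+1) -> R) (f : R -> R).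
Hypotheses (cphi : {within sphere n, continuous phi})
  (phi0 : forall x, sphere n x -> 0 < phi x)
  (cRg : {within sphere n, continuous Rg}) (cf : continuous f).

Section solution.
Variable u : 'rV[R]_(n.+1) -> R.
Hypothesis cu : {within sphere n, continuous u}.

Definition rhs x := phi x `^ cexp n s * (f (u x) + Rg x * u x).

Lemma cexp_gt0 : 0 < cexp n s.
Proof.
by rewrite /cexp divr_gt0//; move: sn s0; move: (n%:R : R) => t *; lra.
Qed.

Lemma bm_rhs : bm n (fun y => rhs (istereo n y)).
Proof.
have [[Mp hp] mp] := bm_sphere cphi; have [[Mu hu] mu] := bm_sphere cu.
apply: bm_mul.
  split; last exact: (measurableT_comp (@measurable_powR R (cexp n s)) mp).
  exists (Mp `^ cexp n s) => y; rewrite ger0_norm ?powR_ge0//.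
  have p0 := ltW (phi0 (istereo_sphere n y)).
  have pM : phi (istereo n y) <= Mp by rewrite (le_trans (ler_norm _)).
  by apply: ge0_ler_powR; rewrite ?nnegrE ?(ltW cexp_gt0) ?(le_trans p0).
apply: bm_add; last by apply: bm_mul; exact: bm_sphere.
split; last by apply: measurableT_comp => //; exact: continuous_measurable_fun.
have cfs : {within `[- Mu, Mu], continuous f} by exact: continuous_subspaceT.
have := compact_bounded (continuous_compact cfs (@segment_compact R (- Mu) Mu)).
move=> [M [Mr hM]]; exists (M + 1) => y; apply: (hM (M + 1)); first by rewrite ltrDl.
by exists (u (istereo n y)) => //=; rewrite in_itv/= -ler_norml.
Qed.

Lemma sint_potential z : sphere n z ->
  sint n (fun x => (f (u x) + Rg x * u x) / Kker n s phi z x * vol_dens n s phi x) =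
  ((phi z)^-1 * 4 `^ (- a) * potential a (fun y => rhs (istereo n y)) (crd z))%:E.
Proof.
move=> Sz; pose F y := rhs (istereo n y).
have E y : (f (u (istereo n y)) + Rg (istereo n y) * u (istereo n y)) /
    Kker n s phi z (istereo n y) * vol_dens n s phi (istereo n y) =
    (phi z)^-1 * 4 `^ (- a) * (F y * kern a (crd z) y).
  rewrite /Kker invfM (edist_kern y Sz) invfM /F /rhs /vol_dens.
  have p0 := phi0 (istereo_sphere n y).
  (* 2n / (n - 2s) = (n + 2s) / (n - 2s) + 1: the volume form provides the power of phi in [rhs] and
     one more phi, which cancels phi(w) in the kernel. *)
  have -> : phi (istereo n y) `^ (2 * n%:R / (n%:R - 2 * s)) =
      phi (istereo n y) `^ cexp n s * phi (istereo n y).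
    rewrite -[X in _ = _ * X](powRr1 (ltW p0)) -powRD ?(gt_eqF p0) ?implybT//.
    congr (_ `^ _); rewrite /cexp; field.
    by rewrite gt_eqF// subr_gt0.
  move: (f _ + _) (kern _ _ _) (4 `^ _) (phi _ `^ _) => x1 x2 x3 x4.
  move: (phi (istereo n y)) p0 (phi z) (phi0 Sz) => x5 ? x6 ?.
  by  field; rewrite !gt_eqF.
have bF : bm n F := bm_rhs.
have ik := lint_kern n2 a0 an (Sz : unitv (crd z)) bF.
have ik' := integrableZl measurableT ((phi z)^-1 * 4 `^ (- a)) ik.
rewrite sintE.
  congr EFin; rewrite /potential /Lam -RintegralZl//.
  by apply: eq_Rintegral => p _; rewrite E mulrCA.
apply: (eq_integrable measurableT _ _ _ ik') => p _.
by rewrite -EFinM E mulrCA.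
Qed.

(** Symmetry moves the potential onto the harmonic, on which it acts as multiplication by
    [Sk n a k]. *)
Lemma Lam_potential_harmonic k (p : mpoly.mpoly n.+1 R) : homog k p -> laplacian p = 0 ->
  Lam n (fun y => potential a (fun y => rhs (istereo n y)) (fun i : 'I_n.+1 => st i y) * pst p y) =
  Sk n a k * Lam n (fun y => rhs (istereo n y) * pst p y).
Proof.
move=> hp lp; have bF := bm_rhs.
rewrite (Lam_potential_swap n2 a0 an bF (bm_pst p)) -(Lam_cmul n2); last first.
  by apply: bm_mul => //; exact: bm_pst.
congr Lam; apply/funext => y.
rewrite /potential (funk_hecke n2 a0 an (unitv_st n y) hp lp) -/(pst p y); ring.
Qed.

Lemma bm_phi_u : bm n (fun y => phi (istereo n y) * u (istereo n y)).
Proof. by apply: bm_mul; exact: bm_sphere. Qed.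

(** Replaces test functions on the sphere by the polynomials behind them, and extended-real iterated
    integrals by [Lam], the integrands being bounded. *)
Lemma Pg_eqP : Pg_eq n s phi u (fun x => f (u x) + Rg x * u x) <->
  forall k (p : mpoly.mpoly n.+1 R), homog k p -> laplacian p = 0 ->
    Lam n (fun y => rhs (istereo n y) * pst p y) =
    Ps_eig n s k * Lam n (fun y => phi (istereo n y) * u (istereo n y) * pst p y).
Proof.
have E (k : nat) (Y : 'rV[R]_n.+1 -> R) (p : mpoly.mpoly n.+1 R) :
    (forall x, sphere n x -> Y x = mpoly.meval (fun i => x ord0 i) p) ->
    sint n (fun x => phi x `^ cexp n s * (f (u x) + Rg x * u x) * Y x) =
      (Lam n (fun y => rhs (istereo n y) * pst p y))%:E /\
    sint n (fun x => phi x * u x * Y x) =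
      (Lam n (fun y => phi (istereo n y) * u (istereo n y) * pst p y))%:E.
  move=> Yp; have Yst y : Y (istereo n y) = pst p y by rewrite Yp//; exact: istereo_sphere.
  split; rewrite sintE.
  - by congr (EFin (Lam n _)); apply/funext => y; rewrite Yst.
  - have h := lint_bm n2 (bm_mul bm_rhs (bm_pst p)).
    by apply: (eq_integrable measurableT _ _ _ h) => q _; rewrite Yst.
  - by congr (EFin (Lam n _)); apply/funext => y; rewrite Yst.
  - have h := lint_bm n2 (bm_mul bm_phi_u (bm_pst p)).
    by apply: (eq_integrable measurableT _ _ _ h) => q _; rewrite Yst.
split=> [D k p hp lp|D k Y [p [hp [lp Yp]]]].
  pose Y (x : 'rV[R]_n.+1) := mpoly.meval (fun i => x ord0 i) p.
  have [e1 e2] := E k Y p (fun _ _ => erefl).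
  have := D k Y; rewrite e1 e2 -EFinM => D'; apply: EFin_inj; apply: D'.
  by exists p.
by have [-> ->] := E k Y p Yp; rewrite -EFinM (D k p hp lp).
Qed.

Lemma integral_equationP :
  (forall z, sphere n z -> (u z)%:E = ((cns n s)%:E *
     sint n (fun w => ((f (u w) + Rg w * u w) / Kker n s phi z w * vol_dens n s phi w)%R))%E) <->
  (forall z, sphere n z ->
     phi z * u z = kappa * potential a (fun y => rhs (istereo n y)) (crd z)).
Proof.
split=> I z Sz; have pz := phi0 Sz; have := I z Sz.
  rewrite sint_potential// -EFinM => -[->]; rewrite /kappa; field.
  by rewrite gt_eqF.
rewrite sint_potential// -EFinM => h; congr EFin.
apply: (mulfI (lt0r_neq0 pz)); rewrite h /kappa; field.
by rewrite gt_eqF.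
Qed.

Lemma integral_to_differential :
  (forall z, sphere n z ->
     phi z * u z = kappa * potential a (fun y => rhs (istereo n y)) (crd z)) ->
  Pg_eq n s phi u (fun x => f (u x) + Rg x * u x).
Proof.
move=> I; apply/Pg_eqP => k p hp lp.
have -> : Lam n (fun y => phi (istereo n y) * u (istereo n y) * pst p y) =
    kappa * Lam n (fun y => potential a (fun y => rhs (istereo n y)) (fun i : 'I_n.+1 => st i y) * pst p y).
  rewrite -(Lam_cmul n2); last first.
    by apply: bm_mul; [exact: (bm_potential n2 a0 an bm_rhs)|exact: bm_pst].
  congr Lam; apply/funext => y; rewrite (I _ (istereo_sphere n y)) /st; ring.
rewrite (Lam_potential_harmonic hp lp) mulrA mulrA [_ * _ * Sk _ _ _](_ : _ = 1) ?mul1r//.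
by rewrite -[RHS](kappa_Sk k); ring.
Qed.

(* The difference of the two sides is orthogonal to all spherical harmonics,
   hence vanishes wherever it is continuous. *)
Lemma differential_to_integral :
  Pg_eq n s phi u (fun x => f (u x) + Rg x * u x) ->
  forall z, sphere n z ->
     phi z * u z = kappa * potential a (fun y => rhs (istereo n y)) (crd z).
Proof.
move=> /Pg_eqP D z Sz; pose F y := rhs (istereo n y).
(* The sign is a parameter because [peak] excludes only a positive value at z; it is used with c = 1
   and c = -1. *)
pose E (c : R) x := c * (kappa * potential a F (crd x) - phi x * u x).
have bP := bm_potential n2 a0 an bm_rhs.
have bkP : bm n (fun y => kappa * potential a F (fun i : 'I_n.+1 => st i y)).
  by apply: bm_mul => //; exact: bm_cst.
have bD : bm n (fun y => kappa * potential a F (fun i : 'I_n.+1 => st i y) +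
    (- 1) * (phi (istereo n y) * u (istereo n y))).
  by apply: bm_add => //; apply: bm_mul; [exact: bm_cst|exact: bm_phi_u].
have EE c : (fun y => E c (istereo n y)) = (fun y => c * (kappa * potential a F (fun i : 'I_n.+1 => st i y) +
    (- 1) * (phi (istereo n y) * u (istereo n y)))).
  by apply/funext => y; rewrite /E mulN1r.
have bE c : bm n (fun y => E c (istereo n y)).
  by rewrite EE; apply: bm_mul => //; exact: bm_cst.
have oE c : harmonic_orth n (fun y => E c (istereo n y)).
  move=> k p hp lp; have bp := bm_pst p.
  rewrite (_ : (fun y => _) = (fun y => c * (kappa * (potential a F (fun i : 'I_n.+1 => st i y) * pst p y) +
    (- 1) * (phi (istereo n y) * u (istereo n y) * pst p y)))); last first.
    by apply/funext => y; rewrite /E /st; ring.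
  have b1 := bm_mul bP bp; have b2 := bm_mul bm_phi_u bp.
  rewrite (Lam_cmul n2); last by apply: bm_add; apply: bm_mul => //; exact: bm_cst.
  rewrite (Lam_add n2); [|by apply: bm_mul => //; exact: bm_cst|by apply: bm_mul => //; exact: bm_cst].
  rewrite (Lam_cmul n2 _ b1) (Lam_cmul n2 _ b2) (Lam_potential_harmonic hp lp) (D k p hp lp).
  have := kappa_Sk k; set L := Lam _ _ => kS.
  by rewrite (_ : _ + _ = (kappa * Sk n a k * Ps_eig n s k - 1) * L); [rewrite kS subrr mul0r mulr0|ring].
have cphiu : scont (fun x => phi x * u x) z.
  apply: within_scont => //; apply/subspace_continuousP => x Sx.
  by apply: cvgM; [have /subspace_continuousP := cphi|have /subspace_continuousP := cu]; apply.
have cE c : `|c| = 1 -> scont (E c) z.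
  move=> c1 e e0; have e2 : 0 < e / 2 by rewrite divr_gt0.
  have k0 : 0 < `|kappa| + 1 by rewrite ltr_wpDl.
  have [d1 d10 h1] := potential_continuous n2 a0 an bm_rhs (Sz : unitv (crd z)) (divr_gt0 e2 k0).
  have [d2 d20 h2] := cphiu _ e2.
  exists (Num.min d1 d2) => [|x Sx hx]; first by rewrite lt_min d10.
  have {}h1 := h1 _ (Sx : unitv (crd x)).
  have /h1 : forall i, `|z ord0 i - x ord0 i| < d1.
    by move=> i; apply: lt_le_trans (hx i) _; rewrite ge_min lexx.
  have /(h2 _ Sx) : forall i, `|z ord0 i - x ord0 i| < d2.
    by move=> i; apply: lt_le_trans (hx i) _; rewrite ge_min lexx orbT.
  move=> {}h2; rewrite ltr_pdivlMr// => {}h1; rewrite /E -mulrBr normrM c1 mul1r.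
  have -> (p q b c' : R) : kappa * p - b - (kappa * q - c') = kappa * (p - q) - (b - c') by ring.
  apply: (le_lt_trans (ler_normB _ _)); rewrite [ltRHS]splitr ltrD//.
  by apply: le_lt_trans h1; rewrite normrM mulrC ler_wpM2l// lerDl.
have H c : `|c| = 1 -> E c z <= 0.
  move=> c1; rewrite leNgt; apply/negP => Ez.
  have e0 : 0 < E c z / 2 by rewrite divr_gt0.
  have [d d0 hd] := cE c c1 _ e0; have [[M hM] _] := bE c.
  pose d' := Num.min d 1.
  have d'0 : 0 < d' by rewrite lt_min d0 ltr01.
  have d'1 : d' <= 1 by rewrite ge_min lexx orbT.
  have d2 : 0 < d' ^+ 2 <= 1 by rewrite exprn_gt0//= exprn_ile1// ltW.
  have /andP[d20 d21] := d2.
  (* Since 1 - v = |z - x|^2 / 4, values of v above this level force |z - x| < d'; the bound d' <= 1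
     keeps the level positive. *)
  have q0 : 0 < 1 - d' ^+ 2 / 4 by lra.
  have q1 : 1 - d' ^+ 2 / 4 < 1 by lra.
  have v1 : unitv (crd z) by exact: Sz.
  apply: (peak n2 (bE c) v1 e0 q0 q1 hM); last exact: (harmonic_orth_vz n2 (bE c) v1 (oE c)).
  move=> y vq; have := hd _ (istereo_sphere n y).
  have hi i : `|z ord0 i - istereo n y ord0 i| < d.
    apply: (@lt_le_trans _ _ d'); last by rewrite ge_min lexx.
    rewrite -(@ltr_pXn2r _ 2) ?nnegrE ?(ltW d'0)// real_normK ?num_real//.
    have := oneB_vz y v1; rewrite (bigD1 i)//=.
    have : 0 <= \sum_(j < n.+1 | j != i) (z ord0 j - st j y) ^+ 2.
      by apply: sumr_ge0 => j _; exact: sqr_ge0.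
    by rewrite -/(st i y); move: vq; lra.
  by move=> /(_ hi); rewrite ltr_norml => /andP[_]; lra.
have := H 1 (normr1 _); have := H (- 1); rewrite normrN1 /E => /(_ erefl).
by rewrite mul1r mulN1r -/F; lra.
Qed.

End solution.
End conformal.
End integral_equation.

Theorem theorem3p4 (R : realType) (n : nat) (s : R)
    (phi : 'rV[R]_(n.+1) -> R) (Rg : 'rV[R]_(n.+1) -> R) (f : R -> R) :
  (3 <= n)%N -> 0 < 2 * s -> 2 * s < n%:R ->
  smooth_on_sphere n phi -> (forall x, sphere n x -> 0 < phi x) ->
  (* R^g_s = P^g_s(1) *)
  {within sphere n, continuous Rg} -> Pg_eq n s phi (fun _ => 1) Rg ->
  continuous f ->
  (* (i) continuous nonnegative solutions of (I) solve (D) *)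
  (forall u : 'rV[R]_(n.+1) -> R,
      {within sphere n, continuous u} ->
      (forall x, sphere n x -> 0 <= u x) ->
      (forall z, sphere n z ->
         (u z)%:E = ((cns n s)%:E *
           sint n (fun w => ((f (u w) + Rg w * u w) / Kker n s phi z w
                            * vol_dens n s phi w)%R))%E) ->
      Pg_eq n s phi u (fun x => f (u x) + Rg x * u x))
  /\
  (* (ii) under the sign condition, smooth nonnegative solutions of (D)
     solve (I) *)
  ((forall z t, sphere n z -> 0 <= t -> 0 <= f t + Rg z * t) ->
   forall u : 'rV[R]_(n.+1) -> R,
      smooth_on_sphere n u ->
      (forall x, sphere n x -> 0 <= u x) ->
      Pg_eq n s phi u (fun x => f (u x) + Rg x * u x) ->
      forall z, sphere n z ->
         (u z)%:E = ((cns n s)%:E *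
           sint n (fun w => ((f (u w) + Rg w * u w) / Kker n s phi z w
                            * vol_dens n s phi w)%R))%E).
Proof.
move=> n3 s0 sn /smooth_within cphi phi0 cRg _ cf; split=> [u cu _ I|_ u /smooth_within cu _ D].
  apply: (integral_to_differential n3 s0 sn cphi phi0 cRg cf cu).
  exact/(integral_equationP n3 s0 sn cphi phi0 cRg cf cu).
apply/(integral_equationP n3 s0 sn cphi phi0 cRg cf cu).
exact: (differential_to_integral n3 s0 sn cphi phi0 cRg cf cu).
Qed.
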